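(* Let $\{A_{(\alpha)}\}_{\alpha\in\mathbb F_n^+}$ and $\{B_{(\alpha)}\}_{\alpha\in\mathbb F_n^+\setminus\{g_0\}}$ be operators in $B(\mathcal E)$, with $A_{(0)}:=A_{(g_0)}$. Then the formal series $$\varphi(W):=\sum_{|\alpha|\ge1}B_{(\alpha)}\otimes W_\alpha^*+A_{(0)}\otimes I+\sum_{|\alpha|\ge1}A_{(\alpha)}\otimes W_\alpha$$ is the formal Fourier representation of a weighted right multi-Toeplitz operator $T\in B(\mathcal E\otimes F^2(H_n))$ if and only if (i) $\sum_{|\alpha|\ge1}\frac1{b^{(m)}_\alpha}A_{(\alpha)}^*A_{(\alpha)}$ and $\sum_{|\alpha|\ge1}\frac1{b^{(m)}_\alpha}B_{(\alpha)}B_{(\alpha)}^*$ are WOT-convergent series, and (ii) $\sup_{0\le r<1}\|\varphi(rW)\|<\infty$. Moreover, in this case: (a) for each $r\in[0,1)$ the operator $$\varphi(rW):=\sum_{k=1}^\infty\sum_{|\alpha|=k}B_{(\alpha)}\otimes r^{|\alpha|}W_\alpha^*+A_{(0)}\otimes I+\sum_{k=1}^\infty\sum_{|\alpha|=k}A_{(\alpha)}\otimes r^{|\alpha|}W_\alpha$$ is in $\boldsymbol{\mathcal A}_{\mathcal E}({\bf D}_f^m)^*+\boldsymbol{\mathcal A}_{\mathcal E}({\bf D}_f^m)$, where the series converge in the operator norm topology; (b) $T=\text{SOT-}\lim_{r\to1}\varphi(rW)$; (c) $\|T\|=\sup_{0\le r<1}\|\varphi(rW)\|=\lim_{r\to1}\|\varphi(rW)\|=\sup_{q\in\mathcal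 E\otimes\mathcal P,\ \|q\|\le1}\|\varphi(W)q\|$.
   Context: Fix integers $n,m\ge1$ and a separable Hilbert space $\mathcal E$. $\mathbb F_n^+$ is the free monoid on generators $g_1,\dots,g_n$ with identity $g_0$; $|\alpha|$ is the word length ($|g_0|=0$). For operators (or indeterminates) and $\alpha=g_{i_1}\cdots g_{i_k}$ put $X_\alpha:=X_{i_1}\cdots X_{i_k}$, $X_{g_0}:=I$. $f=\sum_{\alpha}a_\alpha Z_\alpha$ is a fixed positive regular free holomorphic function: a formal power series in noncommuting indeterminates $Z_1,\dots,Z_n$ with $a_\alpha\ge0$, $a_{g_0}=0$, $a_{g_i}>0$ for $1\le i\le n$, and $\limsup_{k}\big(\sum_{|\alpha|=k}|a_\alpha|^2\big)^{1/2k}<\infty$. Put $b^{(m)}_{g_0}:=1$ and, for $|\alpha|\ge1$, $$b^{(m)}_\alpha:=\sum_{j=1}^{|\alpha|}\ \sum_{\gamma_1\cdots\gamma_j=\alpha,\ |\gamma_i|\ge1}a_{\gamma_1}\cdots a_{\gamma_j}\binom{j+m-1}{m-1}.$$ $F^2(H_n)$ (full Fock space) is the Hilbert space with orthonormal basis $\{e_\alpha\}_{\alpha\in\mathbb F_n^+}$, $e_{g_0}=1$; $\mathcal P$ is the linear span of the $e_\alpha$ and $\mathcal E\otimes\mathcal P$ is the set of finite sums $\sum h_\alpha\otimes e_\alpha$, $h_\alpha\in\mathcal E$. The weighted left creation operators $W_i\in B(F^2(H_n))$ are $W_ie_\alpha=\sqrt{b^{(m)}_\alpha/b^{(m)}_{g_i\alpha}}\,e_{g_i\alpha}$.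 The domain algebra $\mathcal A({\bf D}_f^m)$ is the norm closure of the polynomials in $W_1,\dots,W_n$ and the identity; $\boldsymbol{\mathcal A}_{\mathcal E}({\bf D}_f^m):=B(\mathcal E)\otimes_{min}\mathcal A({\bf D}_f^m)$ (spatial tensor product, i.e. norm closure of the algebraic tensor product in $B(\mathcal E\otimes F^2(H_n))$). For $\omega,\gamma\in\mathbb F_n^+$ write $\omega\ge_r\gamma$ if $\omega=\sigma\gamma$ for some $\sigma\in\mathbb F_n^+$, and $\omega>_r\gamma$ if moreover $\sigma\ne g_0$; $\omega,\gamma$ are comparable if $\omega\ge_r\gamma$ or $\gamma>_r\omega$. For comparable $\omega,\gamma$ put $\lambda_{\omega,\gamma}:=\sqrt{b^{(m)}_\omega/b^{(m)}_\gamma}$ if $\omega\ge_r\gamma$ and $\lambda_{\omega,\gamma}:=\sqrt{b^{(m)}_\gamma/b^{(m)}_\omega}$ if $\gamma>_r\omega$. For $T\in B(\mathcal E\otimes F^2(H_n))$ let $C_{\omega,\gamma}\in B(\mathcal E)$ be given by $\langle C_{\omega,\gamma}x,y\rangle=\langle T(x\otimes e_\gamma),y\otimes e_\omega\rangle$. $T$ is a weighted right multi-Toeplitz operator if $\lambda_{\omega g_i,\gamma g_i}C_{\omega g_i,\gamma g_i}=\lambda_{\omega,\gamma}C_{\omega,\gamma}$ for all $i$ and all comparable $\omega,\gamma$, and $C_{\alpha,\beta}=0$ whenever $\alpha,\beta$ are not comparable. The formal Fourier representation of a weighted right multi-Toeplitz $T$ is the formal series $\varphi(W)$ with coefficients determined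 by $\langle A_{(\alpha)}x,y\rangle=\sqrt{b^{(m)}_\alpha}\langle T(x\otimes1),y\otimes e_\alpha\rangle$ ($\alpha\in\mathbb F_n^+$) and $\langle B_{(\alpha)}x,y\rangle=\sqrt{b^{(m)}_\alpha}\langle T(x\otimes e_\alpha),y\otimes1\rangle$ ($|\alpha|\ge1$), $x,y\in\mathcal E$. For $q\in\mathcal E\otimes\mathcal P$, $\varphi(W)q:=\sum_{|\alpha|\ge1}(B_{(\alpha)}\otimes W_\alpha^* )q+\sum_{\alpha}(A_{(\alpha)}\otimes W_\alpha)q$ (well defined when (i) holds). In (ii), $\varphi(rW)$ is the operator given by the norm-convergent series displayed in (a). Limits $r\to1$ are over $r<1$. *)

(* Defs.v *)
From HB Require Import structures.
From mathcomp Require Import all_boot all_order all_algebra finmap.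
From mathcomp Require Import all_classical all_reals all_analysis.
From mathcomp Require Import complex.
From mathcomp.analysis.showcase Require Import summability.

Set Implicit Arguments.
Unset Strict Implicit.
Unset Printing Implicit Defensive.

Import Order.TTheory GRing.Theory Num.Theory.
Import numFieldNormedType.Exports.

Local Open Scope classical_set_scope.
Local Open Scope ring_scope.
Local Open Scope complex_scope.

(* The inner product is linear in its first argument. The norm of a
   normedModType over R[i] takes its (real) values in R[i]; hnorm below is the
   same norm with values in R. *)
HB.mixin Record CompleteNormedModule_isHilbert (R : realType) (E : Type)
    of CompleteNormedModule R[i] E := {
  inner : E -> E -> R[i] ;
  inner_linear : forall z : E, linear_for *%R (inner ^~ z) ;
  inner_conj : forall x y : E, inner y x = (inner x y)^* ;
  inner_norm : forall x : E, `|x| ^+ 2 = inner x x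
}.

#[short(type="hilbertType")]
HB.structure Definition Hilbert (R : realType) :=
  {E of CompleteNormedModule R[i] E & CompleteNormedModule_isHilbert R E}.

Section Operators.
Context {R : realType}.
Implicit Types E F H : hilbertType R.

Definition hnorm {E} (x : E) : R := complex.Re `|x|.

Definition separable_space E := exists2 D : set E, countable D & dense D.

Definition bounded_op {E F} : set (E -> F) :=
  [set T | linear T /\ exists M : R, forall x, hnorm (T x) <= M * hnorm x].

Definition opnorm {E F} (T : E -> F) : \bar R :=
  ereal_sup [set (hnorm (T x))%:E | x in [set x : E | hnorm x <= 1]].

(* Value 0 when no bounded adjoint exists (e.g. when T is not bounded). *)
Definition adjoint {E F} (T : E -> F) : F -> E :=
  xget 0 [set S | bounded_op S /\
                  forall x y, inner (T x) y = inner x (S y)].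

Definition op_cvg {H} (u : nat -> H -> H) (T : H -> H) :=
  bounded_op T /\ opnorm (u N - T) @[N --> \oo] --> 0%E.

Definition op_lim {H} (u : nat -> H -> H) : H -> H :=
  xget 0 [set T | op_cvg u T].

Definition op_closure {H} (D : set (H -> H)) : set (H -> H) :=
  [set T | bounded_op T /\
           forall eps : R, 0 < eps ->
             exists2 S, D S & (opnorm (T - S)%R < eps%:E)%E].

Definition orthonormal_basis (I : eqType) F (e : I -> F) :=
  (forall i j, inner (e i) (e j) = (i == j)%:R) /\
  dense [set z : F | exists (s : seq I) (c : I -> R[i]),
                       z = \sum_(i <- s) c i *: e i].

(* (H, tens) is a Hilbert space tensor product of E and F; this determines it
   up to a unitary compatible with the elementary tensors. *)
Record hilbert_tensor E F H (tens : E -> F -> H) : Prop := HilbertTensor {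
  tens_linearl : forall u, linear (tens ^~ u) ;
  tens_linearr : forall x, linear (tens x) ;
  tens_inner : forall x u y v,
    inner (tens x u) (tens y v) = inner x y * inner u v ;
  tens_dense : dense [set z : H | exists s : seq (E * F),
                                    z = \sum_(p <- s) tens p.1 p.2]
}.

(* The bounded operator A (x) X; it exists and is unique for bounded A, X. *)
Definition tensop E F H (tens : E -> F -> H) (A : E -> E) (X : F -> F) :
    H -> H :=
  xget 0 [set T | bounded_op T /\
                  forall x u, T (tens x u) = tens (A x) (X u)].

(* Norm closure of the algebraic tensor product of B(E) and the algebra AF. *)
Definition spatial_tensor E F H (tens : E -> F -> H) (AF : set (F -> F)) :
    set (H -> H) :=
  op_closure [set S | exists (k : nat) (A : 'I_k -> E -> E) (X : 'I_k -> F -> F),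
    (forall i, bounded_op (A i) /\ AF (X i)) /\
    S = \sum_(i < k) tensop tens (A i) (X i)].

Definition star_plus {H} (D : set (H -> H)) : set (H -> H) :=
  [set T | exists S1 S2, [/\ D S1, D S2 & T = adjoint S1 + S2]].

End Operators.

(* The free monoid on n generators is seq 'I_n: product ++, unit [::], length
   size. *)
Notation word n := (seq 'I_n).

Definition nontrivial {n} (alpha : word n) : bool := alpha != [::].

(* Finite partial sums over the words satisfying P; the sums over all such
   words are the (unordered) limits of these along the filter totally. *)
Definition word_psum {n} {V : zmodType} (P : pred (word n)) (u : word n -> V)
    (J : {fset word n}) : V :=
  \sum_(alpha <- J | P alpha) u alpha.

Definition wot_summable {R : realType} {E : hilbertType R} {n}
    (P : pred (word n)) (u : word n -> E -> E) :=
  exists2 S, bounded_op S &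
    forall x y : E,
      inner (word_psum P u J x) y @[J --> totally] --> (inner (S x) y : R[i]^o).

Record positive_regular {R : realType} {n} (a : word n -> R) : Prop :=
  PositiveRegular {
  posreg_ge0 : forall alpha, 0 <= a alpha ;
  posreg_unit : a [::] = 0 ;
  posreg_gen : forall i, 0 < a [:: i] ;
  posreg_limsup :
    (limn_esup (fun k => ((\sum_(alpha : k.-tuple 'I_n) `|a alpha| ^+ 2)
                            `^ (2 * k%:R)^-1)%:E) < +oo)%E
}.

(* A factorisation gamma_1...gamma_j = alpha is a j-tuple of words, each of
   length at most |alpha|. *)
Definition bcoef {R : realType} {n} (m : nat) (a : word n -> R)
    (alpha : word n) : R :=
  if alpha is [::] then 1 else
  \sum_(1 <= j < (size alpha).+1)
    \sum_(gamma : j.-tuple ((size alpha).-bseq 'I_n) |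
           (flatten [seq bseqval w | w <- gamma] == alpha) &&
           all (fun w => 1 <= size (bseqval w))%N gamma)
      (\prod_(w <- gamma) a (bseqval w)) * 'C(j + m - 1, m - 1)%:R.

Definition rge {n} (omega gamma : word n) : bool := suffix gamma omega.
Definition rgt {n} (omega gamma : word n) : bool :=
  rge omega gamma && (omega != gamma).
Definition rcomparable {n} (omega gamma : word n) : bool :=
  rge omega gamma || rgt gamma omega.

(* Only meaningful on comparable pairs. *)
Definition rweight {R : realType} {n} (b : word n -> R) (omega gamma : word n) :
    R :=
  if rge omega gamma then Num.sqrt (b omega / b gamma)
  else Num.sqrt (b gamma / b omega).

(* E is the coefficient space, (e_alpha) the orthonormal basis of the Fock
   space F, tens : E -> F -> H the tensor product, b the weights b^(m). *)
Section MultiToeplitz.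
Context {R : realType} {n : nat} {E F H : hilbertType R}.
Variables (e : word n -> F) (tens : E -> F -> H) (b : word n -> R).

Definition creation (i : 'I_n) : F -> F :=
  xget 0 [set T | bounded_op T /\
    forall alpha, T (e alpha) =
      (Num.sqrt (b alpha / b (i :: alpha)))%:C *: e (i :: alpha)].

Definition creation_word (alpha : word n) : F -> F :=
  foldr (fun i T => creation i \o T) id alpha.

Definition domain_algebra : set (F -> F) :=
  op_closure [set X | exists (s : seq (word n)) (c : word n -> R[i]),
    X = \sum_(alpha <- s) c alpha *: creation_word alpha].

Definition entry (T : H -> H) (omega gamma : word n) : E -> E :=
  xget 0 [set C | bounded_op C /\
    forall x y, inner (C x) y =
                inner (T (tens x (e gamma))) (tens y (e omega))].

Definition multi_Toeplitz (T : H -> H) :=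
  [/\ bounded_op T,
      forall (i : 'I_n) (omega gamma : word n), rcomparable omega gamma ->
        (rweight b (rcons omega i) (rcons gamma i))%:C *:
          entry T (rcons omega i) (rcons gamma i) =
        (rweight b omega gamma)%:C *: entry T omega gamma
    & forall alpha beta : word n, ~~ rcomparable alpha beta ->
        entry T alpha beta = 0].

Definition fourier_representation (A B : word n -> E -> E) (T : H -> H) :=
  (forall alpha (x y : E), inner (A alpha x) y =
    (Num.sqrt (b alpha))%:C *
      inner (T (tens x (e [::]))) (tens y (e alpha))) /\
  (forall alpha (x y : E), nontrivial alpha -> inner (B alpha x) y =
    (Num.sqrt (b alpha))%:C *
      inner (T (tens x (e alpha))) (tens y (e [::]))).

Definition E_poly : set H :=
  [set q | exists (s : seq (word n)) (h : word n -> E),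
             q = \sum_(alpha <- s) tens (h alpha) (e alpha)].

Variables (A B : word n -> E -> E).

(* The two infinite series of phi(rW), as sequences of partial sums. *)
Definition phi_r_Bpsum (r : R) (N : nat) : H -> H :=
  \sum_(1 <= k < N.+1) \sum_(alpha : k.-tuple 'I_n)
    tensop tens (B alpha) ((r ^+ size alpha)%:C *: adjoint (creation_word alpha)).

Definition phi_r_Apsum (r : R) (N : nat) : H -> H :=
  \sum_(1 <= k < N.+1) \sum_(alpha : k.-tuple 'I_n)
    tensop tens (A alpha) ((r ^+ size alpha)%:C *: creation_word alpha).

Definition phi_r (r : R) : H -> H :=
  op_lim (phi_r_Bpsum r) + tensop tens (A [::]) id + op_lim (phi_r_Apsum r).

Definition phi_W (q : H) : H :=
  lim (word_psum nontrivial
         (fun alpha => tensop tens (B alpha) (adjoint (creation_word alpha)) q) J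
       @[J --> totally]) +
  lim (word_psum predT
         (fun alpha => tensop tens (A alpha) (creation_word alpha) q) J
       @[J --> totally]).

End MultiToeplitz.

(* Main.v *)
Require Import Defs.
From HB Require Import structures.
From mathcomp Require Import all_boot all_order all_algebra finmap.
From mathcomp Require Import all_classical all_reals all_analysis.
From mathcomp Require Import complex.
From mathcomp.analysis.showcase Require Import summability.
From mathcomp Require Import ring lra zify.

(* Let K(omega, gamma) be the operator matrix with entries
   sqrt (b_gamma / b_(alpha gamma)) A_alpha at (alpha gamma, gamma),
   sqrt (b_gamma / b_(alpha gamma)) B_alpha at (gamma, alpha gamma), and 0 at
   incomparable words: T is weighted multi-Toeplitz with the given Fourier
   representation iff it is bounded with matrix K.  The inequality
   b_beta b_gamma <= binom (|beta| + m - 1, m - 1) b_(beta gamma) bounds the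
   degree k part of phi(rW) by r^k times the square root of a polynomial in k, so
   that the series converge in norm and phi(rW) has matrix
   r^| |omega| - |gamma| | K(omega, gamma).  Now (r^|j - k|) is the Gram matrix of
   a sequence of unit vectors, so phi(rW) is a Schur multiple of T by a positive
   definite kernel with diagonal 1, whence ||phi(rW)|| <= ||T||.  On the vectors
   x (x) e_gamma, phi(rW) is phi(W) followed by a diagonal contraction that tends
   strongly to the identity as r -> 1; together with a uniform bound this gives
   strong convergence on the whole space, both for a given T and for the T that
   has to be constructed from (ii). *)

Set Implicit Arguments.
Unset Strict Implicit.
Unset Printing Implicit Defensive.

Import Order.TTheory GRing.Theory Num.Theory.
Import numFieldNormedType.Exports.

Local Open Scope classical_set_scope.
Local Open Scope ring_scope.
Local Open Scope complex_scope.

(** The inequality between the weights comes from concatenating factorisations and is used in two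
    mirror forms. With the binomial in |beta| it bounds W_beta uniformly, and half of the powers of
    r absorbs the polynomial growth. With the binomial in |gamma| it makes the A series of phi(W)
    converge on x (x) e_gamma, but the constant then depends on |gamma|, so phi(W) is handled on
    polynomials only and everything else goes through phi(rW). The diagonal contraction that relates
    phi(rW) to phi(W) differs for each |gamma|. It therefore gives limits on monomials but no bound
    on sums of mixed degree; the uniform bound has to come from the Schur multiplier. Adjoints,
    tensor products, creation operators, matrix entries and norm limits are all chosen by [xget],
    with default 0, so each needs an existence proof: the Riesz theorem, extension from an
    orthogonal total family, or completeness. The B series is the adjoint of an A series whose
    coefficients are the adjoints of B_alpha, so only creation operators are ever estimated. *)

Local Notation normc := Normc.normc.
Local Notation Re := complex.Re.

#[local] Existing Instance totally_filter.

(** * Hilbert spaces and bounded operators *)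

Section HilbertBasics.
Context {R : realType} {H : hilbertType R}.
Implicit Types (x y z : H) (c : R[i]) (r : R).

Lemma innerDl x y z : inner (x + y) z = inner x z + inner y z.
Proof. by have := inner_linear z 1 x y; rewrite scale1r /= mul1r. Qed.

Lemma inner0l z : inner 0 z = 0 :> R[i].
Proof. by apply: (addIr (inner 0 z)); rewrite -innerDl addr0 add0r. Qed.

Lemma innerZl c x z : inner (c *: x) z = c * inner x z.
Proof. by have := inner_linear z c x 0; rewrite addr0 inner0l addr0. Qed.

Lemma innerNl x z : inner (- x) z = - inner x z.
Proof. by rewrite -scaleN1r innerZl mulN1r. Qed.

Lemma innerBl x y z : inner (x - y) z = inner x z - inner y z.
Proof. by rewrite innerDl innerNl. Qed.

Lemma inner_suml I (s : seq I) (P : pred I) (f : I -> H) z :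
  inner (\sum_(i <- s | P i) f i) z = \sum_(i <- s | P i) inner (f i) z.
Proof.
apply: (big_morph (fun x => inner x z)) => [x y|]; [exact: innerDl|exact: inner0l].
Qed.

Lemma innerDr x y z : inner x (y + z) = inner x y + inner x z.
Proof. by rewrite inner_conj innerDl rmorphD /= -!inner_conj. Qed.

Lemma inner0r x : inner x 0 = 0 :> R[i].
Proof. by rewrite inner_conj inner0l rmorph0. Qed.

Lemma innerZr c x z : inner x (c *: z) = conjc c * inner x z.
Proof. by rewrite inner_conj innerZl rmorphM /= -inner_conj. Qed.

Lemma innerNr x z : inner x (- z) = - inner x z.
Proof. by rewrite inner_conj innerNl rmorphN /= -inner_conj. Qed.

Lemma innerBr x y z : inner x (y - z) = inner x y - inner x z.
Proof. by rewrite innerDr innerNr. Qed.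

Lemma inner_sumr I (s : seq I) (P : pred I) (f : I -> H) z :
  inner z (\sum_(i <- s | P i) f i) = \sum_(i <- s | P i) inner z (f i).
Proof.
apply: (big_morph (fun x => inner z x)) => [x y|]; [exact: innerDr|exact: inner0r].
Qed.

Lemma norm_hnorm x : `|x| = (hnorm x)%:C.
Proof.
rewrite /hnorm; have : 0 <= `|x| by exact: normr_ge0.
by case: `|x| => a b; rewrite lecE /= => /andP[/eqP -> _].
Qed.

Lemma hnorm_ge0 x : 0 <= hnorm x.
Proof. by have := normr_ge0 x; rewrite norm_hnorm lecR. Qed.

Lemma inner_hnorm x : inner x x = (hnorm x ^+ 2)%:C.
Proof. by rewrite -inner_norm norm_hnorm -rmorphXn. Qed.

Lemma hnorm_sqr x : hnorm x ^+ 2 = Re (inner x x).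
Proof. by rewrite inner_hnorm. Qed.

Lemma hnormZ c x : hnorm (c *: x) = normc c * hnorm x.
Proof.
apply: (@complexI R); rewrite -norm_hnorm normrZ norm_hnorm rmorphM /=; congr (_ * _).
Qed.

Lemma hnormZr r x : hnorm (r%:C *: x) = `|r| * hnorm x.
Proof. by rewrite hnormZ /= expr0n addr0 sqrtr_sqr. Qed.

Lemma hnorm0 : hnorm (0 : H) = 0.
Proof. by apply: (@complexI R); rewrite -norm_hnorm normr0. Qed.

Lemma hnorm0_eq0 x : hnorm x = 0 -> x = 0.
Proof. by move=> h; apply/eqP; rewrite -normr_eq0 norm_hnorm h. Qed.

Lemma hnormN x : hnorm (- x) = hnorm x.
Proof. by rewrite /hnorm normrN. Qed.

Lemma ler_hnormD x y : hnorm (x + y) <= hnorm x + hnorm y.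
Proof. by rewrite -lecR rmorphD /= -!norm_hnorm ler_normD. Qed.

Lemma hdistC x y : hnorm (x - y) = hnorm (y - x).
Proof. by rewrite -hnormN opprB. Qed.

Lemma hdistD z x y : hnorm (x - y) <= hnorm (x - z) + hnorm (z - y).
Proof. by rewrite -{1}(subrK z x) -addrA ler_hnormD. Qed.

Lemma Re_innerC x y : Re (inner x y) = Re (inner y x).
Proof. by rewrite inner_conj; case: (inner y x). Qed.

Lemma hnormD_sqr x y :
  hnorm (x + y) ^+ 2 = hnorm x ^+ 2 + hnorm y ^+ 2 + 2 * Re (inner x y).
Proof.
rewrite !hnorm_sqr innerDl !innerDr !raddfD /= (Re_innerC y x); ring.
Qed.

Lemma hnormB_sqr x y :
  hnorm (x - y) ^+ 2 = hnorm x ^+ 2 + hnorm y ^+ 2 - 2 * Re (inner x y).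
Proof. by rewrite hnormD_sqr hnormN innerNr raddfN /= mulrN. Qed.

(** Cauchy-Schwarz for the real part: the square of |y| x - |x| y is nonnegative, and 2 |x| |y| can
    be cancelled from its expansion. *)
Lemma Re_inner_le x y : Re (inner x y) <= hnorm x * hnorm y.
Proof.
have [x0|x0] := eqVneq (hnorm x) 0.
  by rewrite x0 (hnorm0_eq0 x0) inner0l mul0r.
have [y0|y0] := eqVneq (hnorm y) 0.
  by rewrite y0 (hnorm0_eq0 y0) inner0r mulr0.
have px : 0 < hnorm x by rewrite lt_def x0 hnorm_ge0.
have py : 0 < hnorm y by rewrite lt_def y0 hnorm_ge0.
have := sqr_ge0 (hnorm ((hnorm y)%:C *: x - (hnorm x)%:C *: y)).
rewrite hnormB_sqr !hnormZr innerZl innerZr !ger0_norm ?hnorm_ge0//.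
rewrite conjc_real mulrA -rmorphM /=.
case: (inner x y) => u v /=; rewrite mul0r subr0 => h.
have {}h : 0 <= (2 * hnorm x * hnorm y) * (hnorm x * hnorm y - u) by nra.
by move: h; rewrite pmulr_rge0 ?subr_ge0// !mulr_gt0.
Qed.

(** Multiplying [y] by c = [inner x y] turns the inner product into the real number |c|^2, so the
    bound on real parts applies, and |c| cancels. *)
Lemma normc_inner_le x y : normc (inner x y) <= hnorm x * hnorm y.
Proof.
set c := inner x y.
have h0 : 0 <= normc c by rewrite -lecR; exact: (normr_ge0 c).
have h2 : normc c ^+ 2 = Re (conjc c * c).
  rewrite /c; case: (inner x y) => u v /=; rewrite sqr_sqrtr ?addr_ge0 ?sqr_ge0//; ring.
have := Re_inner_le x (c *: y); rewrite innerZr -/c -h2 hnormZ mulrCA expr2.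
have [->|c0] := eqVneq (normc c) 0; first by rewrite mulr_ge0 ?hnorm_ge0.
by rewrite ler_pM2l// lt_def c0 h0.
Qed.

Lemma Re_inner_ge x y : - (hnorm x * hnorm y) <= Re (inner x y).
Proof. by rewrite lerNl -raddfN -innerNl (le_trans (Re_inner_le _ _))// hnormN. Qed.

Lemma inner_eq0 x : (forall y, Re (inner x y) = 0) -> x = 0.
Proof.
by move=> /(_ x); rewrite -hnorm_sqr => /eqP; rewrite sqrf_eq0 => /eqP/hnorm0_eq0.
Qed.

Lemma inner_ext x y : (forall z, inner x z = inner y z) -> x = y.
Proof.
by move=> h; apply/eqP; rewrite -subr_eq0; apply/eqP/inner_eq0 => z; rewrite innerBl h subrr.
Qed.

(** A positive element of [R[i]] has zero imaginary part, so the complex epsilons of the library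
    criterion are real ones. *)
Lemma hcvgP T (G : set_system T) {FG : Filter G} (f : T -> H) (l : H) :
  f @ G --> l <-> forall eps : R, 0 < eps -> \forall t \near G, hnorm (f t - l) < eps.
Proof.
split.
  move=> /cvgrPdist_lt h eps eps0.
  have := h eps%:C; rewrite ltcR => /(_ eps0); apply: filterS => t.
  by rewrite -normrN opprB norm_hnorm ltcR.
move=> h; apply/cvgrPdist_lt => -[e1 e2]; rewrite ltcE /= => /andP[/eqP-> e10].
have := h _ e10; apply: filterS => t.
by rewrite -normrN opprB norm_hnorm ltcR.
Qed.

Lemma hcauchy T (G : set_system T) {FG : ProperFilter G} (f : T -> H) :
  (forall eps : R, 0 < eps -> exists z, \forall t \near G, hnorm (f t - z) < eps) ->
  exists l : H, f @ G --> l.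
Proof.
move=> h; have : cvg (f @ G); last by move=> c; exists (lim (f @ G)).
apply: cauchy_cvg; apply: cauchy_exP => -[e1 e2]; rewrite ltcE /= => /andP[/eqP-> e10].
have [z hz] := h _ e10; exists z; rewrite /ball_ /=.
by apply: filterS hz => t; rewrite -ball_normE /= -normrN opprB norm_hnorm ltcR.
Qed.

End HilbertBasics.

Section LinearMaps.
Context {K : pzRingType} {V W : lmodType K} (f : V -> W).
Hypothesis f_lin : linear f.

Lemma linD x y : f (x + y) = f x + f y.
Proof. by have := f_lin 1 x y; rewrite !scale1r. Qed.

Lemma lin0 : f 0 = 0.
Proof. by apply: (addIr (f 0)); rewrite -linD !add0r. Qed.

Lemma linZ c x : f (c *: x) = c *: f x.
Proof. by have := f_lin c x 0; rewrite !addr0 lin0 addr0. Qed.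

Lemma linN x : f (- x) = - f x.
Proof. by rewrite -scaleN1r linZ scaleN1r. Qed.

Lemma linB x y : f (x - y) = f x - f y.
Proof. by rewrite linD linN. Qed.

Lemma lin_sum I (s : seq I) (P : pred I) (u : I -> V) :
  f (\sum_(i <- s | P i) u i) = \sum_(i <- s | P i) f (u i).
Proof. exact: (big_morph f linD lin0). Qed.

End LinearMaps.

Section BoundedOps.
Context {R : realType}.
Implicit Types E F H : hilbertType R.

Lemma bounded_op_ge0 E F (T : E -> F) : bounded_op T ->
  exists2 M : R, 0 <= M & forall x, hnorm (T x) <= M * hnorm x.
Proof.
move=> [_ [M hM]]; exists `|M|; first exact: normr_ge0.
by move=> x; rewrite (le_trans (hM x))// ler_wpM2r ?hnorm_ge0// ler_norm.
Qed.

Lemma bounded_op0 E F : bounded_op (0 : E -> F).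
Proof.
split; first by move=> a u v /=; rewrite scaler0 addr0.
by exists 0 => x; rewrite hnorm0 mul0r.
Qed.

Lemma bounded_op_id E : bounded_op (id : E -> E).
Proof. by split=> //; exists 1 => x; rewrite mul1r. Qed.

Lemma bounded_opD E F (S T : E -> F) :
  bounded_op S -> bounded_op T -> bounded_op (S + T).
Proof.
move=> [lS [M hM]] [lT [N hN]]; split.
  by move=> a u v; rewrite !fctE lS lT scalerDr !addrA (addrAC (a *: S u)).
by exists (M + N) => x; rewrite fctE mulrDl (le_trans (ler_hnormD _ _))// lerD.
Qed.

Lemma bounded_opZ E F c (T : E -> F) : bounded_op T -> bounded_op (c *: T).
Proof.
move=> [lT [N hN]]; split.
  by move=> a u v; rewrite !fctE lT scalerDr !scalerA mulrC.
exists (normc c * N) => x; rewrite fctE hnormZ -mulrA ler_wpM2l//.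
by rewrite -lecR; exact: (normr_ge0 c).
Qed.

Lemma bounded_opN E F (T : E -> F) : bounded_op T -> bounded_op (- T).
Proof. by move=> hT; rewrite -scaleN1r; exact: bounded_opZ. Qed.

Lemma bounded_opB E F (S T : E -> F) :
  bounded_op S -> bounded_op T -> bounded_op (S - T).
Proof. by move=> hS hT; apply: bounded_opD => //; exact: bounded_opN. Qed.

Lemma bounded_op_sum E F I (s : seq I) (P : pred I) (T : I -> E -> F) :
  (forall i, P i -> bounded_op (T i)) -> bounded_op (\sum_(i <- s | P i) T i).
Proof.
move=> h; apply: (big_ind (fun T => bounded_op T)) => //.
- exact: bounded_op0.
- exact: bounded_opD.
Qed.

Lemma bounded_op_comp E F H (S : F -> H) (T : E -> F) :
  bounded_op S -> bounded_op T -> bounded_op (S \o T).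
Proof.
move=> hS hT; split; first by move=> a u v /=; rewrite hT.1 hS.1.
have [M M0 hM] := bounded_op_ge0 hS; have [N N0 hN] := bounded_op_ge0 hT.
by exists (M * N) => x /=; rewrite (le_trans (hM _))// -mulrA ler_wpM2l.
Qed.

Lemma le_opnorm E F (T : E -> F) (M : R) : 0 <= M ->
  (forall x, hnorm (T x) <= M * hnorm x) -> (opnorm T <= M%:E)%E.
Proof.
move=> M0 h; apply: ub_ereal_sup => _ [x /= x1 <-]; rewrite lee_fin.
by rewrite (le_trans (h x))// -[leRHS]mulr1 ler_wpM2l.
Qed.

Lemma opnorm_le E F (T : E -> F) (M : R) : linear T ->
  (opnorm T <= M%:E)%E -> forall x, hnorm (T x) <= M * hnorm x.
Proof.
move=> lT h x; have [x0|x0] := eqVneq (hnorm x) 0.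
  by rewrite x0 mulr0 (hnorm0_eq0 x0) (lin0 lT) hnorm0.
have px : 0 < hnorm x by rewrite lt_def x0 hnorm_ge0.
have : ((hnorm (T (((hnorm x)^-1)%:C *: x)))%:E <= M%:E)%E.
  apply: le_trans h; apply: ereal_sup_ubound; exists (((hnorm x)^-1)%:C *: x) => //=.
  by rewrite hnormZr ger0_norm ?invr_ge0 ?hnorm_ge0// mulVf.
rewrite lee_fin (linZ lT) hnormZr ger0_norm ?invr_ge0 ?hnorm_ge0//.
by rewrite mulrC ler_pdivrMr.
Qed.

Lemma opnorm_ge0 E F (T : E -> F) : (0 <= opnorm T)%E.
Proof.
apply: (@le_trans _ _ (hnorm (T 0))%:E); first by rewrite lee_fin hnorm_ge0.
by apply: ereal_sup_ubound; exists 0 => //=; rewrite hnorm0 ler01.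
Qed.

Lemma opnorm_fin E F (T : E -> F) : bounded_op T ->
  exists2 M : R, 0 <= M & opnorm T = M%:E.
Proof.
move=> hT; have [M M0 hM] := bounded_op_ge0 hT.
have := le_opnorm M0 hM; have := opnorm_ge0 T.
case: (opnorm T) => [r| |]//=; rewrite lee_fin => r0 _; by exists r.
Qed.

Lemma opnorm0 E F : opnorm (0 : E -> F) = 0%E.
Proof.
apply/eqP; rewrite eq_le opnorm_ge0 andbT; apply: le_opnorm => // x.
by rewrite hnorm0 mul0r.
Qed.

Lemma opnorm_ub E F (T : E -> F) x : hnorm x <= 1 -> ((hnorm (T x))%:E <= opnorm T)%E.
Proof. by move=> x1; apply: ereal_sup_ubound; exists x. Qed.

(* The representing vector minimises |y|^2 - 2 Re f(y). *)
Lemma riesz H (f : H -> R[i]) (M : R) :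
  (forall c x y, f (c *: x + y) = c * f x + f y) ->
  (forall x, normc (f x) <= M * hnorm x) ->
  exists v, forall x, f x = inner x v.
Proof.
move=> flin fM.
have normc_Re (z : R[i]) : Re z <= normc z.
  case: z => u v /=; rewrite (le_trans (ler_norm _))// -sqrtr_sqr ler_wsqrtr//.
  by rewrite lerDl sqr_ge0.
pose Phi y := hnorm y ^+ 2 - 2 * Re (f y).
(* Since Re f(y) <= M |y|, this is (|y| - M)^2 >= 0. *)
have Phi_ge y : - M ^+ 2 <= Phi y.
  have := le_trans (normc_Re _) (fM y); rewrite /Phi => h.
  by have := sqr_ge0 (hnorm y - M); nra.
have hinf : has_inf (range Phi).
  split; first by exists (Phi 0); exists 0.
  by exists (- M ^+ 2) => _ [y _ <-].
pose m := inf (range Phi).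
have m_le y : m <= Phi y by apply: ge_inf; [exact: hinf.2|exists y].
have ex k : exists y, Phi y < m + k.+1%:R^-1.
  have k0 : 0 < k.+1%:R^-1 :> R by rewrite invr_gt0 ltr0Sn.
  have [_ [y _ <-] hy] := inf_adherent k0 hinf.
  by exists y.
have [y hy] := choice ex.
have fD u v : f (u + v) = f u + f v by have := flin 1 u v; rewrite scale1r mul1r.
have f0 : f 0 = 0 by apply: (addIr (f 0)); rewrite -fD !add0r.
have fZ c u : f (c *: u) = c * f u by have := flin c u 0; rewrite f0 !addr0.
have reZ (r : R) (c : R[i]) : Re (r%:C * c) = r * Re c.
  by case: c => u v /=; rewrite mul0r subr0.
(* Parallelogram law, with [Phi] at the midpoint of u and v bounded below by m; hence a minimising
   sequence is Cauchy. *)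
have hpar u v : hnorm (u - v) ^+ 2 <= 2 * (Phi u + Phi v) - 4 * m.
  have := m_le ((2^-1)%:C *: (u + v)).
  rewrite /Phi hnormZr fZ fD reZ raddfD /= exprMn hnormD_sqr hnormB_sqr ger0_norm//.
  move=> h; have e : (2^-1 : R) * 2 = 1 by rewrite mulVf.
  nra.
have [v hv] : exists v : H, y @ \oo --> v.
  apply: hcauchy => eps eps0.
  have /(ltr_add_invr) [k] : (0 : R) < eps ^+ 2 / 4 by rewrite divr_gt0// exprn_gt0.
  rewrite add0r => hk; exists (y k); exists k => //= n kn.
  rewrite -(@ltr_pXn2r _ 2)// ?nnegrE ?hnorm_ge0 ?(ltW eps0)//.
  apply: le_lt_trans (hpar _ _) _.
  have h1 := hy k; have h2 := hy n.
  have h3 : n.+1%:R^-1 <= k.+1%:R^-1 :> R by rewrite lef_pV2 ?posrE ?ltr0Sn// ler_nat ltnS.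
  move: h1 h2 h3 hk; move: (k.+1%:R^-1 : R) (n.+1%:R^-1 : R) (Phi (y k)) (Phi (y n)).
  by move=> a b p q; lra.
(* First variation in the direction z. It is carried out along the minimising sequence [y n] and
   only then passed to the limit, so that continuity of [Phi] at v need not be proved. *)
have Revz z : Re (inner v z) = Re (f z).
  pose d := Re (inner v z) - Re (f z).
  have key t : 0 <= 2 * t * d + t ^+ 2 * hnorm z ^+ 2.
    rewrite leNgt; apply/negP => hneg.
    pose q := - (2 * t * d + t ^+ 2 * hnorm z ^+ 2).
    have q0 : 0 < q by rewrite oppr_gt0.
    pose C := 2 * `|t| * hnorm z + 1.
    have C0 : 0 < C by rewrite ltr_wpDl// !mulr_ge0 ?hnorm_ge0.
    have /hcvgP/(_ (q / 2 / C)) := hv.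
    have -> : 0 < q / 2 / C by rewrite !divr_gt0.
    move=> /(_ isT) [N1 _ hN1].
    have /ltr_add_invr [k] : 0 < q / 2 by rewrite divr_gt0.
    rewrite add0r => hk.
    pose n := maxn N1 k.
    have h1 := hN1 n (leq_maxl _ _); have h2 := hy n.
    have h3 : n.+1%:R^-1 <= k.+1%:R^-1 :> R.
      by rewrite lef_pV2 ?posrE ?ltr0Sn// ler_nat ltnS leq_maxr.
    have h4 := m_le (y n + t%:C *: z).
    have tz : Re (inner (y n) (t%:C *: z)) = t * Re (inner (y n) z).
      by rewrite innerZr conjc_real reZ.
    move: h4; rewrite /Phi hnormD_sqr hnormZr fD fZ raddfD /= reZ exprMn (real_normK (num_real t)) tz.
    move=> h4.
    have h5 : `|2 * t * (Re (inner (y n) z) - Re (inner v z))| < q / 2.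
      rewrite normrM -raddfB -innerBl.
      have : `|Re (inner (y n - v) z)| <= hnorm (y n - v) * hnorm z.
        by rewrite ler_norml Re_inner_ge Re_inner_le.
      have : hnorm (y n - v) * C < q / 2 by rewrite -ltr_pdivlMr.
      rewrite normrM (@ger0_norm _ 2)// /C => a1 a2.
      have t0 := normr_ge0 t; have z0 := hnorm_ge0 z; have w0 := hnorm_ge0 (y n - v).
      apply: le_lt_trans a1.
      apply: (@le_trans _ _ (2 * `|t| * (hnorm (y n - v) * hnorm z))).
        by rewrite ler_wpM2l// mulr_ge0.
      nra.
    move: h5; rewrite ltr_norml => /andP[h5 h6].
    rewrite /Phi in h2; rewrite /q /d in h5 h6 hk.
    move: h2 h3 h4 h5 h6 hk; move: (k.+1%:R^-1 : R) (n.+1%:R^-1 : R) => a b.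
    by move: (m) => m'; lra.
  have Z0 := sqr_ge0 (hnorm z).
  (* A nearly optimal t; the 1 in the denominator covers z = 0. The value is a negative multiple of
     d^2, so d = 0. *)
  have := key (- d / (1 + hnorm z ^+ 2)).
  set Z := hnorm z ^+ 2 in Z0 *.
  have Z1 : 0 < 1 + Z by lra.
  have -> : 2 * (- d / (1 + Z)) * d + (- d / (1 + Z)) ^+ 2 * Z =
            - (d ^+ 2 * ((2 + Z) / (1 + Z) ^+ 2)) by field; exact: lt0r_neq0.
  rewrite oppr_ge0 pmulr_lle0; last by rewrite divr_gt0 ?exprn_gt0// (lt_le_trans Z1)// lerD2r ler1n.
  move=> h; have : d ^+ 2 = 0 by apply/eqP; rewrite eq_le h sqr_ge0.
  by move/eqP; rewrite sqrf_eq0 subr_eq0 => /eqP.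
(* The real part at ['i *: z] is the imaginary part at z, up to sign. *)
exists v => z; have h1 := Revz z; have h2 := Revz ('i *: z).
move: h2; rewrite fZ innerZr; move: h1; rewrite (inner_conj v z).
case: (inner v z) => a b; case: (f z) => c d /= -> h.
by congr (_ +i* _); lra.
Qed.

Lemma adjoint_ex E F (T : E -> F) : bounded_op T ->
  exists S, bounded_op S /\ forall x y, inner (T x) y = inner x (S y).
Proof.
move=> hT; have [M M0 hM] := bounded_op_ge0 hT.
have ex y : exists v, forall x, inner (T x) y = inner x v.
  apply: (riesz (M := M * hnorm y)) => [c u v|x].
    by rewrite hT.1 innerDl innerZl.
  rewrite (le_trans (normc_inner_le _ _))// mulrAC ler_wpM2r ?hnorm_ge0//.
have [S hS] := choice ex; exists S; split=> //; split.
  move=> a u v; apply: inner_ext => z.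
  by rewrite inner_conj -hS innerDr innerZr !hS -innerZr -innerDr -inner_conj.
exists M => y; have [->|y0] := eqVneq (hnorm (S y)) 0.
  by rewrite mulr_ge0// hnorm_ge0.
have py : 0 < hnorm (S y) by rewrite lt_def y0 hnorm_ge0.
rewrite -(ler_pM2l py) -expr2 hnorm_sqr -hS.
by rewrite (le_trans (Re_inner_le _ _))// mulrCA mulrA ler_wpM2r ?hnorm_ge0.
Qed.

Lemma adjointP E F (T : E -> F) : bounded_op T ->
  bounded_op (adjoint T) /\ forall x y, inner (T x) y = inner x (adjoint T y).
Proof. by move=> hT; exact: (xgetPex 0 (adjoint_ex hT)). Qed.

Lemma bounded_adjoint E F (T : E -> F) : bounded_op T -> bounded_op (adjoint T).
Proof. by case/adjointP. Qed.

Lemma inner_adjoint E F (T : E -> F) x y : bounded_op T ->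
  inner (T x) y = inner x (adjoint T y).
Proof. by case/adjointP. Qed.

Lemma inner_adjointl E F (T : E -> F) x y : bounded_op T ->
  inner (adjoint T y) x = inner y (T x).
Proof. by move=> hT; rewrite inner_conj -inner_adjoint// -inner_conj. Qed.

Lemma adjoint_unique E F (T : E -> F) S : bounded_op T ->
  (forall x y, inner (T x) y = inner x (S y)) -> adjoint T = S.
Proof.
move=> hT h; apply/funext => y; apply: inner_ext => z.
by rewrite inner_conj -inner_adjoint// h -inner_conj.
Qed.

Lemma adjoint_bound E F (T : E -> F) (M : R) : 0 <= M -> bounded_op T ->
  (forall x, hnorm (T x) <= M * hnorm x) ->
  forall y, hnorm (adjoint T y) <= M * hnorm y.
Proof.
move=> M0 hT hM y; have [->|y0] := eqVneq (hnorm (adjoint T y)) 0.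
  by rewrite mulr_ge0// hnorm_ge0.
have py : 0 < hnorm (adjoint T y) by rewrite lt_def y0 hnorm_ge0.
rewrite -(ler_pM2l py) -expr2 hnorm_sqr -inner_adjoint//.
by rewrite (le_trans (Re_inner_le _ _))// mulrCA mulrA ler_wpM2r ?hnorm_ge0.
Qed.

End BoundedOps.

(** * Extension and convergence of operators *)

Section Extension.
Context {R : realType}.
Implicit Types H K : hilbertType R.

Lemma dense_hnorm H (D : set H) : dense D ->
  forall z (eps : R), 0 < eps -> exists2 p, D p & hnorm (z - p) < eps.
Proof.
move=> dD z eps eps0.
have [|p [zp Dp]] := dD (ball z eps%:C) _ (ball_open z _).
- by exists z; apply: ballxx; rewrite ltcR.
- by exists p => //; move: zp; rewrite -ball_normE /= norm_hnorm ltcR.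
Qed.

Lemma ler_addgt0_mul (a b M : R) : 0 <= M ->
  (forall eps, 0 < eps -> a <= b + M * eps) -> a <= b.
Proof.
move=> M0 h; apply/ler_addgt0Pr => eps eps0.
have M1 : 0 < M + 1 by rewrite ltr_wpDl.
have := h (eps / (M + 1)); rewrite divr_gt0// => /(_ isT) /le_trans; apply.
rewrite lerD2l mulrCA ler_piMr ?(ltW eps0)// ler_pdivrMr// mul1r lerDl ler01//.
Qed.

(* The closure of the graph G is the graph of T. *)
Lemma graph_ext H K (G : set (H * K)) (M : R) : 0 <= M ->
  (forall c p q, G p -> G q -> G (c *: p.1 + q.1, c *: p.2 + q.2)) ->
  (forall p, G p -> hnorm p.2 <= M * hnorm p.1) ->
  (forall z (eps : R), 0 < eps -> exists2 p, G p & hnorm (z - p.1) < eps) ->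
  exists T : H -> K, [/\ linear T, forall x, hnorm (T x) <= M * hnorm x
    & forall p, G p -> T p.1 = p.2].
Proof.
move=> M0 Glin GM Gdense.
pose adh z y := forall eps : R, 0 < eps ->
  exists2 p, G p & hnorm (z - p.1) < eps /\ hnorm (y - p.2) < eps.
have adh_lin c z y z' y' : adh z y -> adh z' y' -> adh (c *: z + z') (c *: y + y').
  move=> h h' eps eps0.
  have c0 : 0 <= normc c by rewrite -lecR; exact: (normr_ge0 c).
  have c1 : 0 < normc c + 1 by rewrite ltr_wpDl.
  have d0 : 0 < eps / (normc c + 1) by rewrite divr_gt0.
  have [p Gp [p1 p2]] := h _ d0; have [q Gq [q1 q2]] := h' _ d0.
  exists (c *: p.1 + q.1, c *: p.2 + q.2); first exact: Glin.
  have aux (V : hilbertType R) (u u' v v' : V) :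
      hnorm (u - v) < eps / (normc c + 1) -> hnorm (u' - v') < eps / (normc c + 1) ->
      hnorm (c *: u + u' - (c *: v + v')) < eps.
    move=> huv hu'v'; rewrite opprD addrACA -scalerBr.
    apply: le_lt_trans (ler_hnormD _ _) _; rewrite hnormZ.
    have -> : eps = normc c * (eps / (normc c + 1)) + eps / (normc c + 1).
      by field; exact: lt0r_neq0.
    by rewrite ler_ltD// ler_wpM2l// ltW.
  by split; apply: aux.
have adh_le z y : adh z y -> hnorm y <= M * hnorm z.
  move=> h; apply: (@ler_addgt0_mul _ _ (M + 1)); first by rewrite addr_ge0.
  move=> eps eps0; have [p Gp [p1 p2]] := h _ eps0.
  have h1 : hnorm y <= hnorm (y - p.2) + hnorm p.2.
    by rewrite -{1}(subrK p.2 y) ler_hnormD.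
  have h2 : hnorm p.1 <= hnorm (z - p.1) + hnorm z.
    by rewrite -{1}(subrK z p.1) (le_trans (ler_hnormD _ _))// hdistC.
  have h3 := GM _ Gp.
  have h4 : M * hnorm p.1 <= M * (eps + hnorm z).
    by rewrite ler_wpM2l// (le_trans h2)// lerD2r ltW.
  lra.
have adh_ex z : exists y, adh z y.
  have ex k : exists p, G p /\ hnorm (z - p.1) < k.+1%:R^-1.
    by have [|p Gp zp] := Gdense z k.+1%:R^-1; [rewrite invr_gt0|exists p].
  have [p /all_and2[Gp zp]] := choice ex.
  (* The difference of two points of G is again in G, so [GM] transfers the Cauchy property from
     first to second coordinates. *)
  have pp n k : hnorm ((p n).2 - (p k).2) <= M * (n.+1%:R^-1 + k.+1%:R^-1).
    have := GM _ (Glin (-1) _ _ (Gp k) (Gp n)) => /=.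
    rewrite !scaleN1r ![- _ + _]addrC => /le_trans; apply.
    by rewrite ler_wpM2l// (le_trans (hdistD z _ _))// lerD// ?(ltW (zp k))// hdistC ltW.
  have M1 : 0 < M + 1 by rewrite ltr_wpDl.
  have small (eps : R) : 0 < eps -> exists k, forall n, (k <= n)%N -> n.+1%:R^-1 < eps.
    move=> /ltr_add_invr[k]; rewrite add0r => hk; exists k => n kn.
    by apply: le_lt_trans hk; rewrite lef_pV2 ?posrE ?ltr0Sn// ler_nat ltnS.
  have pp' eps : 0 < eps -> exists k, forall n m, (k <= n)%N -> (k <= m)%N ->
      hnorm ((p n).2 - (p m).2) < eps.
    move=> eps0; have e0 : 0 < eps / 2 / (M + 1) by rewrite !divr_gt0.
    have [k hk] := small _ e0; exists k => n m kn km.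
    apply: le_lt_trans (pp _ _) _.
    have -> : eps = (M + 1) * (eps / 2 / (M + 1) + eps / 2 / (M + 1)).
      by field; exact: lt0r_neq0.
    have i0 : 0 < n.+1%:R^-1 :> R by rewrite invr_gt0.
    have j0 : 0 < m.+1%:R^-1 :> R by rewrite invr_gt0.
    have := hk _ kn; have := hk _ km.
    move: (eps / 2 / (M + 1)) i0 j0 => d.
    move: (n.+1%:R^-1 : R) (m.+1%:R^-1 : R) => i j i0 j0 hj hi.
    have h1 : M * (i + j) <= M * (d + d) by rewrite ler_wpM2l//; lra.
    rewrite mulrDl mul1r; lra.
  have [y hy] : exists y : K, (fun n => (p n).2) @ \oo --> y.
    apply: hcauchy => eps eps0; have [k hk] := pp' _ eps0.
    by exists (p k).2; exists k => // n kn; apply: hk.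
  exists y => eps eps0; have /hcvgP/(_ _ eps0)[N _ hN] := hy.
  have [k hk] := small _ eps0.
  exists (p (maxn N k)) => //; split; first by rewrite (lt_trans (zp _))// hk// leq_maxr.
  by rewrite hdistC; apply: hN; exact: leq_maxl.
have adh_uniq z y y' : adh z y -> adh z y' -> y = y'.
  move=> h h'; apply/eqP; rewrite -subr_eq0; apply/eqP/hnorm0_eq0/eqP.
  rewrite eq_le hnorm_ge0 andbT.
  have := adh_le _ _ (adh_lin (-1) _ _ _ _ h' h).
  by rewrite !scaleN1r [- z + z]addNr hnorm0 mulr0 addrC.
have [T hT] := choice adh_ex; exists T; split.
- by move=> c u v; apply: (adh_uniq (c *: u + v)) => //; exact: adh_lin.
- by move=> x; exact: adh_le.
- move=> p Gp; apply: (adh_uniq p.1) => // eps eps0.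
  by exists p => //; rewrite !subrr !hnorm0.
Qed.

Lemma orth_sum_sqr H (I : eqType) (s : seq I) (u : I -> H) : uniq s ->
  (forall i j, i != j -> inner (u i) (u j) = 0) ->
  hnorm (\sum_(i <- s) u i) ^+ 2 = \sum_(i <- s) hnorm (u i) ^+ 2.
Proof.
move=> + orth; elim: s => [|i s IH] /=; first by rewrite !big_nil hnorm0 expr0n.
move=> /andP[is_ us]; rewrite !big_cons hnormD_sqr IH// inner_sumr.
rewrite [X in Re X]big_seq [X in Re X]big1 /= ?mulr0 ?addr0// => j js.
by apply: orth; apply: contraNneq is_ => ->.
Qed.

(** Merges the terms with equal index, so that the remaining indices are distinct and Pythagoras
    applies to an arbitrary list of pairs. *)
Lemma sum_by_fst (I : choiceType) (V W : zmodType) (f : I -> V -> W) (s : seq (I * V)) :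
  (forall i x y, f i (x + y) = f i x + f i y) ->
  \sum_(p <- s) f p.1 p.2 =
  \sum_(i <- undup (unzip1 s)) f i (\sum_(p <- s | p.1 == i) p.2).
Proof.
move=> fD; have f0 i : f i 0 = 0 by apply: (addIr (f i 0)); rewrite -fD !add0r.
under [RHS]eq_bigr => i _ do rewrite (big_morph (f i) (fD i) (f0 i)).
rewrite (exchange_big_dep xpredT)//= big_seq [RHS]big_seq.
apply: eq_bigr => p ps.
rewrite -big_filter; have -> : [seq i <- undup (unzip1 s) | p.1 == i] = [:: p.1].
  have -> : (fun i => p.1 == i) = pred1 p.1 by apply/funext => i /=; rewrite eq_sym.
  by rewrite filter_pred1_uniq ?undup_uniq// mem_undup; apply/mapP; exists p.
by rewrite big_seq1.
Qed.

Definition total_family (H : hilbertType R) (I V : Type) (f : I -> V -> H) :=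
  forall z (eps : R), 0 < eps ->
    exists s : seq (I * V), hnorm (z - \sum_(p <- s) f p.1 p.2) < eps.

(** The source of nearly all operators below. On finite sums, Pythagoras in both the domain and the
    target reduces the bound to the single-index bound; this also shows that the image does not
    depend on how the sum is written. *)
Lemma orth_ext H K (I : choiceType) (V : lmodType R[i])
    (f : I -> V -> H) (g : I -> V -> K) (M : R) : 0 <= M ->
  (forall i, linear (f i)) -> (forall i, linear (g i)) ->
  (forall i j x y, i != j -> inner (f i x) (f j y) = 0) ->
  (forall i j x y, i != j -> inner (g i x) (g j y) = 0) ->
  (forall i x, hnorm (g i x) <= M * hnorm (f i x)) ->
  total_family f ->
  exists T : H -> K, [/\ linear T, forall x, hnorm (T x) <= M * hnorm x
    & forall i x, T (f i x) = g i x].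
Proof.
move=> M0 fl gl fo go gM ft.
pose G := [set q | exists s : seq (I * V), q = (\sum_(p <- s) f p.1 p.2, \sum_(p <- s) g p.1 p.2)].
have Glin c p q : G p -> G q -> G (c *: p.1 + q.1, c *: p.2 + q.2).
  move=> [s ->] [t ->]; exists ([seq (p.1, c *: p.2) | p <- s] ++ t) => /=.
  rewrite !big_cat !big_map /= !scaler_sumr; congr (_ + _, _ + _);
  by apply: eq_bigr => i _; rewrite linZ.
have GM q : G q -> hnorm q.2 <= M * hnorm q.1.
  move=> [s ->] /=; rewrite -(@ler_pXn2r _ 2)// ?nnegrE ?mulr_ge0 ?hnorm_ge0//.
  rewrite exprMn (sum_by_fst _ (fun i => linD (gl i))) (sum_by_fst _ (fun i => linD (fl i))).
  rewrite orth_sum_sqr ?undup_uniq//; last by move=> i j; exact: go.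
  rewrite orth_sum_sqr ?undup_uniq//; last by move=> i j; exact: fo.
  rewrite mulr_sumr; apply: ler_sum => i _.
  by rewrite -exprMn ler_pXn2r// ?nnegrE ?mulr_ge0 ?hnorm_ge0.
have [|T [Tl TM TG]] := graph_ext M0 Glin GM.
  by move=> z eps /(ft z)[s hs]; eexists; first by exists s.
exists T; split=> // i x; have := TG (f i x, g i x); apply.
by exists [:: (i, x)]; rewrite !big_seq1.
Qed.

Lemma total_family_eq H K (I V : Type) (f : I -> V -> H) (S T : H -> K) :
  total_family f -> bounded_op S -> bounded_op T ->
  (forall i x, S (f i x) = T (f i x)) -> S = T.
Proof.
move=> ft hS hT e; apply/funext => z; apply/eqP; rewrite -subr_eq0.
apply/eqP/hnorm0_eq0/eqP; rewrite eq_le hnorm_ge0 andbT.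
have [M M0 hM] := bounded_op_ge0 (bounded_opB hS hT).
apply: (@ler_addgt0_mul _ _ M) => // eps eps0.
have [s hs] := ft z _ eps0; rewrite add0r.
have -> : S z - T z = (S - T) (z - \sum_(p <- s) f p.1 p.2).
  rewrite (linB (bounded_opB hS hT).1) (lin_sum (bounded_opB hS hT).1) big1 ?subr0//.
  by move=> p _; rewrite fctE e subrr.
by rewrite (le_trans (hM _))// ler_wpM2l// ltW.
Qed.

Lemma hcvg_unique H (T : Type) (G : set_system T) {FG : ProperFilter G}
  (f : T -> H) (l l' : H) : f @ G --> l -> f @ G --> l' -> l = l'.
Proof. by move=> h h'; exact: (cvg_unique (@norm_hausdorff _ _) h h'). Qed.

Lemma hcvg_sum H (T I : Type) (G : set_system T) {FG : ProperFilter G}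
    (s : seq I) (f : I -> T -> H) (l : I -> H) :
  (forall i, f i @ G --> l i) ->
  (fun t => \sum_(i <- s) f i t) @ G --> (\sum_(i <- s) l i : H).
Proof.
move=> h; elim: s => [|i s IH].
  under eq_fun do rewrite big_nil.
  by rewrite big_nil; exact: cvg_cst.
under eq_fun do rewrite big_cons.
by rewrite big_cons; apply: cvgD.
Qed.

(** A uniform bound upgrades convergence on a total family to convergence everywhere, by an
    epsilon/2 argument and completeness. Linearity and the bound are asked only near the limit
    because phi(rW) is controlled only for 0 <= r < 1. *)
Lemma sot_cvg H K (T I V : Type) (G : set_system T) {FG : ProperFilter G}
    (f : I -> V -> H) (U : T -> H -> K) (M : R) : 0 <= M -> total_family f ->
  (\forall t \near G, linear (U t) /\ forall z, hnorm (U t z) <= M * hnorm z) ->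
  (forall i x, exists l : K, U ^~ (f i x) @ G --> l) ->
  exists S : H -> K, [/\ linear S, forall z, hnorm (S z) <= M * hnorm z
    & forall z, U ^~ z @ G --> (S z : K)].
Proof.
move=> M0 ft hU hl.
have ex z : exists l : K, U ^~ z @ G --> l.
  apply: hcauchy => eps eps0.
  have M1 : 0 < M + 1 by rewrite ltr_wpDl.
  have d0 : 0 < eps / 2 / (M + 1) by rewrite !divr_gt0.
  have [s hs] := ft z _ d0.
  have [l hl'] := choice (fun p : I * V => hl p.1 p.2).
  exists (\sum_(p <- s) l p).
  have /hcvgP/(_ (eps / 2)) := hcvg_sum (FG := FG) (s := s) hl'.
  rewrite divr_gt0// => /(_ isT) h2.
  near=> t.
  have [Ul UM] : linear (U t) /\ forall z, hnorm (U t z) <= M * hnorm z by near: t.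
  have h3 : hnorm (\sum_(p <- s) U t (f p.1 p.2) - \sum_(p <- s) l p) < eps / 2 by near: t.
  apply: le_lt_trans (hdistD (\sum_(p <- s) U t (f p.1 p.2)) _ _) _.
  rewrite -(lin_sum Ul) -(linB Ul) in h3 *.
  have h4 := UM (z - \sum_(p <- s) f p.1 p.2).
  have h5 : M * hnorm (z - \sum_(p <- s) f p.1 p.2) <= eps / 2.
    have -> : eps / 2 = (M + 1) * (eps / 2 / (M + 1)) by field; exact: lt0r_neq0.
    by rewrite ler_pM ?hnorm_ge0// ?lerDl// ltW.
  rewrite (lin_sum Ul) in h3 *.
  by rewrite [ltRHS]splitr ler_ltD// (le_trans h4).
have [S hS] := choice ex; exists S; split=> //.
- move=> c u v; apply: (hcvg_unique (hS (c *: u + v))).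
  have h : (fun t => c *: U t u + U t v) @ G --> (c *: S u + S v : K).
    by apply: cvgD => //; apply: cvgZr.
  apply: cvg_trans h; apply: near_eq_cvg; apply: filterS hU => t [Ul _].
  by rewrite Ul.
- move=> z; apply: (@ler_addgt0_mul _ _ 1) => // eps eps0; rewrite mul1r.
  have /hcvgP/(_ _ eps0) h := hS z.
  have [t [[_ hM] ht]] := filter_ex (filterI hU h).
  rewrite -(subrK (U t z) (S z)) addrC (le_trans (ler_hnormD _ _))// lerD//.
  by rewrite hdistC ltW.
Unshelve. all: by end_near.
Qed.

Lemma inner_cvg H (T : Type) (G : set_system T) {FG : ProperFilter G}
    (f : T -> H) l y : f @ G --> l -> inner (f t) y @[t --> G] --> (inner l y : R[i]^o).
Proof.
move=> /hcvgP hf; apply/(@cvgrPdist_lt R[i] R[i]^o) => -[e1 e2].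
rewrite ltcE /= => /andP[/eqP-> e10].
have M1 : 0 < hnorm y + 1 by rewrite ltr_wpDl// hnorm_ge0.
have := hf (e1 / (hnorm y + 1)); rewrite divr_gt0// => /(_ isT); apply: filterS => t.
rewrite ltr_pdivlMr// => ht; rewrite -innerBl.
have : normc (inner (l - f t) y) < e1.
  rewrite (le_lt_trans (normc_inner_le _ _))// hdistC.
  by apply: le_lt_trans ht; rewrite ler_wpM2l ?hnorm_ge0// lerDl.
by rewrite -ltcR.
Qed.

Lemma inner_cvg_unique H (T : Type) (G : set_system T) {FG : ProperFilter G}
    (f : T -> H) l y c : f @ G --> l -> (\forall t \near G, inner (f t) y = c) ->
  inner l y = c.
Proof.
move=> /inner_cvg h hc; apply: (cvg_unique (@norm_hausdorff R[i] R[i]^o) (h y)).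
exact: (@cvg_near_cst _ R[i]^o c).
Qed.

Lemma big_fset_sub (I : choiceType) (V : zmodType) (P : pred I) (F : I -> V)
    (J L : {fset I}) : (J `<=` L)%fset ->
  \sum_(i <- L | P i) F i =
  \sum_(i <- J | P i) F i + \sum_(i <- [seq i <- L | i \notin J] | P i) F i.
Proof.
move=> /fsubsetP JL.
have -> : \sum_(i <- J | P i) F i = \sum_(i <- [seq i <- L | i \in J] | P i) F i.
  apply: perm_big; apply: uniq_perm; rewrite ?filter_uniq ?fset_uniq// => i.
  by rewrite mem_filter; case: (boolP (i \in J)) => //= /JL ->.
rewrite -big_cat; apply: perm_big; rewrite perm_sym.
by have /permPl := perm_filterC (mem J) L.
Qed.

(** Take J whose sum of squares is within eps^2 of the supremum: any larger index set adds a vector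
    orthogonal to the part over J, of squared norm below eps^2. *)
Lemma orth_cvg H (I : choiceType) (P : pred I) (u : I -> H) (C : R) :
  (forall i j, i != j -> inner (u i) (u j) = 0) ->
  (forall s : seq I, uniq s -> \sum_(i <- s | P i) hnorm (u i) ^+ 2 <= C) ->
  exists l : H, (fun J : {fset I} => \sum_(i <- J | P i) u i) @ totally --> l.
Proof.
move=> orth hC; pose S := [set \sum_(i <- J | P i) hnorm (u i) ^+ 2 | J in @setT {fset I}].
have hS : has_sup S.
  split; first by exists (\sum_(i <- (fset0 : {fset I}) | P i) hnorm (u i) ^+ 2); exists fset0.
  by exists C => _ [J _ <-]; apply: hC; exact: fset_uniq.
apply: hcauchy => eps eps0.
have e2 : 0 < eps ^+ 2 by rewrite exprn_gt0.
have [_ [J _ <-] hJ] := sup_adherent e2 hS.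
exists (\sum_(i <- J | P i) u i); exists J => //= L JL.
have t_uniq : uniq [seq i <- L | i \notin J] by rewrite filter_uniq// fset_uniq.
rewrite (big_fset_sub _ _ JL) addrAC subrr add0r.
rewrite -(@ltr_pXn2r _ 2)// ?nnegrE ?hnorm_ge0 ?(ltW eps0)//.
rewrite -big_filter orth_sum_sqr ?filter_uniq// big_filter.
have : \sum_(i <- L | P i) hnorm (u i) ^+ 2 <= sup S.
  by apply: ub_le_sup; [exact: hS.2|exists L].
rewrite (big_fset_sub _ _ JL); move: hJ; set p := \sum_(i <- J | _) _; set q := \sum_(i <- _ | _) _.
by move: (sup S) p q => s p q; lra.
Qed.

Lemma ereal_cvg_fin (T : Type) (G : set_system T) {FG : Filter G}
    (f : T -> \bar R) (l : R) :
  (forall eps : R, 0 < eps ->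
     \forall t \near G, exists2 r : R, f t = r%:E & `|r - l| < eps) ->
  f @ G --> l%:E.
Proof.
move=> h; apply: cvg_EFin.
  by apply: filterS (h 1 ltr01) => t [r -> _].
apply/cvgrPdist_lt => eps eps0; apply: filterS (h _ eps0) => t [r + hr] /=.
by move=> ->; rewrite distrC.
Qed.

(** Completeness in operator norm: the limit is taken pointwise, and letting k tend to infinity in
    the Cauchy estimate keeps the modulus [t n]. *)
Lemma op_cauchy H (U : nat -> H -> H) (t : nat -> R) :
  (forall k, bounded_op (U k)) -> (forall k, 0 <= t k) -> t @ \oo --> (0 : R) ->
  (forall n k x, (n <= k)%N -> hnorm (U k x - U n x) <= t n * hnorm x) ->
  exists S, op_cvg U S.
Proof.
move=> hU t_ge0 ht hk.
have t0 (eps : R) : 0 < eps -> exists N, forall n, (N <= n)%N -> t n < eps.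
  move=> eps0; have /cvgrPdist_lt/(_ _ eps0)[N _ hN] := ht; exists N => n /hN.
  by rewrite /= sub0r normrN => /(le_lt_trans (ler_norm _)).
have ex x : exists l : H, U ^~ x @ \oo --> l.
  apply: hcauchy => eps eps0.
  have x1 : 0 < hnorm x + 1 by rewrite ltr_wpDl// hnorm_ge0.
  have [N hN] := t0 (eps / (hnorm x + 1)) (divr_gt0 eps0 x1).
  exists (U N x); exists N => // n /= Nn; apply: le_lt_trans (hk _ _ _ Nn) _.
  have := hN _ (leqnn N); rewrite ltr_pdivlMr//; apply: le_lt_trans.
  by rewrite ler_wpM2l// lerDl.
have [S hS] := choice ex.
have hSt n x : hnorm (U n x - S x) <= t n * hnorm x.
  apply: (@ler_addgt0_mul _ _ 1) => // eps eps0; rewrite mul1r.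
  have /hcvgP/(_ _ eps0)[N _ hN] := hS x.
  rewrite (le_trans (hdistD (U (maxn N n) x) _ _))// lerD//.
    by rewrite hdistC hk// leq_maxr.
  by rewrite ltW//; apply: hN; exact: leq_maxl.
have Slin : linear S.
  move=> c u v; apply: (hcvg_unique (hS (c *: u + v))).
  have -> : U ^~ (c *: u + v) = (fun n => c *: U n u + U n v).
    by apply/funext => n; rewrite (hU n).1.
  by apply: cvgD => //; apply: cvgZr.
have Sb : bounded_op S.
  split=> //; have [M _ hM] := bounded_op_ge0 (hU 0%N).
  exists (t 0%N + M) => x; rewrite -(subrK (U 0%N x) (S x)) (le_trans (ler_hnormD _ _))//.
  by rewrite mulrDl lerD// hdistC.
exists S; split=> //; apply: ereal_cvg_fin => eps eps0.
have [N hN] := t0 _ eps0; exists N => // n /= Nn.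
have [r r0 rE] := opnorm_fin (bounded_opB (hU n) Sb).
exists r => //; rewrite subr0 ger0_norm//; apply: le_lt_trans (hN _ Nn).
by rewrite -lee_fin -rE; apply: le_opnorm => // x; exact: hSt.
Qed.

Lemma geometric_op_cvg H (U : nat -> H -> H) (C rho : R) : 0 <= C -> 0 <= rho < 1 ->
  (forall k, (0 < k)%N -> bounded_op (U k)) ->
  (forall k x, (0 < k)%N -> hnorm (U k x) <= C * rho ^+ k * hnorm x) ->
  exists S, op_cvg (fun N => \sum_(1 <= k < N.+1) U k) S.
Proof.
move=> C0 /andP[rho0 rho1] hU hk.
have r1 : 0 < 1 - rho by rewrite subr_gt0.
have D0 : 0 <= C / (1 - rho) by rewrite divr_ge0// ltW.
apply: (@op_cauchy _ _ (geometric (C / (1 - rho)) rho)).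
- by move=> k; rewrite big_nat_cond; apply: bounded_op_sum => i /andP[/andP[i0 _] _]; exact: hU.
- by move=> k; rewrite mulr_ge0// exprn_ge0.
- by apply: cvg_geometric; rewrite ger0_norm.
- move=> n k x nk.
  (* The sharper modulus rho^n - rho^k is what carries the induction on k: passing from k to k+1
     frees exactly C rho^k, more than the new term needs. *)
  suff h : hnorm ((\sum_(1 <= i < k.+1) U i) x - (\sum_(1 <= i < n.+1) U i) x) <=
      C / (1 - rho) * (rho ^+ n - rho ^+ k) * hnorm x.
    rewrite (le_trans h)// ler_wpM2r ?hnorm_ge0// ler_wpM2l//.
    by rewrite lerBlDr lerDl exprn_ge0.
  elim: k nk => [|k IH].
    by rewrite leqn0 => /eqP ->; rewrite !subrr hnorm0 mulr0 mul0r.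
  rewrite leq_eqVlt => /predU1P[->|]; first by rewrite !subrr hnorm0 mulr0 mul0r.
  rewrite ltnS => /IH h; rewrite big_nat_recr//= fctE addrAC.
  rewrite (le_trans (ler_hnormD _ _))//.
  have h1 := hk k.+1 x isT.
  have e : C / (1 - rho) * (rho ^+ n - rho ^+ k.+1) * hnorm x =
     C / (1 - rho) * (rho ^+ n - rho ^+ k) * hnorm x + C * rho ^+ k * hnorm x.
    by rewrite exprS; field; exact: lt0r_neq0.
  rewrite e lerD// (le_trans h1)// ler_wpM2r ?hnorm_ge0// ler_wpM2l//.
  by rewrite exprS ler_piMl ?exprn_ge0// ltW.
Qed.

End Extension.

(** * The weights b^(m) *)

Section Weights.
Context {R : realType} {n : nat}.
Implicit Types (a : word n -> R) (alpha beta gamma : word n).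

(* The inner sum of bcoef, over the factorisations of alpha into j nonempty words,
   computed recursively on the first factor. *)
Fixpoint facsum a (j : nat) alpha : R :=
  if j is j'.+1 then
    \sum_(1 <= k < (size alpha).+1) a (take k alpha) * facsum a j' (drop k alpha)
  else (alpha == [::])%:R.

(** The first factor must be a nonempty prefix of [alpha], so it is determined by its length. [N] is
    independent of [alpha] because the induction shortens the word while the type of the factors
    stays fixed. *)
Lemma facsumE a N j alpha : (size alpha <= N)%N ->
  \sum_(gamma : j.-tuple (N.-bseq 'I_n) |
           (flatten [seq bseqval w | w <- gamma] == alpha) &&
           all (fun w => 1 <= size (bseqval w))%N gamma)
      (\prod_(w <- gamma) a (bseqval w)) = facsum a j alpha.
Proof.
elim: j alpha => [|j IH] alpha aN /=.
  have [->|ane] := eqVneq alpha [::].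
    by rewrite (big_pred1 [tuple]) ?big_nil// => g; rewrite [g]tuple0 /= eqxx.
  by rewrite big_pred0// => g; rewrite [g]tuple0 /= eq_sym (negbTE ane).
pose h (p : N.-bseq 'I_n * j.-tuple (N.-bseq 'I_n)) := [tuple of p.1 :: p.2].
have hbij : bijective h.
  exists (fun t : j.+1.-tuple _ => (thead t, [tuple of behead t])).
    by move=> [x t]; rewrite /h /= theadE; congr pair; apply: val_inj.
  by move=> t; rewrite /h /= -tuple_eta.
rewrite (reindex h) /=; last by apply: onW_bij.
pose P (w : N.-bseq 'I_n) := (0 < size (bseqval w))%N && (take (size (bseqval w)) alpha == bseqval w).
transitivity (\sum_(w : N.-bseq 'I_n | P w) a (bseqval w) *
    facsum a j (drop (size (bseqval w)) alpha)).
  under [RHS]eq_bigr => w _ do rewrite -IH ?size_drop ?(leq_trans (leq_subr _ _))// mulr_sumr.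
  rewrite pair_big_dep /=; apply: eq_big => [[w t]|[w t] _] /=; last by rewrite big_cons.
  rewrite /P [RHS]andbA -!andbA andbCA; congr andb; rewrite andbA; congr andb.
  apply/eqP/andP => [<-|[/eqP e /eqP ->]].
    by rewrite take_size_cat// drop_size_cat// !eqxx.
  by rewrite -{1}e cat_take_drop.
(* The prefixes of length 1 to |alpha| enumerate the words satisfying [P], each once. *)
pose bs k := insub_bseq N (take k alpha).
have bsE k : bseqval (bs k) = take k alpha.
  rewrite /bs /insub_bseq; apply: insubdK.
  by rewrite unfold_in /= size_take_min (leq_trans (geq_minr _ _)).
rewrite -[LHS]big_filter (perm_big [seq bs k | k <- index_iota 1 (size alpha).+1]).
  rewrite big_map; apply: eq_big_nat => k /andP[k1 k2].
  by rewrite bsE size_takel.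
apply: uniq_perm.
- by rewrite filter_uniq// index_enum_uniq.
- rewrite map_inj_in_uniq ?iota_uniq// => k k'; rewrite !mem_index_iota => /andP[_ k1] /andP[_ k2].
  move=> /(congr1 (fun w : N.-bseq _ => size (bseqval w))); rewrite !bsE !size_takel//.
- move=> w; rewrite mem_filter mem_index_enum andbT /P; apply/andP/mapP.
    move=> [w0 /eqP e]; exists (size (bseqval w)).
      rewrite mem_index_iota w0 ltnS -{1}e size_take_min geq_minr//.
    by apply: val_inj; rewrite /= bsE.
  move=> [k]; rewrite mem_index_iota => /andP[k1 k2] ->; rewrite bsE size_takel//.
Qed.

Lemma facsum_ge0 a j alpha : (forall w, 0 <= a w) -> 0 <= facsum a j alpha.
Proof.
move=> a0; elim: j alpha => [|j IH] alpha /=; first by rewrite ler0n.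
by apply: sumr_ge0 => k _; rewrite mulr_ge0.
Qed.

Lemma facsum_nil a j : facsum a j.+1 [::] = 0.
Proof. by rewrite /= big_geq. Qed.

(** The factorisation into single letters already contributes a positive product. *)
Lemma facsum_size_gt0 a alpha : (forall w, 0 <= a w) -> (forall i, 0 < a [:: i]) ->
  0 < facsum a (size alpha) alpha.
Proof.
move=> a0 ai; elim: alpha => [|i s IH] /=; first exact: ltr01.
rewrite big_nat_recl//= take0 drop0 ltr_wpDr ?mulr_gt0//.
by apply: sumr_ge0 => k _; rewrite mulr_ge0// facsum_ge0.
Qed.

(** Starting the sum at j = 0 removes the case distinction: the term j = 0 is 1 for the empty word
    and vanishes for all others. *)
Lemma bcoefE m a alpha : (0 < m)%N ->
  bcoef m a alpha =
  \sum_(0 <= j < (size alpha).+1) facsum a j alpha * 'C(j + m - 1, m - 1)%:R.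
Proof.
move=> m0; rewrite /bcoef; case: alpha => [|i s].
  by rewrite big_nat1 add0n binn /= mulr1.
rewrite [RHS]big_nat_recl// mul0r add0r big_add1 /=.
apply: eq_bigr => j _; have /= <- := facsumE a j.+1 (leqnn (size (i :: s))).
by rewrite mulr_suml.
Qed.

Lemma bcoef_nil m a : bcoef m a [::] = 1. Proof. by []. Qed.

Lemma bcoef_gt0 m a alpha : (0 < m)%N ->
  (forall w, 0 <= a w) -> (forall i, 0 < a [:: i]) -> 0 < bcoef m a alpha.
Proof.
move=> m0 a0 ai; rewrite bcoefE// big_nat_recr//= ltr_wpDl//.
  by apply: sumr_ge0 => j _; rewrite mulr_ge0// facsum_ge0.
rewrite mulr_gt0 ?facsum_size_gt0// ltr0n bin_gt0.
by rewrite leq_sub2r// leq_addl.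
Qed.

(** A factorisation of beta into i words followed by one of gamma into l words factorises beta gamma
    into i + l words, and the pair can be recovered by cutting after beta. The weight [w] is
    arbitrary because removing the first factor of beta shifts it by one. *)
Lemma facsum_cat a beta gamma N M (w : nat -> R) : (forall v, 0 <= a v) ->
  (forall k, 0 <= w k) -> (size beta <= N)%N -> (size beta + size gamma <= M)%N ->
  \sum_(0 <= i < N.+1) facsum a i beta *
     (\sum_(0 <= l < (size gamma).+1) facsum a l gamma * w (i + l)%N) <=
  \sum_(0 <= j < M.+1) facsum a j (beta ++ gamma) * w j.
Proof.
move=> a0; elim: N M beta w => [|N IH] M [|b0 beta] w w0 bN bM //.
- rewrite big_nat1 /= mul1r (@big_cat_nat _ _ _ (size gamma).+1 0 M.+1)//=.
  by rewrite lerDl; apply: sumr_ge0 => j _; rewrite mulr_ge0// facsum_ge0.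
- rewrite big_nat_recl// [X in _ + X]big1 ?addr0; last by move=> i _; rewrite facsum_nil mul0r.
  rewrite /= mul1r (@big_cat_nat _ _ _ (size gamma).+1 0 M.+1)//=.
  by rewrite lerDl; apply: sumr_ge0 => j _; rewrite mulr_ge0// facsum_ge0.
set al := b0 :: beta in bN bM *.
case: M bM => // M bM.
rewrite big_nat_recl// [X in X * _]/= mul0r add0r.
rewrite [leRHS]big_nat_recl// [X in _ <= X * _ + _]/= mul0r add0r.
under eq_bigr => i _ do rewrite [facsum _ _ _]/= -/(size al) mulr_suml.
under [leRHS]eq_bigr => i _ do rewrite [facsum _ _ _]/= -/(size (al ++ gamma)) mulr_suml.
rewrite exchange_big [leRHS]exchange_big /=.
have sz : ((size al).+1 <= (size (al ++ gamma)).+1)%N by rewrite ltnS size_cat leq_addr.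
(* Only first factors that end inside [al] are kept; those reaching into gamma contribute
   nonnegative terms, which are dropped. *)
rewrite [leRHS](@big_cat_nat _ _ _ (size al).+1)//=.
rewrite ler_wpDr//.
  by apply: sumr_ge0 => k _; apply: sumr_ge0 => j _; rewrite !mulr_ge0// facsum_ge0.
rewrite big_nat_cond [leRHS]big_nat_cond; apply: ler_sum => k; rewrite andbT => /andP[k1 k2].
have -> : take k (al ++ gamma) = take k al by rewrite takel_cat.
have -> : drop k (al ++ gamma) = drop k al ++ gamma.
  rewrite drop_cat; move: k2; rewrite ltnS leq_eqVlt => /orP[/eqP->|->//].
  by rewrite ltnn subnn drop0 drop_oversize.
under eq_bigr => i _ do rewrite -mulrA.
under [leRHS]eq_bigr => i _ do rewrite -mulrA.
rewrite -!mulr_sumr ler_wpM2l//.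
have := IH M (drop k al) (fun i => w i.+1); apply => //.
  by move: bN; rewrite size_drop /=; lia.
by move: bM; rewrite size_drop /=; move: k2; rewrite /=; lia.
Qed.

(** In the double sum over i and l, the binomial of i is at most that of |beta|, and the binomial of
    l at most that of i + l. *)
Lemma bcoef_cat m a beta gamma : (0 < m)%N -> (forall v, 0 <= a v) ->
  bcoef m a beta * bcoef m a gamma <=
  'C(size beta + m - 1, m - 1)%:R * bcoef m a (beta ++ gamma).
Proof.
move=> m0 a0; rewrite !bcoefE//.
have w0 k : 0 <= 'C(k + m - 1, m - 1)%:R :> R by [].
have sz : (size beta + size gamma <= size (beta ++ gamma))%N by rewrite size_cat.
have := facsum_cat a0 w0 (leqnn (size beta)) sz.
set D : R := 'C(size beta + m - 1, m - 1)%:R.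
move=> /(ler_wpM2l (w0 (size beta))) /(le_trans _); apply.
rewrite mulr_suml mulr_sumr; rewrite big_nat_cond [leRHS]big_nat_cond.
apply: ler_sum => i; rewrite andbT ltnS => /andP[_ ib].
rewrite -mulrA [leRHS]mulrCA ler_wpM2l ?facsum_ge0//.
rewrite !mulr_sumr; apply: ler_sum => l _; rewrite mulrCA [leRHS]mulrCA ler_wpM2l ?facsum_ge0//.
rewrite -/D; apply: ler_pM => //; rewrite ler_nat leq_bin2l//; lia.
Qed.

(** The same with the roles of i and l exchanged. It serves for gamma fixed and beta running over
    all words. *)
Lemma bcoef_catr m a beta gamma : (0 < m)%N -> (forall v, 0 <= a v) ->
  bcoef m a beta * bcoef m a gamma <=
  'C(size gamma + m - 1, m - 1)%:R * bcoef m a (beta ++ gamma).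
Proof.
move=> m0 a0; rewrite !bcoefE//.
have w0 k : 0 <= 'C(k + m - 1, m - 1)%:R :> R by [].
have sz : (size beta + size gamma <= size (beta ++ gamma))%N by rewrite size_cat.
have := facsum_cat a0 w0 (leqnn (size beta)) sz.
set D : R := 'C(size gamma + m - 1, m - 1)%:R.
move=> /(ler_wpM2l (w0 (size gamma))) /(le_trans _); apply.
rewrite mulr_suml mulr_sumr; apply: ler_sum => i _.
rewrite -mulrA [leRHS]mulrCA ler_wpM2l ?facsum_ge0//.
rewrite !mulr_sumr big_nat_cond [leRHS]big_nat_cond.
apply: ler_sum => l; rewrite andbT ltnS => /andP[_ lg].
rewrite mulrCA [leRHS]mulrCA ler_wpM2l ?facsum_ge0//.
rewrite -/D mulrC; apply: ler_pM => //; rewrite ler_nat leq_bin2l//; lia.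
Qed.

(* The left side is a single term of the binomial expansion of (r + (1 - r))^(k + m - 1). *)
Lemma bin_mul_expr_le m k (r : R) : (0 < m)%N -> 0 <= r < 1 ->
  'C(k + m - 1, m - 1)%:R * r ^+ k <= (1 - r) ^- (m - 1).
Proof.
move=> m0 /andP[r0 r1]; have t0 : 0 < 1 - r by rewrite subr_gt0.
rewrite -[leRHS]mul1r ler_pdivlMr ?exprn_gt0//.
have mk : (m - 1 < (k + m - 1).+1)%N by rewrite ltnS; lia.
have : (r + (1 - r)) ^+ (k + m - 1) = 1 by rewrite addrC subrK expr1n.
rewrite exprDn (bigD1 (Ordinal mk))//= => e; rewrite -[leRHS]e.
have -> : (k + m - 1 - (m - 1) = k)%N by lia.
rewrite -mulrA mulr_natl ler_wpDr//; apply: sumr_ge0 => i _.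
by rewrite mulrn_wge0// mulr_ge0// exprn_ge0// ltW.
Qed.

End Weights.

(** * Weighted creation operators and tensor products *)

Lemma rcomparable_cat {n} (alpha gamma : word n) : rcomparable (alpha ++ gamma) gamma.
Proof. by rewrite /rcomparable /rge suffix_suffix. Qed.

Lemma rcomparableC {n} (omega gamma : word n) : rcomparable omega gamma = rcomparable gamma omega.
Proof.
rewrite /rcomparable /rgt /rge; have [->|ne] := eqVneq omega gamma; first by [].
by rewrite /= !andbT orbC.
Qed.

Lemma rcomparableP {n} (omega gamma : word n) :
  [\/ exists alpha, omega = alpha ++ gamma,
      exists2 alpha, nontrivial alpha & gamma = alpha ++ omega
    | ~~ rcomparable omega gamma].
Proof.
have [/suffixP[al ->]|h] := boolP (suffix gamma omega); first by constructor 1; exists al.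
have [/suffixP[al e]|h'] := boolP (suffix omega gamma).
  constructor 2; exists al => //; apply: contraNneq h => al0.
  by rewrite e al0 suffix_refl.
by constructor 3; rewrite /rcomparable /rgt /rge negb_or h negb_and h'.
Qed.

Section Fock.
Context {R : realType} {n : nat} {F : hilbertType R}.
Variables (e : word n -> F) (b : word n -> R).
Hypotheses (e_basis : orthonormal_basis e) (b_gt0 : forall w, 0 < b w).

(** The weight of W_alpha on e_gamma: the weights of the successive letters telescope. *)
Definition shift_coef (alpha gamma : word n) : R := Num.sqrt (b gamma / b (alpha ++ gamma)).

Lemma shift_coef_ge0 alpha gamma : 0 <= shift_coef alpha gamma.
Proof. exact: sqrtr_ge0. Qed.

Lemma shift_coef_sqr alpha gamma : shift_coef alpha gamma ^+ 2 = b gamma / b (alpha ++ gamma).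
Proof. by rewrite sqr_sqrtr// divr_ge0// ltW. Qed.

Lemma shift_coef_nil gamma : shift_coef [::] gamma = 1.
Proof. by rewrite /shift_coef /= divff ?sqrtr1// gt_eqF. Qed.

Lemma shift_coef_cons i alpha gamma :
  shift_coef (i :: alpha) gamma = shift_coef [:: i] (alpha ++ gamma) * shift_coef alpha gamma.
Proof.
rewrite /shift_coef /= -sqrtrM ?divr_ge0 ?ltW//; congr Num.sqrt.
by field; rewrite !gt_eqF.
Qed.

Lemma fock_total : total_family (fun gamma (c : R[i]^o) => c *: e gamma).
Proof.
move=> z eps eps0; have [p [s [c ->]] hp] := dense_hnorm e_basis.2 z eps0.
by exists [seq (i, c i) | i <- s]; rewrite big_map.
Qed.

Lemma inner_fock gamma delta : inner (e gamma) (e delta) = (gamma == delta)%:R.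
Proof. exact: e_basis.1. Qed.

Lemma hnorm_fock gamma : hnorm (e gamma) = 1.
Proof.
have := inner_hnorm (e gamma); rewrite inner_fock eqxx => /(congr1 (@complex.Re R)) /= h.
by apply/eqP; rewrite -(@eqrXn2 _ 2)// ?hnorm_ge0// expr1n -h.
Qed.

Lemma fock_op_eq (K : hilbertType R) (S T : F -> K) : bounded_op S -> bounded_op T ->
  (forall gamma, S (e gamma) = T (e gamma)) -> S = T.
Proof.
move=> hS hT h; apply: (total_family_eq fock_total) => // gamma c.
by rewrite (linZ hS.1) (linZ hT.1) h.
Qed.

Hypothesis gen_bound : forall i, exists C : R, forall gamma, b gamma / b (i :: gamma) <= C.

(** Distinct basis vectors go to multiples of distinct basis vectors, so bounded weights suffice;
    the scalars [R[i]^o] act as the fibres in [orth_ext]. *)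
Lemma creationP i : bounded_op (creation e b i) /\
  forall gamma, creation e b i (e gamma) = (shift_coef [:: i] gamma)%:C *: e (i :: gamma).
Proof.
suff : exists T : F -> F, bounded_op T /\ forall gamma,
    T (e gamma) = (shift_coef [:: i] gamma)%:C *: e (i :: gamma) by move=> /(xgetPex 0).
have [C hC] := gen_bound i.
have C0 : 0 <= C by apply: le_trans (hC [::]); rewrite divr_ge0// ltW.
have s0 := sqrtr_ge0 C.
have [||||||T [Tl TM TE]] := @orth_ext R F F (word n) R[i]^o (fun gamma (c : R[i]^o) => c *: e gamma)
  (fun gamma (c : R[i]^o) => (c * (shift_coef [:: i] gamma)%:C) *: e (i :: gamma)) _ s0.
- by move=> gamma c u v; rewrite /= scalerDl scalerA.
- by move=> gamma c u v; rewrite /= mulrDl scalerDl -mulrA scalerA.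
- by move=> g d x y ne; rewrite innerZl innerZr inner_fock (negbTE ne) !mulr0.
- by move=> g d x y ne; rewrite innerZl innerZr inner_fock eqseq_cons eqxx (negbTE ne) !mulr0.
- move=> g x; rewrite !hnormZ !hnorm_fock Normc.normcM !mulr1 mulrC ler_wpM2r//.
    by rewrite -lecR; exact: (normr_ge0 x).
  by rewrite /= expr0n addr0 sqrtr_sqr ger0_norm ?shift_coef_ge0// ler_wsqrtr.
- exact: fock_total.
exists T; split; first by split=> //; exists (Num.sqrt C).
by move=> g; have := TE g 1; rewrite scale1r mul1r.
Qed.

Lemma bounded_creation_word alpha : bounded_op (creation_word e b alpha).
Proof.
elim: alpha => [|i alpha IH] /=; first exact: bounded_op_id.
by apply: bounded_op_comp => //; exact: (creationP i).1.
Qed.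

Lemma creation_wordE alpha gamma :
  creation_word e b alpha (e gamma) = (shift_coef alpha gamma)%:C *: e (alpha ++ gamma).
Proof.
elim: alpha => [|i alpha IH] /=; first by rewrite shift_coef_nil scale1r.
rewrite IH (linZ (creationP i).1.1) (creationP i).2 scalerA -rmorphM /=.
by rewrite mulrC -shift_coef_cons.
Qed.

Lemma domain_algebra_creation_word (c : R[i]) alpha :
  domain_algebra e b (c *: creation_word e b alpha).
Proof.
split; first by apply: bounded_opZ; exact: bounded_creation_word.
move=> eps eps0; exists (c *: creation_word e b alpha).
  by exists [:: alpha], (fun=> c); rewrite big_seq1.
by rewrite subrr opnorm0 lte_fin.
Qed.

End Fock.

Section Tensor.
Context {R : realType} {n : nat} {E F H : hilbertType R}.
Variables (e : word n -> F) (tens : E -> F -> H) (b : word n -> R).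
Hypotheses (e_basis : orthonormal_basis e) (tensP : hilbert_tensor tens).
Hypotheses (b_gt0 : forall w, 0 < b w).

Definition iota_op (gamma : word n) (x : E) : H := tens x (e gamma).
Local Notation iota := iota_op.
Local Notation sh := (shift_coef b).
Local Notation W := (creation_word e b).

Lemma iota_lin gamma : linear (iota gamma).
Proof. exact: (tens_linearl tensP). Qed.

Lemma iota_inner gamma delta x y :
  inner (iota gamma x) (iota delta y) = inner x y * (gamma == delta)%:R.
Proof. by rewrite /iota (tens_inner tensP) (inner_fock e_basis). Qed.

Lemma iota_orth gamma delta x y : gamma != delta -> inner (iota gamma x) (iota delta y) = 0.
Proof. by rewrite iota_inner => /negbTE ->; rewrite mulr0. Qed.

Lemma iota_same gamma x y : inner (iota gamma x) (iota gamma y) = inner x y.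
Proof. by rewrite iota_inner eqxx mulr1. Qed.

Lemma hnorm_iota gamma x : hnorm (iota gamma x) = hnorm x.
Proof.
by apply/eqP; rewrite -(@eqrXn2 _ 2)// ?hnorm_ge0// !hnorm_sqr iota_same.
Qed.

Lemma bounded_iota gamma : bounded_op (iota gamma).
Proof.
by split; [exact: iota_lin|exists 1 => x; rewrite hnorm_iota mul1r].
Qed.

Lemma hnorm_tens x u : hnorm (tens x u) = hnorm x * hnorm u.
Proof.
apply/eqP; rewrite -(@eqrXn2 _ 2)// ?mulr_ge0 ?hnorm_ge0//.
by rewrite exprMn hnorm_sqr (tens_inner tensP) !inner_hnorm -rmorphM.
Qed.

Lemma bounded_tensl x : bounded_op (tens x).
Proof.
by split; [exact: (tens_linearr tensP)|exists (hnorm x) => u; rewrite hnorm_tens].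
Qed.

Lemma tens_total : total_family (fun u x => tens x u).
Proof.
move=> z eps eps0; have [p [s ->] hp] := dense_hnorm (tens_dense tensP) z eps0.
by exists [seq (q.2, q.1) | q <- s]; rewrite big_map.
Qed.

Lemma iota_total : total_family iota.
Proof.
have approx x u (eps : R) : 0 < eps -> exists t : seq (word n * E),
    hnorm (tens x u - \sum_(q <- t) iota q.1 q.2) < eps.
  move=> eps0; have x1 : 0 < hnorm x + 1 by rewrite ltr_wpDl// hnorm_ge0.
  have [s hs] := fock_total e_basis u (divr_gt0 eps0 x1).
  exists [seq (q.1, q.2 *: x) | q <- s]; rewrite big_map /=.
  have -> : \sum_(q <- s) iota q.1 (q.2 *: x) = tens x (\sum_(q <- s) q.2 *: e q.1).
    rewrite (lin_sum (tens_linearr tensP x)); apply: eq_bigr => q _.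
    by rewrite (linZ (iota_lin _)) (linZ (tens_linearr tensP x)).
  rewrite -(linB (tens_linearr tensP x)) hnorm_tens.
  move: hs; rewrite ltr_pdivlMr//; apply: le_lt_trans.
  by rewrite mulrC ler_wpM2l ?hnorm_ge0// lerDl.
have approx_sum (s : seq (F * E)) (eps : R) : 0 < eps -> exists t : seq (word n * E),
    hnorm (\sum_(q <- s) tens q.2 q.1 - \sum_(q <- t) iota q.1 q.2) < eps.
  elim: s eps => [|q s IH] eps eps0; first by exists [::]; rewrite !big_nil subrr hnorm0.
  have e2 : 0 < eps / 2 by rewrite divr_gt0.
  have [t ht] := IH _ e2; have [t' ht'] := approx q.2 q.1 _ e2.
  exists (t' ++ t); rewrite big_cons big_cat /= opprD addrACA.
  by rewrite (le_lt_trans (ler_hnormD _ _))// [ltRHS]splitr ltrD.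
move=> z eps eps0; have e2 : 0 < eps / 2 by rewrite divr_gt0.
have [s hs] := tens_total z e2; have [t ht] := approx_sum s _ e2.
exists t; rewrite (le_lt_trans (hdistD (\sum_(q <- s) tens q.2 q.1) _ _))//.
by rewrite [ltRHS]splitr ltrD.
Qed.

Lemma iota_ext z z' : (forall gamma y, inner z (iota gamma y) = inner z' (iota gamma y)) -> z = z'.
Proof.
move=> h; apply/eqP; rewrite -subr_eq0; apply/eqP; set d := z - z'.
have hd gamma y : inner d (iota gamma y) = 0 by rewrite innerBl h subrr.
apply/hnorm0_eq0/eqP; rewrite -sqrf_eq0 eq_le sqr_ge0 andbT.
apply: (@ler_addgt0_mul _ _ _ (hnorm d)); first exact: hnorm_ge0.
move=> eps eps0; have [s hs] := iota_total d eps0.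
have -> : hnorm d ^+ 2 = Re (inner d (d - \sum_(q <- s) iota q.1 q.2)).
  by rewrite innerBr inner_sumr big1 ?subr0 ?hnorm_sqr// => q _; rewrite hd.
by rewrite add0r (le_trans (Re_inner_le _ _))// ler_wpM2l ?hnorm_ge0// ltW.
Qed.

Lemma iota_op_eq (K : hilbertType R) (S T : H -> K) : bounded_op S -> bounded_op T ->
  (forall gamma x, S (iota gamma x) = T (iota gamma x)) -> S = T.
Proof. exact: total_family_eq iota_total. Qed.

(** Covers both block shifts, with [s] = [cat alpha], and block diagonal operators, with [s] =
    [id]. *)
Lemma diag_ext (s : word n -> word n) (D : word n -> E -> E) (P : pred (word n)) (M : R) :
  0 <= M -> {in P &, injective s} -> (forall gamma, linear (D gamma)) ->
  (forall gamma x, hnorm (D gamma x) <= M * hnorm x) ->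
  exists T : H -> H, [/\ linear T, forall z, hnorm (T z) <= M * hnorm z
    & forall gamma x, T (iota gamma x) = if P gamma then iota (s gamma) (D gamma x) else 0].
Proof.
move=> M0 sinj Dl DM; apply: (orth_ext (f := iota)
  (g := fun gamma x => if P gamma then iota (s gamma) (D gamma x) else 0)) => //.
- exact: iota_lin.
- move=> g; case: (P g) => c u v; last by rewrite scaler0 addr0.
  by rewrite Dl iota_lin.
- by move=> *; exact: iota_orth.
- move=> i j x y ne; case: ifP => Pi; last by rewrite inner0l.
  case: ifP => Pj; last by rewrite inner0r.
  by apply: iota_orth; apply: contraNneq ne => /sinj ->.
- move=> i x; case: ifP => _; last by rewrite hnorm0 mulr_ge0 ?hnorm_ge0.
  by rewrite !hnorm_iota.
- exact: iota_total.
Qed.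

Definition is_tensop (A : E -> E) (X : F -> F) (T : H -> H) :=
  bounded_op T /\ forall x u, T (tens x u) = tens (A x) (X u).

Lemma is_tensop_eq A X T : is_tensop A X T -> tensop tens A X = T.
Proof.
move=> hT; apply: xget_unique => // S hS; apply: iota_op_eq; [exact: hS.1|exact: hT.1|].
by move=> gamma x; rewrite /iota hS.2 hT.2.
Qed.

Lemma is_tensopP A X T : is_tensop A X T -> is_tensop A X (tensop tens A X).
Proof. by move=> h; rewrite (is_tensop_eq h). Qed.

Lemma is_tensop_scale A X T c : is_tensop A X T -> is_tensop A (c *: X) (c *: T).
Proof.
move=> [hT TE]; split; first exact: bounded_opZ.
by move=> x u; rewrite !fctE TE (linZ (tens_linearr tensP _)).
Qed.

Lemma is_tensop_adjoint A X T : bounded_op A -> bounded_op X ->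
  is_tensop A X T -> is_tensop (adjoint A) (adjoint X) (adjoint T).
Proof.
move=> hA hX [hT TE]; split; first exact: bounded_adjoint.
move=> x u; apply: iota_ext => gamma y.
rewrite inner_adjointl// /iota TE !(tens_inner tensP).
by rewrite -!inner_adjointl.
Qed.

Hypothesis shift_bound : forall alpha, exists C : R, forall gamma, sh alpha gamma <= C.

Let gen_bound i : exists C : R, forall gamma, b gamma / b (i :: gamma) <= C.
Proof.
have [C hC] := shift_bound [:: i]; exists (C ^+ 2) => gamma.
rewrite -[leLHS](shift_coef_sqr b_gt0 [:: i] gamma).
have s0 := shift_coef_ge0 b [:: i] gamma.
by rewrite ler_pXn2r ?nnegrE ?(le_trans s0).
Qed.

(** The operator is built as a block weighted shift on the vectors x (x) e_gamma. For fixed x both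
    sides of the product formula are bounded in u, so it extends from the basis to every u. *)
Lemma is_tensop_shift A alpha : bounded_op A -> is_tensop A (W alpha) (tensop tens A (W alpha)).
Proof.
move=> hA; have [M M0 hM] := bounded_op_ge0 hA; have [C hC] := shift_bound alpha.
have C0 : 0 <= C by apply: le_trans (hC [::]); exact: shift_coef_ge0.
have [||||T [Tl TM TE]] := @diag_ext (cat alpha) (fun gamma x => (sh alpha gamma)%:C *: A x) predT (C * M).
- by rewrite mulr_ge0.
- by move=> g d _ _ /eqP; rewrite eqseq_cat// eqxx => /eqP.
- by move=> g c u v; rewrite hA.1 scalerDr !scalerA mulrC.
- move=> g x; rewrite hnormZr ger0_norm ?shift_coef_ge0// -mulrA ler_pM//.
  + exact: shift_coef_ge0.
  + exact: hnorm_ge0.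
have bT : bounded_op T by split=> //; exists (C * M).
suff h : is_tensop A (W alpha) T by exact: is_tensopP h.
split=> // x u; have h : T \o tens x = tens (A x) \o W alpha.
  apply: (fock_op_eq e_basis).
  - by apply: bounded_op_comp => //; exact: bounded_tensl.
  - apply: bounded_op_comp; first exact: bounded_tensl.
    exact: bounded_creation_word.
  - move=> gamma /=; have := TE gamma x; rewrite /iota /= => ->.
    rewrite creation_wordE// (linZ (tens_linearr tensP _)).
    by rewrite (linZ (tens_linearl tensP _)).
by have := congr1 (fun f => f u) h.
Qed.

Lemma tensop_shiftE A alpha gamma x : bounded_op A ->
  tensop tens A (W alpha) (iota gamma x) = (sh alpha gamma)%:C *: iota (alpha ++ gamma) (A x).
Proof.
move=> hA; rewrite /iota (is_tensop_shift alpha hA).2 creation_wordE//.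
by rewrite (linZ (tens_linearr tensP _)).
Qed.

Lemma tensop_scale A alpha c : bounded_op A ->
  tensop tens A (c *: W alpha) = c *: tensop tens A (W alpha).
Proof. by move=> hA; apply: is_tensop_eq; apply: is_tensop_scale; exact: is_tensop_shift. Qed.

Lemma adjoint_adjoint (E1 F1 : hilbertType R) (T : E1 -> F1) : bounded_op T -> adjoint (adjoint T) = T.
Proof.
move=> hT; apply: adjoint_unique; first exact: bounded_adjoint.
by move=> x y; rewrite inner_adjointl.
Qed.

(** Tensoring with the adjoint of W_alpha needs no new construction: A is the adjoint of its
    adjoint, and adjoints of tensor products are tensor products of adjoints. *)
Lemma is_tensop_coshift A alpha : bounded_op A ->
  is_tensop A (adjoint (W alpha)) (adjoint (tensop tens (adjoint A) (W alpha))).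
Proof.
move=> hA; rewrite -{1}(adjoint_adjoint hA); apply: is_tensop_adjoint.
- exact: bounded_adjoint.
- exact: bounded_creation_word.
- by apply: is_tensop_shift; exact: bounded_adjoint.
Qed.

Lemma tensop_coshift A alpha c : bounded_op A ->
  tensop tens A (c *: adjoint (W alpha)) = c *: adjoint (tensop tens (adjoint A) (W alpha)).
Proof. by move=> hA; apply: is_tensop_eq; apply: is_tensop_scale; exact: is_tensop_coshift. Qed.

End Tensor.

(** * The operators phi(rW) *)

Section OpLimits.
Context {R : realType} {H : hilbertType R}.
Implicit Types (U : nat -> H -> H) (S : H -> H).

Lemma op_cvg_pointwise U S z : (forall k, bounded_op (U k)) -> op_cvg U S ->
  U ^~ z @ \oo --> (S z : H).
Proof.
move=> hU [hS hcv]; apply/hcvgP => eps eps0.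
have z1 : 0 < hnorm z + 1 by rewrite ltr_wpDl// hnorm_ge0.
have d0 : 0 < eps / (hnorm z + 1) by rewrite divr_gt0.
have : \forall k \near \oo, (opnorm (U k - S)%R < (eps / (hnorm z + 1))%:E)%E.
  by apply: (hcv [set y | (y < _)%E]); apply: open_ereal_lt'; rewrite lte_fin.
apply: filterS => k hk.
have := opnorm_le (bounded_opB (hU k) hS).1 (ltW hk) z.
rewrite fctE => /le_lt_trans; apply.
by rewrite mulrAC ltr_pdivrMr// ltr_pM2l// ltrDl.
Qed.

Lemma op_limE U S : (forall k, bounded_op (U k)) -> op_cvg U S -> op_lim U = S.
Proof.
move=> hU hS; apply: xget_unique => // S' hS'; apply/funext => z.
exact: (hcvg_unique (@op_cvg_pointwise _ _ z hU hS') (@op_cvg_pointwise _ _ z hU hS)).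
Qed.

Lemma adjointB (S T : H -> H) : bounded_op S -> bounded_op T ->
  adjoint (S - T) = adjoint S - adjoint T.
Proof.
move=> hS hT; apply: adjoint_unique; first exact: bounded_opB.
by move=> x y; rewrite !fctE innerBl innerBr !inner_adjoint.
Qed.

Lemma opnorm_adjoint_le (T : H -> H) : bounded_op T -> (opnorm (adjoint T) <= opnorm T)%E.
Proof.
move=> hT; have [r r0 rE] := opnorm_fin hT; rewrite rE; apply: le_opnorm => //.
by apply: adjoint_bound => //; apply: opnorm_le; [exact: hT.1|rewrite rE].
Qed.

Lemma op_cvg_adjoint U S : (forall k, bounded_op (U k)) -> op_cvg U S ->
  op_cvg (fun k => adjoint (U k)) (adjoint S).
Proof.
move=> hU [hS hcv]; split; first exact: bounded_adjoint.
apply: (squeeze_cvge _ (cvg_cst _) hcv); near=> k.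
by rewrite opnorm_ge0 -adjointB// opnorm_adjoint_le//; exact: bounded_opB.
Unshelve. all: by end_near.
Qed.

End OpLimits.

(** * Norm convergence and matrix entries of the two series of phi(rW) *)

Section Series.
Context {R : realType} {n m : nat} {E F H : hilbertType R}.
Variables (e : word n -> F) (tens : E -> F -> H) (b : word n -> R).
Hypotheses (m_gt0 : (0 < m)%N).
Hypotheses (e_basis : orthonormal_basis e) (tensP : hilbert_tensor tens).
Hypotheses (b_gt0 : forall w, 0 < b w).
Local Notation D k := ('C(k + m - 1, m - 1)%:R : R).
Hypothesis b_cat : forall beta gamma,
  b beta * b gamma <= D (size beta) * b (beta ++ gamma).

Local Notation iota := (iota_op e tens).
Local Notation sh := (shift_coef b).
Local Notation W := (creation_word e b).

Lemma shift_coef_sqr_le alpha gamma : sh alpha gamma ^+ 2 <= D (size alpha) / b alpha.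
Proof.
rewrite shift_coef_sqr// ler_pdivrMr// mulrAC ler_pdivlMr//.
by rewrite mulrC b_cat.
Qed.

Lemma shift_coef_bounded alpha : exists C : R, forall gamma, sh alpha gamma <= C.
Proof.
exists (Num.sqrt (D (size alpha) / b alpha)) => gamma.
rewrite -(ger0_norm (shift_coef_ge0 b alpha gamma)) -sqrtr_sqr ler_wsqrtr//.
exact: shift_coef_sqr_le.
Qed.

Let tshE := tensop_shiftE e_basis tensP b_gt0 shift_coef_bounded.
Let tshP := is_tensop_shift e_basis tensP b_gt0 shift_coef_bounded.
Let tscale := tensop_scale e_basis tensP b_gt0 shift_coef_bounded.

Section Levels.
Variables (X : word n -> E -> E) (M : R) (r : R).
Hypotheses (X_bd : forall alpha, nontrivial alpha -> bounded_op (X alpha)).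
Hypotheses (M_ge0 : 0 <= M) (X_M : forall s x, uniq s ->
  \sum_(alpha <- s | nontrivial alpha) (b alpha)^-1 * hnorm (X alpha x) ^+ 2 <= M * hnorm x ^+ 2).
Hypothesis r01 : 0 <= r < 1.

Definition level k : H -> H := \sum_(alpha : k.-tuple 'I_n)
    tensop tens (X alpha) ((r ^+ size alpha)%:C *: W alpha).

Lemma tuple_nontrivial k (alpha : k.-tuple 'I_n) : (0 < k)%N -> nontrivial alpha.
Proof. by move=> k0; rewrite /nontrivial -size_eq0 size_tuple -lt0n. Qed.

Lemma bounded_level k : (0 < k)%N -> bounded_op (level k).
Proof.
move=> k0; apply: bounded_op_sum => alpha _; rewrite tscale.
  by apply: bounded_opZ; apply: (tshP _ _).1; apply: X_bd; exact: tuple_nontrivial.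
by apply: X_bd; exact: tuple_nontrivial.
Qed.

Lemma level_iota k gamma x : (0 < k)%N ->
  level k (iota gamma x) = \sum_(alpha : k.-tuple 'I_n)
    (r ^+ k * sh alpha gamma)%:C *: iota (alpha ++ gamma) (X alpha x).
Proof.
move=> k0; rewrite /level fct_sumE; apply: eq_bigr => alpha _.
have hX := X_bd (tuple_nontrivial alpha k0).
by rewrite tscale// fctE tshE// scalerA -rmorphM /= size_tuple.
Qed.

(* The words alpha have a common length, so the images of the iota gamma x are
   orthogonal for distinct gamma. *)
Lemma level_bound k z : (0 < k)%N ->
  hnorm (level k z) <= Num.sqrt ((1 - r) ^- (m - 1) * M) * Num.sqrt r ^+ k * hnorm z.
Proof.
move=> k0; have /andP[r0 r1] := r01.
(* The squared norm carries r^(2k) times the binomial. One r^k absorbs the binomial through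
   [bin_mul_expr_le]; the other, after the square root, is the geometric rate. *)
set C := Num.sqrt _ * _.
have K0 : 0 <= (1 - r) ^- (m - 1) * M.
  by rewrite mulr_ge0// invr_ge0 exprn_ge0// subr_ge0 ltW.
have C0 : 0 <= C by rewrite mulr_ge0 ?exprn_ge0 ?sqrtr_ge0.
have hX (alpha : k.-tuple 'I_n) := X_bd (tuple_nontrivial alpha k0).
have orth g d x y (al be : k.-tuple 'I_n) : (g != d) || (al != be) ->
    inner ((r ^+ k * sh al g)%:C *: iota (al ++ g) (X al x))
          ((r ^+ k * sh be d)%:C *: iota (be ++ d) (X be y)) = 0.
  move=> ne; rewrite innerZl innerZr iota_orth ?mulr0//.
  by rewrite eqseq_cat ?size_tuple// negb_and orbC.
have [||||||T [Tl TM TE]] := @orth_ext R H H (word n) E iota (fun gamma x =>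
   \sum_(alpha : k.-tuple 'I_n) (r ^+ k * sh alpha gamma)%:C *: iota (alpha ++ gamma) (X alpha x)) C C0.
- exact: iota_lin.
- move=> g c u v; rewrite scaler_sumr -big_split /=; apply: eq_bigr => al _.
  by rewrite (hX al).1 (iota_lin e tensP) scalerDr !scalerA mulrC.
- by move=> *; exact: iota_orth.
- move=> g d x y gd; rewrite inner_suml big1// => al _; rewrite inner_sumr big1// => be _.
  by apply: orth; rewrite gd.
- move=> g x; rewrite hnorm_iota// -(@ler_pXn2r _ 2)// ?nnegrE ?mulr_ge0 ?hnorm_ge0//.
  rewrite orth_sum_sqr ?index_enum_uniq//; last by move=> al be ne; apply: orth; rewrite ne orbT.
  have -> : (C * hnorm x) ^+ 2 = (1 - r) ^- (m - 1) * r ^+ k * (M * hnorm x ^+ 2).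
    by rewrite !exprMn sqr_sqrtr// -exprM mulnC exprM sqr_sqrtr//; ring.
  have h : \sum_(al : k.-tuple 'I_n) (b al)^-1 * hnorm (X al x) ^+ 2 <= M * hnorm x ^+ 2.
    have := X_M (s := [seq val al | al : k.-tuple 'I_n]) x.
    rewrite map_inj_uniq ?enum_uniq => [|? ? /val_inj//]; move=> /(_ isT).
    rewrite big_map big_enum_cond /=.
    by under eq_bigl => al do rewrite (tuple_nontrivial al k0).
  apply: le_trans (ler_wpM2l _ h); last first.
    by rewrite mulr_ge0 ?exprn_ge0// invr_ge0 exprn_ge0// subr_ge0 ltW.
  rewrite mulr_sumr; apply: ler_sum => al _.
  rewrite hnormZr hnorm_iota// exprMn (real_normK (num_real _)) [leRHS]mulrA ler_wpM2r ?sqr_ge0//.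
  rewrite exprMn.
  apply: (@le_trans _ _ ((r ^+ k) ^+ 2 * (D k / b al))).
    by rewrite ler_wpM2l ?sqr_ge0// (le_trans (shift_coef_sqr_le _ _))// size_tuple.
  rewrite mulrA; apply: ler_wpM2r; first by rewrite invr_ge0 ltW.
  have h1 := bin_mul_expr_le k m_gt0 r01.
  apply: le_trans (ler_wpM2r (exprn_ge0 k r0) h1).
  by rewrite le_eqVlt; apply/orP; left; apply/eqP; ring.
- exact: iota_total.
have -> : level k = T; last exact: TM.
apply: (iota_op_eq e_basis tensP); [exact: bounded_level|by split=> //; exists C|].
by move=> g x; rewrite level_iota// TE.
Qed.

Lemma bounded_Apsum N : bounded_op (phi_r_Apsum e tens b X r N).
Proof.
rewrite /phi_r_Apsum big_nat_cond; apply: bounded_op_sum => k /andP[/andP[k0 _] _].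
exact: bounded_level.
Qed.

Lemma Apsum_cvg : exists S, op_cvg (phi_r_Apsum e tens b X r) S.
Proof.
have /andP[r0 r1] := r01.
apply: (@geometric_op_cvg _ H level (Num.sqrt ((1 - r) ^- (m - 1) * M)) (Num.sqrt r)).
- exact: sqrtr_ge0.
- by rewrite sqrtr_ge0 -[ltRHS]sqrtr1 ltr_sqrt.
- exact: bounded_level.
- by move=> k x k0; exact: level_bound.
Qed.

Lemma level_entry k gamma x omega y : (0 < k)%N ->
  inner (level k (iota gamma x)) (iota omega y) = \sum_(alpha : k.-tuple 'I_n)
    (r ^+ k * sh alpha gamma)%:C * (inner (X alpha x) y * (val alpha ++ gamma == omega)%:R).
Proof.
move=> k0; rewrite level_iota// inner_suml; apply: eq_bigr => al _.
by rewrite innerZl iota_inner.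
Qed.

Variable S : H -> H.
Hypothesis S_cvg : op_cvg (phi_r_Apsum e tens b X r) S.

(** Entries of the partial sums are constant from N = |alpha| on: lengths single out the level
    |alpha|, and there only the word [alpha] itself contributes. *)
Lemma Aseries_entry alpha gamma x y : nontrivial alpha ->
  inner (S (iota gamma x)) (iota (alpha ++ gamma) y) =
  (r ^+ size alpha * sh alpha gamma)%:C * inner (X alpha x) y.
Proof.
move=> al0; apply: (inner_cvg_unique (@op_cvg_pointwise _ _ _ _ (iota gamma x) bounded_Apsum S_cvg)).
have sz0 : (0 < size alpha)%N by rewrite lt0n size_eq0.
exists (size alpha) => // N /= alN.
rewrite /phi_r_Apsum fct_sumE inner_suml (bigD1_seq (size alpha)) ?iota_uniq ?mem_index_iota ?sz0//=.
rewrite [X in X + _]level_entry// (bigD1 (in_tuple alpha))//= eqxx mulr1.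
rewrite big1 ?addr0 => [|be ne].
  rewrite big_nat_cond big1 ?addr0// => k /andP[/andP[k0 _] ne]; rewrite [LHS]level_entry//.
  apply: big1 => be _; have [e1|_] := eqVneq (_ ++ _) (alpha ++ gamma); last by rewrite !mulr0.
  have := congr1 size e1; rewrite !size_cat size_tuple => /addIn kE.
  by case/eqP: ne.
rewrite eqseq_cat ?size_tuple// eqxx andbT.
have [e1|] := eqVneq (tval be) alpha; last by rewrite !mulr0.
by case/eqP: ne; apply: val_inj.
Qed.

Lemma Aseries_entry0 omega gamma x y :
  (forall alpha, nontrivial alpha -> omega != alpha ++ gamma) ->
  inner (S (iota gamma x)) (iota omega y) = 0.
Proof.
move=> h; apply: (inner_cvg_unique (@op_cvg_pointwise _ _ _ _ (iota gamma x) bounded_Apsum S_cvg)).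
exists 0%N => // N _; rewrite /phi_r_Apsum fct_sumE inner_suml big_nat_cond.
apply: big1 => k /andP[/andP[k0 _] _]; rewrite [LHS]level_entry// big1// => al _.
by rewrite eq_sym (negbTE (h _ (tuple_nontrivial al k0))) !mulr0.
Qed.

End Levels.

(** Turns the annihilation series into a creation series, so the bounds and entries already computed
    apply to it. *)
Lemma Bpsum_adjoint (B : word n -> E -> E) r N :
  (forall alpha, nontrivial alpha -> bounded_op (B alpha)) ->
  phi_r_Bpsum e tens b B r N =
  adjoint (phi_r_Apsum e tens b (fun alpha => adjoint (B alpha)) r N).
Proof.
move=> hB; have hB' al : nontrivial al -> bounded_op (adjoint (B al)).
  by move=> /hB; exact: bounded_adjoint.
apply/esym/adjoint_unique; first exact: bounded_Apsum.
move=> z w; rewrite /phi_r_Apsum /phi_r_Bpsum !fct_sumE inner_suml inner_sumr.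
rewrite big_nat_cond [RHS]big_nat_cond.
apply: eq_bigr => k /andP[/andP[k0 _] _]; rewrite !fct_sumE inner_suml inner_sumr.
apply: eq_bigr => al _; have al0 := tuple_nontrivial al k0.
rewrite tscale; last exact: hB'.
rewrite (tensop_coshift e_basis tensP b_gt0 shift_coef_bounded); last exact: hB.
rewrite !fctE innerZl innerZr conjc_real inner_adjoint//.
by apply: (tshP _ _).1; exact: hB'.
Qed.

End Series.

Lemma neq_cat {n} (alpha gamma : word n) : nontrivial alpha -> gamma != alpha ++ gamma.
Proof.
rewrite /nontrivial -size_eq0; apply: contraNneq => /(congr1 size) /eqP.
by rewrite size_cat -{1}[size gamma]add0n eqn_add2r eq_sym.
Qed.

Lemma cat_injr {n} (gamma alpha beta : word n) : alpha ++ gamma = beta ++ gamma -> alpha = beta.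
Proof.
move=> h; have /eqP : size (alpha ++ gamma) = size (beta ++ gamma) by rewrite h.
by rewrite !size_cat eqn_add2r => /eqP sz; move/eqP: h; rewrite eqseq_cat// eqxx andbT => /eqP.
Qed.

Lemma nontrivial_catl {n} (alpha beta : word n) : nontrivial alpha -> nontrivial (alpha ++ beta).
Proof. by case: alpha. Qed.

Lemma near_left1 (R : realType) : \forall r \near (1 : R)^'-, 0 <= r < 1.
Proof.
near=> r; apply/andP; split; near: r; last exact: nbhs_left_lt.
by near=> r; apply: ltW; near: r; apply: nbhs_left_gt.
Unshelve. all: by end_near.
Qed.

(** * Matrix entries of phi(rW) and phi(W), and damping by degree *)

Section Symbol.
Context {R : realType} {n m : nat} {E F H : hilbertType R}.
Variables (e : word n -> F) (tens : E -> F -> H) (b : word n -> R).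
Hypotheses (m_gt0 : (0 < m)%N).
Hypotheses (e_basis : orthonormal_basis e) (tensP : hilbert_tensor tens).
Hypotheses (b_gt0 : forall w, 0 < b w).
Local Notation D k := ('C(k + m - 1, m - 1)%:R : R).
Hypothesis b_cat : forall beta gamma,
  b beta * b gamma <= D (size beta) * b (beta ++ gamma).
Hypothesis b_catr : forall beta gamma,
  b beta * b gamma <= D (size gamma) * b (beta ++ gamma).
Variables (A B : word n -> E -> E).

Local Notation iota := (iota_op e tens).
Local Notation sh := (shift_coef b).
Local Notation W := (creation_word e b).
Local Notation phi := (phi_r e tens b A B).

(* The inner products of t with the vectors iota omega y when t is the image of
   iota gamma x under the formal series with coefficients w |alpha| A_alpha and
   w |alpha| B_alpha. *)
Definition entries_at (w : nat -> R) (gamma : word n) (x : E) (t : H) := [/\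
  forall alpha y, inner t (iota (alpha ++ gamma) y) =
    (w (size alpha) * sh alpha gamma)%:C * inner (A alpha x) y,
  forall alpha delta y, nontrivial alpha -> gamma = alpha ++ delta ->
    inner t (iota delta y) = (w (size alpha) * sh alpha delta)%:C * inner (B alpha x) y
  & forall omega y, ~~ rcomparable omega gamma -> inner t (iota omega y) = 0].

Lemma entries_at_unique w gamma x t t' :
  entries_at w gamma x t -> entries_at w gamma x t' -> t = t'.
Proof.
move=> [h1 h2 h3] [k1 k2 k3]; apply: (iota_ext e_basis tensP) => omega y.
case: (rcomparableP omega gamma) => [[al ->]|[al al0 ga]|nc].
- by rewrite h1 k1.
- by rewrite (h2 al)// (k2 al).
- by rewrite h3 ?k3.
Qed.

Lemma entries_at_damp w v gamma x t t' (f : word n -> R) :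
  (forall omega y, inner t' (iota omega y) = (f omega)%:C * inner t (iota omega y)) ->
  (forall alpha, f (alpha ++ gamma) * w (size alpha) = v (size alpha)) ->
  (forall alpha delta, gamma = alpha ++ delta -> f delta * w (size alpha) = v (size alpha)) ->
  entries_at w gamma x t -> entries_at v gamma x t'.
Proof.
move=> tt' f1 f2 [h1 h2 h3]; split.
- by move=> al y; rewrite tt' h1 mulrA -rmorphM /= mulrA f1.
- by move=> al de y al0 ga; rewrite tt' (h2 al)// mulrA -rmorphM /= mulrA (f2 al).
- by move=> om y nc; rewrite tt' h3// mulr0.
Qed.

Variable M : R.
Hypotheses (A_bd : forall alpha, bounded_op (A alpha)).
Hypotheses (B_bd : forall alpha, nontrivial alpha -> bounded_op (B alpha)).
Hypotheses (M_ge0 : 0 <= M) (A_M : forall s x, uniq s ->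
  \sum_(alpha <- s | nontrivial alpha) (b alpha)^-1 * hnorm (A alpha x) ^+ 2 <= M * hnorm x ^+ 2).
Hypotheses (B_M : forall s x, uniq s ->
  \sum_(alpha <- s | nontrivial alpha) (b alpha)^-1 * hnorm (adjoint (B alpha) x) ^+ 2 <= M * hnorm x ^+ 2).

Let Bs alpha := adjoint (B alpha).
Let A_bd' alpha (h : nontrivial alpha) := A_bd alpha.
Let Bs_bd alpha : nontrivial alpha -> bounded_op (Bs alpha).
Proof. by move=> /B_bd; exact: bounded_adjoint. Qed.

Let sh_bd := shift_coef_bounded b_gt0 b_cat.
Let tshE := tensop_shiftE e_basis tensP b_gt0 sh_bd.
Let tshP := is_tensop_shift e_basis tensP b_gt0 sh_bd.
Let tcoP := is_tensop_coshift e_basis tensP b_gt0 sh_bd.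

(** The identity is the creation operator of the empty word. *)
Lemma tensop_idP (X : E -> E) : bounded_op X -> is_tensop tens X id (tensop tens X id).
Proof. by move=> hX; have := tshP [::] hX. Qed.

Lemma phi_rP r : 0 <= r < 1 -> exists S1 S2,
  [/\ op_cvg (phi_r_Apsum e tens b Bs r) S1, op_cvg (phi_r_Apsum e tens b A r) S2,
      op_cvg (phi_r_Bpsum e tens b B r) (adjoint S1)
    & phi r = adjoint S1 + tensop tens (A [::]) id + S2].
Proof.
move=> r01.
have [S1 h1] := Apsum_cvg m_gt0 e_basis tensP b_gt0 b_cat Bs_bd M_ge0 B_M r01.
have [S2 h2] := Apsum_cvg m_gt0 e_basis tensP b_gt0 b_cat A_bd' M_ge0 A_M r01.
have hB : op_cvg (phi_r_Bpsum e tens b B r) (adjoint S1).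
  have -> : phi_r_Bpsum e tens b B r = (fun N => adjoint (phi_r_Apsum e tens b Bs r N)).
    by apply/funext => N; exact: (Bpsum_adjoint e_basis tensP b_gt0 b_cat).
  by apply: op_cvg_adjoint => // k; exact: bounded_Apsum.
exists S1, S2; split=> //; rewrite /phi_r; congr (_ + _ + _).
  apply: op_limE => // k; rewrite (Bpsum_adjoint e_basis tensP b_gt0 b_cat)//.
  by apply: bounded_adjoint; exact: bounded_Apsum.
by apply: op_limE => // k; exact: bounded_Apsum.
Qed.

Lemma bounded_phi_r r : 0 <= r < 1 -> bounded_op (phi r).
Proof.
move=> /phi_rP[S1 [S2 [h1 h2 _ ->]]]; apply: bounded_opD; last exact: h2.1.
apply: bounded_opD; first by apply: bounded_adjoint; exact: h1.1.
exact: (tensop_idP (A_bd [::])).1.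
Qed.

Lemma phi_r_entries r gamma x : 0 <= r < 1 ->
  entries_at (fun k => r ^+ k) gamma x (phi r (iota gamma x)).
Proof.
move=> r01; have [S1 [S2 [h1 h2 _ ->]]] := phi_rP r01.
have bS1 := h1.1.
have A1 := Aseries_entry e_basis tensP b_gt0 b_cat A_bd' h2.
have A0 := Aseries_entry0 e_basis tensP b_gt0 b_cat A_bd' h2.
have B1 := Aseries_entry e_basis tensP b_gt0 b_cat Bs_bd h1.
have B0 := Aseries_entry0 e_basis tensP b_gt0 b_cat Bs_bd h1.
have mid g om y : inner (tensop tens (A [::]) id (iota g x)) (iota om y) =
    inner (A [::] x) y * (g == om)%:R.
  by rewrite /iota_op (tensop_idP (A_bd [::])).2 (iota_inner e_basis tensP).
split.
- move=> al y; rewrite !fctE !innerDl inner_adjointl// mid.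
  rewrite (inner_conj (S1 _)) (B0 gamma (al ++ gamma)) ?conjc0 ?add0r; last first.
    by move=> be be0; rewrite catA neq_cat// nontrivial_catl.
  have [->|al0] := eqVneq al [::].
    rewrite /= eqxx shift_coef_nil// expr0 !mulr1 mul1r A0 ?addr0//.
    by move=> be be0; exact: neq_cat.
  by rewrite A1// (negbTE (neq_cat gamma al0)) mulr0 add0r.
- move=> al de y al0 ->; rewrite !fctE !innerDl inner_adjointl// mid.
  rewrite [X in _ + X]A0 ?addr0; last first.
    by move=> be be0; rewrite catA neq_cat// nontrivial_catl.
  rewrite eq_sym (negbTE (neq_cat de al0)) mulr0 addr0.
  rewrite (inner_conj (S1 _)) B1// rmorphM /= oppr0; congr (_ * _).
  rewrite -inner_conj /Bs -inner_adjoint//; exact: B_bd.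
- move=> om y nc; rewrite !fctE !innerDl inner_adjointl// mid.
  have om1 be : om != be ++ gamma.
    by apply: contraNneq nc => ->; exact: rcomparable_cat.
  have ga1 be : gamma != be ++ om.
    by apply: contraNneq nc => ->; rewrite rcomparableC rcomparable_cat.
  rewrite A0; last by move=> be _; exact: om1.
  rewrite (inner_conj (S1 _)) B0 ?conjc0; last by move=> be _; exact: ga1.
  by rewrite (negbTE (ga1 [::])) mulr0 !addr0.
Qed.

(** The summands sit at the distinct words alpha gamma, hence are orthogonal, and [b_catr] bounds
    b_gamma / b_(alpha gamma) by a constant depending on |gamma| over b_alpha. *)
Lemma phi_W_Acvg gamma x : exists l : H,
  [/\ word_psum predT (fun alpha => tensop tens (A alpha) (W alpha) (iota gamma x)) @ totally --> l,
      forall alpha y, inner l (iota (alpha ++ gamma) y) = (sh alpha gamma)%:C * inner (A alpha x) y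
    & forall omega y, (forall alpha, omega != alpha ++ gamma) -> inner l (iota omega y) = 0].
Proof.
pose u alpha := tensop tens (A alpha) (W alpha) (iota gamma x).
have uE al : u al = (sh al gamma)%:C *: iota (al ++ gamma) (A al x) by rewrite /u tshE.
(* The second summand of the bound accounts for the empty word, which [A_M] leaves out. *)
have [||l hl] := @orth_cvg _ H (word n) predT u
    (D (size gamma) * (M * hnorm x ^+ 2 + (b [::])^-1 * hnorm (A [::] x) ^+ 2)).
- move=> i j ne; rewrite !uE innerZl innerZr (iota_orth e_basis tensP) ?mulr0//.
  by apply: contraNneq ne => /cat_injr ->.
- move=> s us.
  have h1 : \sum_(al <- s) (b al)^-1 * hnorm (A al x) ^+ 2 <=
      M * hnorm x ^+ 2 + (b [::])^-1 * hnorm (A [::] x) ^+ 2.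
    rewrite (bigID nontrivial)/= lerD ?A_M// -big_filter.
    have p0 al : 0 <= (b al)^-1 * hnorm (A al x) ^+ 2.
      by rewrite mulr_ge0 ?sqr_ge0// invr_ge0 ltW.
    have -> : [seq i <- s | ~~ nontrivial i] = [seq i <- s | pred1 [::] i].
      by apply: eq_filter => al; rewrite /nontrivial negbK.
    have [s0|s0] := boolP ([::] \in s).
      by rewrite filter_pred1_uniq// big_seq1.
    rewrite big_filter big_seq_cond big1 ?p0// => al /andP[als /eqP al0].
    by rewrite al0 (negbTE s0) in als.
  rewrite -[leLHS]/(\sum_(i <- s) hnorm (u i) ^+ 2).
  have D0 : 0 <= D (size gamma) by [].
  apply: le_trans (ler_wpM2l D0 h1); rewrite mulr_sumr; apply: ler_sum => al _.
  rewrite uE hnormZr (hnorm_iota e_basis tensP) exprMn (real_normK (num_real _)).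
  rewrite [leRHS]mulrA; apply: ler_wpM2r; first exact: sqr_ge0.
  rewrite shift_coef_sqr// ler_pdivrMr// mulrAC ler_pdivlMr//.
  by rewrite mulrC b_catr.
exists l; split.
- exact: hl.
- move=> al y; apply: (inner_cvg_unique hl); exists [fset al]%fset => //= J alJ.
  rewrite inner_suml (bigD1_seq al)//= ?uE ?innerZl ?(iota_same e_basis tensP) ?fset_uniq//.
    rewrite big1 ?addr0// => be ne; rewrite uE innerZl (iota_orth e_basis tensP) ?mulr0//.
    by apply: contraNneq ne => /cat_injr ->.
  by rewrite -fsub1set.
- move=> om y h; apply: (inner_cvg_unique hl); apply: nearW => J.
  rewrite inner_suml big1// => be _; rewrite uE innerZl (iota_orth e_basis tensP) ?mulr0//.
  by rewrite eq_sym.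
Qed.

Lemma tensop_coshift_entry alpha gamma omega x y : nontrivial alpha ->
  inner (tensop tens (B alpha) (adjoint (W alpha)) (iota gamma x)) (iota omega y) =
  (sh alpha omega)%:C * inner (B alpha x) y * (gamma == alpha ++ omega)%:R.
Proof.
move=> al0; rewrite (is_tensop_eq e_basis tensP (tcoP alpha (B_bd al0))).
rewrite inner_adjointl; last by apply: (tshP _ _).1; exact: Bs_bd.
rewrite tshE; last exact: Bs_bd.
rewrite innerZr conjc_real (iota_inner e_basis tensP) -mulrA; congr (_ * (_ * _)).
by rewrite /Bs -inner_adjoint//; exact: B_bd.
Qed.

(** The adjoint of W_alpha kills e_gamma unless alpha is a prefix of gamma, so the sum is finite and
    the partial sums are constant once they contain the prefixes, collected in [J0]. *)
Lemma phi_W_Bcvg gamma x : exists l : H,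
  [/\ word_psum nontrivial (fun alpha => tensop tens (B alpha) (adjoint (W alpha)) (iota gamma x))
        @ totally --> l,
      forall alpha omega y, nontrivial alpha -> gamma = alpha ++ omega ->
        inner l (iota omega y) = (sh alpha omega)%:C * inner (B alpha x) y
    & forall omega y, (forall alpha, nontrivial alpha -> gamma != alpha ++ omega) ->
        inner l (iota omega y) = 0].
Proof.
pose u alpha := tensop tens (B alpha) (adjoint (W alpha)) (iota gamma x).
have uE al om y : nontrivial al -> inner (u al) (iota om y) =
    (sh al om)%:C * inner (B al x) y * (gamma == al ++ om)%:R.
  exact: tensop_coshift_entry.
pose J0 : {fset word n} := seq_fset tt [seq take k gamma | k <- index_iota 0 (size gamma).+1].
have u0 al : nontrivial al -> al \notin J0 -> u al = 0.
  move=> al0; rewrite seq_fsetE => alJ0; apply: (iota_ext e_basis tensP) => om y.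
  rewrite uE// inner0l; have [ga|_] := eqVneq gamma _; last by rewrite mulr0.
  case/negP: alJ0; apply/mapP; exists (size al).
    by rewrite mem_index_iota ltnS ga size_cat leq_addr.
  by rewrite ga take_size_cat.
exists (word_psum nontrivial u J0); split.
- apply: cvg_near_cst; exists J0 => //= J J0J; rewrite /word_psum (big_fset_sub _ _ J0J).
  rewrite [X in _ + X]big_seq_cond [X in _ + X]big1 ?addr0// => al.
  by rewrite mem_filter => /andP[/andP[alJ0 _] al0]; exact: u0.
- move=> al om y al0 ga; have alJ0 : al \in J0.
    rewrite seq_fsetE; apply/mapP; exists (size al).
      by rewrite mem_index_iota ltnS ga size_cat leq_addr.
    by rewrite ga take_size_cat.
  have fu : uniq [seq i <- J0 | nontrivial i] by apply: filter_uniq; exact: fset_uniq.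
  rewrite inner_suml -big_filter (bigD1_seq al)/= ?fu ?mem_filter ?al0//.
  rewrite uE// (introT eqP ga) mulr1 big_filter_cond.
  rewrite big1 ?addr0// => be /andP[be0 ne]; rewrite uE//.
  have [e1|] := eqVneq gamma (be ++ om); last by rewrite mulr0.
  by move: e1 ne; rewrite ga => /cat_injr ->; rewrite eqxx.
- move=> om y h; rewrite inner_suml big1// => al al0.
  by rewrite uE// (negbTE (h _ al0)) mulr0.
Qed.

Lemma phi_W_iotaP gamma x : exists lB lA : H,
  [/\ word_psum nontrivial (fun alpha => tensop tens (B alpha) (adjoint (W alpha)) (iota gamma x))
        @ totally --> lB,
      word_psum predT (fun alpha => tensop tens (A alpha) (W alpha) (iota gamma x)) @ totally --> lA
    & entries_at (fun=> 1) gamma x (lB + lA)].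
Proof.
have [lB [hB B1 B0]] := phi_W_Bcvg gamma x; have [lA [hA A1 A0]] := phi_W_Acvg gamma x.
exists lB, lA; split=> //; split.
- move=> al y; rewrite innerDl A1 mul1r B0 ?add0r// => be be0.
  by rewrite catA neq_cat// nontrivial_catl.
- move=> al de y al0 ga; rewrite innerDl (B1 al)// mul1r A0 ?addr0// => be.
  by rewrite ga catA neq_cat//; case: be.
- move=> om y nc; rewrite innerDl A0 ?addr0 ?B0// => al.
    by move=> _; apply: contraNneq nc => ->; rewrite rcomparableC rcomparable_cat.
  by apply: contraNneq nc => ->; exact: rcomparable_cat.
Qed.

Lemma phi_W_iota gamma x : entries_at (fun=> 1) gamma x (phi_W e tens b A B (iota gamma x)).
Proof.
have [lB [lA [hB hA h]]] := phi_W_iotaP gamma x; rewrite /phi_W.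
by rewrite (cvg_lim (@norm_hausdorff _ _) hB) (cvg_lim (@norm_hausdorff _ _) hA).
Qed.

(** [phi_W] is a sum of two limits, so it is additive only where these are known to exist; the
    limits are therefore taken monomial by monomial and then added. *)
Lemma phi_W_poly (T : H -> H) : bounded_op T ->
  (forall gamma x, entries_at (fun=> 1) gamma x (T (iota gamma x))) ->
  forall q, E_poly e tens q -> phi_W e tens b A B q = T q.
Proof.
move=> hT hTe _ [s [h ->]].
have /choice[l hl] : forall p : word n, exists l : H * H,
  [/\ word_psum nontrivial (fun alpha => tensop tens (B alpha) (adjoint (W alpha)) (iota p (h p)))
        @ totally --> l.1,
      word_psum predT (fun alpha => tensop tens (A alpha) (W alpha) (iota p (h p))) @ totally --> l.2
    & entries_at (fun=> 1) p (h p) (l.1 + l.2)].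
  by move=> p; have [lB [lA hh]] := phi_W_iotaP p (h p); exists (lB, lA).
have hB : word_psum nontrivial (fun alpha => tensop tens (B alpha) (adjoint (W alpha))
    (\sum_(p <- s) tens (h p) (e p))) @ totally --> (\sum_(p <- s) (l p).1 : H).
  have -> : word_psum nontrivial (fun alpha => tensop tens (B alpha) (adjoint (W alpha))
      (\sum_(p <- s) tens (h p) (e p))) = (fun J => \sum_(p <- s)
      word_psum nontrivial (fun alpha => tensop tens (B alpha) (adjoint (W alpha)) (iota p (h p))) J).
    apply/funext => J; rewrite /word_psum exchange_big /=; apply: eq_bigr => al al0.
    rewrite (lin_sum (is_tensopP e_basis tensP (tcoP al (B_bd al0))).1.1)//.
  by apply: hcvg_sum => p; have [] := hl p.
have hA : word_psum predT (fun alpha => tensop tens (A alpha) (W alpha)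
    (\sum_(p <- s) tens (h p) (e p))) @ totally --> (\sum_(p <- s) (l p).2 : H).
  have -> : word_psum predT (fun alpha => tensop tens (A alpha) (W alpha)
      (\sum_(p <- s) tens (h p) (e p))) = (fun J => \sum_(p <- s)
      word_psum predT (fun alpha => tensop tens (A alpha) (W alpha) (iota p (h p))) J).
    apply/funext => J; rewrite /word_psum exchange_big /=; apply: eq_bigr => al _.
    by rewrite (lin_sum (tshP al (A_bd al)).1.1).
  by apply: hcvg_sum => p; have [] := hl p.
rewrite /phi_W (cvg_lim (@norm_hausdorff _ _) hB) (cvg_lim (@norm_hausdorff _ _) hA).
rewrite -big_split (lin_sum hT.1); apply: eq_bigr => p _ /=.
by have [_ _ h1] := hl p; exact: entries_at_unique h1 (hTe _ _).
Qed.

(** The absolute value |i - k|: at least one truncated difference is 0. *)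
Definition degdist (i k : nat) : nat := (i - k) + (k - i).

(** [k] is the degree of a fixed input vector, so the exponent depends on the output word alone and
    the operator is diagonal. Being self-adjoint, it also scales the entries of arbitrary
    vectors. *)
Lemma damp_ex (k : nat) (r : R) : 0 <= r <= 1 -> exists T : H -> H,
  [/\ bounded_op T, forall z, hnorm (T z) <= hnorm z,
      forall omega y, T (iota omega y) = (r ^+ degdist (size omega) k)%:C *: iota omega y
    & forall z omega y, inner (T z) (iota omega y) =
        (r ^+ degdist (size omega) k)%:C * inner z (iota omega y)].
Proof.
move=> /andP[r0 r1].
have [|||T [Tl TM TE]] := @diag_ext R n E F H e tens e_basis tensP id
    (fun omega y => (r ^+ degdist (size omega) k)%:C *: y) predT 1 ler01.
- by [].
- by move=> g c u v; rewrite scalerDr !scalerA mulrC.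
- move=> g y; rewrite hnormZr ger0_norm ?exprn_ge0// ler_wpM2r ?hnorm_ge0//.
  exact: exprn_ile1.
have hT : bounded_op T by split=> //; exists 1.
have TE' om y : T (iota om y) = (r ^+ degdist (size om) k)%:C *: iota om y.
  by rewrite TE (linZ (iota_lin _ tensP _)).
exists T; split=> // [z|z om y]; first by have := TM z; rewrite mul1r.
rewrite inner_adjoint//.
have -> : adjoint T (iota om y) = (r ^+ degdist (size om) k)%:C *: iota om y.
  apply: (iota_ext e_basis tensP) => de v.
  rewrite inner_adjointl// TE' innerZl innerZr conjc_real (iota_inner e_basis tensP).
  by have [->|_] := eqVneq om de; rewrite ?mulr0.
by rewrite innerZr conjc_real.
Qed.

Lemma damp_entries k r (T : H -> H) gamma x t : size gamma = k ->
  (forall z omega y, inner (T z) (iota omega y) =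
        (r ^+ degdist (size omega) k)%:C * inner z (iota omega y)) ->
  entries_at (fun=> 1) gamma x t -> entries_at (fun j => r ^+ j) gamma x (T t).
Proof.
move=> gk hT; apply: (entries_at_damp (f := fun om => r ^+ degdist (size om) k)) => //.
- move=> al; rewrite mulr1 /degdist -gk size_cat addnK; congr (_ ^+ _); lia.
- move=> al de ga; rewrite mulr1 /degdist -gk ga size_cat; congr (_ ^+ _); lia.
Qed.

Lemma damp_cvg (T : R -> H -> H) (k : nat) :
  (forall r, 0 <= r <= 1 -> [/\ bounded_op (T r), forall z, hnorm (T r z) <= hnorm z
    & forall omega y, T r (iota omega y) = (r ^+ degdist (size omega) k)%:C *: iota omega y]) ->
  forall z, T r z @[r --> 1^'-] --> (z : H).
Proof.
move=> hT.
have near01 : \forall r \near (1 : R)^'-, 0 <= r <= 1.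
  by apply: filterS (near_left1 R) => r /andP[-> /ltW].
have hcv om y : T r (iota om y) @[r --> 1^'-] --> iota om y.
  apply/hcvgP => eps eps0.
  have h : r ^+ degdist (size om) k @[r --> 1^'-] --> (1 : R).
    rewrite -[X in _ --> X](expr1n _ (degdist (size om) k)).
    by apply: cvg_at_left_filter; exact: exprn_continuous.
  have y1 : 0 < hnorm y + 1 by rewrite ltr_wpDl// hnorm_ge0.
  have d0 : 0 < eps / (hnorm y + 1) by rewrite divr_gt0.
  have /cvgrPdist_lt/(_ _ d0) hd := h.
  apply: filterS2 near01 hd => r r01; rewrite ltr_pdivlMr// => hr.
  have [_ _ ->] := hT _ r01.
  rewrite -[X in _ - X]scale1r -scalerBl -(rmorph1 (real_complex R)) -rmorphB /= hnormZr.
  rewrite (hnorm_iota e_basis tensP) distrC.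
  by apply: le_lt_trans hr; rewrite ler_wpM2l// lerDl.
have [|om y|S [Sl SM SE]] := sot_cvg (FG := _) (M := 1) ler01 (iota_total e_basis tensP) (U := T) (G := 1^'-).
- by apply: filterS near01 => r /hT[[h1 _] h2 _]; split=> // z; rewrite mul1r.
- by exists (iota om y); exact: hcv.
suff SI : S = id by rewrite SI in SE.
apply: (iota_op_eq e_basis tensP); [by split=> //; exists 1|exact: bounded_op_id|].
by move=> om y; exact: (hcvg_unique (SE _) (hcv om y)).
Qed.

Lemma phi_r_damp r T gamma x : 0 <= r < 1 ->
  (forall z omega y, inner (T z) (iota omega y) =
        (r ^+ degdist (size omega) (size gamma))%:C * inner z (iota omega y)) ->
  phi r (iota gamma x) = T (phi_W e tens b A B (iota gamma x)).
Proof.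
move=> r01 hT; apply: entries_at_unique (phi_r_entries gamma x r01) _.
by apply: damp_entries => //; exact: phi_W_iota.
Qed.

Lemma phi_r_iota_cvg gamma x :
  phi r (iota gamma x) @[r --> 1^'-] --> phi_W e tens b A B (iota gamma x).
Proof.
(* Outside [0, 1] the value 0 is a placeholder; it does not affect the left limit at 1. *)
have /choice[T hT] : forall r : R, exists T : H -> H, 0 <= r <= 1 ->
  [/\ bounded_op T, forall z, hnorm (T z) <= hnorm z,
      forall omega y, T (iota omega y) = (r ^+ degdist (size omega) (size gamma))%:C *: iota omega y
    & forall z omega y, inner (T z) (iota omega y) =
        (r ^+ degdist (size omega) (size gamma))%:C * inner z (iota omega y)].
  move=> r; have [/(damp_ex (size gamma))[T hT]|nr] := boolP (0 <= r <= 1).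
    by exists T.
  by exists 0 => h; case/negP: nr.
have h := @damp_cvg T (size gamma).
have {h}/(_ (phi_W e tens b A B (iota gamma x))) h : forall z : H, T r z @[r --> 1^'-] --> z.
  by apply: h => r /hT[].
apply: cvg_trans h; apply: near_eq_cvg; apply: filterS (near_left1 R) => r r01.
apply/esym/phi_r_damp => //; have /hT[] // : 0 <= r <= 1.
by case/andP: r01 => -> /ltW.
Qed.

Lemma phi_r_sot (C : R) : 0 <= C -> (forall r z, 0 <= r < 1 -> hnorm (phi r z) <= C * hnorm z) ->
  exists T : H -> H, [/\ bounded_op T,
    forall gamma x, entries_at (fun=> 1) gamma x (T (iota gamma x))
    & forall z, phi r z @[r --> 1^'-] --> (T z : H)].
Proof.
move=> C0 hC.
have [|om y|T [Tl TM TE]] := sot_cvg (FG := _) (M := C) C0 (iota_total e_basis tensP) (U := phi) (G := 1^'-).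
- by apply: filterS (near_left1 R) => r r01; split=> [|z]; [exact: (bounded_phi_r r01).1|exact: hC].
- by exists (phi_W e tens b A B (iota om y)); exact: phi_r_iota_cvg.
exists T; split=> //; first by split=> //; exists C.
move=> g x; rewrite (_ : T _ = phi_W e tens b A B (iota g x)); first exact: phi_W_iota.
by apply: (hcvg_unique (TE _)); exact: phi_r_iota_cvg.
Qed.

End Symbol.

(** * Schur multiplication by r^|j-k| *)

Section Gram.
Context {R : realType}.

(* gram r _ k is the coefficient sequence of the k-th vector of a stationary
   autoregressive sequence of unit vectors: v_(k+1) = r v_k + sqrt (1 - r^2) f_(k+1). *)
Definition gram (r : R) (i k : nat) : R :=
  if i is 0 then r ^+ k
  else if (i <= k)%N then Num.sqrt (1 - r ^+ 2) * r ^+ (k - i) else 0.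

(** For j+1 and k+1 the terms at 0 and 1 add up to r^(j+k), the term at 0 for j and k; all later
    terms are those of j and k shifted by one. *)
Lemma gram_sum r N j k : 0 <= r < 1 -> (j <= N)%N -> (k <= N)%N ->
  \sum_(0 <= i < N.+1) gram r i j * gram r i k = r ^+ degdist j k.
Proof.
move=> /andP[r0 r1].
have s2 : Num.sqrt (1 - r ^+ 2) * Num.sqrt (1 - r ^+ 2) = 1 - r ^+ 2.
  by rewrite -expr2 sqr_sqrtr// subr_ge0 exprn_ile1// ltW.
have base N' k' : \sum_(0 <= i < N'.+1) gram r i 0 * gram r i k' = r ^+ k'.
  rewrite big_nat_recl// big1 ?addr0 ?mul1r// => i _.
  by rewrite {1}/gram ltn0 mul0r.
elim: N j k => [|N IH] [|j] [|k] //= jN kN; rewrite ?base//.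
- under eq_bigr do rewrite mulrC.
  by rewrite base /degdist subn0 addn0.
- have := IH j k jN kN; rewrite big_nat_recl// => IHjk.
  have -> : degdist j.+1 k.+1 = degdist j k by rewrite /degdist !subSS.
  rewrite -IHjk big_nat_recl// big_nat_recl// addrA; congr (_ + _).
  rewrite /gram /= !subn1 /= mulrACA s2 !exprS; ring.
Qed.

End Gram.

Section Schur.
Context {R : realType} {n : nat} {E F H : hilbertType R}.
Variables (e : word n -> F) (tens : E -> F -> H).
Hypotheses (e_basis : orthonormal_basis e) (tensP : hilbert_tensor tens).
Local Notation iota := (iota_op e tens).
Implicit Types (s t : seq (word n * E)).

Let poly s : H := \sum_(u <- s) iota u.1 u.2.
(** The i-th component of the image of [poly s] when a vector of degree k is tensored with the k-th
    Gram vector. It vanishes for i above the degrees in s, so finite sums over i suffice. *)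
Let gpoly r i s : H := \sum_(u <- s) (gram r i (size u.1))%:C *: iota u.1 u.2.

Lemma gram_form (T : H -> H) r s t N : linear T -> 0 <= r < 1 ->
  (forall u, u \in s -> (size u.1 <= N)%N) -> (forall u, u \in t -> (size u.1 <= N)%N) ->
  \sum_(0 <= i < N.+1) inner (T (gpoly r i s)) (gpoly r i t) =
  \sum_(u <- s) \sum_(v <- t) (r ^+ degdist (size u.1) (size v.1))%:C *
    inner (T (iota u.1 u.2)) (iota v.1 v.2).
Proof.
move=> Tl r01 sN tN.
have E1 i : inner (T (gpoly r i s)) (gpoly r i t) = \sum_(u <- s) \sum_(v <- t)
    (gram r i (size u.1) * gram r i (size v.1))%:C * inner (T (iota u.1 u.2)) (iota v.1 v.2).
  rewrite /gpoly (lin_sum Tl) inner_suml; apply: eq_bigr => u _.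
  rewrite inner_sumr; apply: eq_bigr => v _.
  by rewrite (linZ Tl) innerZl innerZr conjc_real mulrA -rmorphM.
under eq_bigr => i _ do rewrite E1.
rewrite exchange_big /= big_seq [RHS]big_seq; apply: eq_bigr => u us.
rewrite exchange_big /= big_seq [RHS]big_seq; apply: eq_bigr => v vt.
by rewrite -mulr_suml -rmorph_sum /= (gram_sum r01 (sN _ us) (tN _ vt)).
Qed.

(** Tensoring with the Gram vectors is an isometry V, and P is the compression by V of a direct sum
    of copies of T; in coordinates, the form of P at p, q is the sum over i of the form of T at p_i,
    q_i. *)
Lemma schur_bound (T P : H -> H) (M r : R) : 0 <= M -> 0 <= r < 1 ->
  bounded_op T -> (forall z, hnorm (T z) <= M * hnorm z) -> bounded_op P ->
  (forall gamma omega x y, inner (P (iota gamma x)) (iota omega y) =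
     (r ^+ degdist (size gamma) (size omega))%:C * inner (T (iota gamma x)) (iota omega y)) ->
  forall z, hnorm (P z) <= M * hnorm z.
Proof.
move=> M0 r01 hT TM hP PT.
(* The arithmetic mean of the squares replaces the product of the norms, because it can be summed
   over i term by term. *)
have bnd s t : Re (inner (P (poly s)) (poly t)) <=
    M * ((hnorm (poly s) ^+ 2 + hnorm (poly t) ^+ 2) / 2).
  pose N := \max_(u <- s ++ t) size u.1.
  have sN u : u \in s -> (size u.1 <= N)%N.
    by move=> us; apply: (@leq_bigmax_seq _ _ xpredT (fun v : word n * E => size v.1) u); rewrite // mem_cat us.
  have tN u : u \in t -> (size u.1 <= N)%N.
    by move=> ut; apply: (@leq_bigmax_seq _ _ xpredT (fun v : word n * E => size v.1) u); rewrite // mem_cat ut orbT.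
  have -> : inner (P (poly s)) (poly t) = \sum_(0 <= i < N.+1) inner (T (gpoly r i s)) (gpoly r i t).
    rewrite (gram_form hT.1 r01 sN tN) /poly (lin_sum hP.1) inner_suml.
    by apply: eq_bigr => u _; rewrite inner_sumr; apply: eq_bigr => v _; rewrite PT.
  (* The case T = id of [gram_form]: distinct words give orthogonal vectors, and the kernel is 1 on
     the diagonal. *)
  have nrm s' : (forall u, u \in s' -> (size u.1 <= N)%N) ->
      \sum_(0 <= i < N.+1) hnorm (gpoly r i s') ^+ 2 = hnorm (poly s') ^+ 2.
    move=> s'N; have := gram_form (bounded_op_id H).1 r01 s'N s'N.
    rewrite hnorm_sqr /poly inner_suml => h; apply: (@complexI R).
    rewrite rmorph_sum /=.
    under eq_bigr => i _ do rewrite -inner_hnorm.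
    rewrite h.
    have -> : (\sum_(u <- s') \sum_(v <- s') (r ^+ degdist (size u.1) (size v.1))%:C *
        inner (iota u.1 u.2) (iota v.1 v.2)) = inner (poly s') (poly s').
      rewrite /poly inner_suml; apply: eq_bigr => u _; rewrite inner_sumr; apply: eq_bigr => v _.
      rewrite (iota_inner e_basis tensP); have [->|_] := eqVneq u.1 v.1; last by rewrite !mulr0.
      by rewrite /degdist subnn mul1r.
    by rewrite -inner_suml -/(poly s') inner_hnorm.
  rewrite -(nrm s sN) -(nrm t tN) -big_split /= mulr_suml mulr_sumr raddf_sum /=.
  apply: ler_sum => i _; rewrite (le_trans (Re_inner_le _ _))//.
  have h1 := TM (gpoly r i s); have h2 := hnorm_ge0 (gpoly r i t).
  apply: (@le_trans _ _ (M * hnorm (gpoly r i s) * hnorm (gpoly r i t))).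
    by rewrite ler_wpM2r.
  rewrite -mulrA ler_wpM2l// ler_pdivlMr//.
  have := sqr_ge0 (hnorm (gpoly r i s) - hnorm (gpoly r i t)); nra.
have bnd2 s t : Re (inner (P (poly s)) (poly t)) <= M * (hnorm (poly s) * hnorm (poly t)).
  have [s0|s0] := eqVneq (hnorm (poly s)) 0.
    by rewrite (hnorm0_eq0 s0) (lin0 hP.1) inner0l hnorm0 mul0r mulr0.
  have [t0|t0] := eqVneq (hnorm (poly t)) 0.
    by rewrite (hnorm0_eq0 t0) inner0r hnorm0 !mulr0.
  have ps : 0 < hnorm (poly s) by rewrite lt_def s0 hnorm_ge0.
  have pt : 0 < hnorm (poly t) by rewrite lt_def t0 hnorm_ge0.
  (* Rescaling the second vector by [a] makes both norms equal, where the arithmetic and geometric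
     means agree. *)
  pose a := hnorm (poly s) / hnorm (poly t).
  have a0 : 0 < a by rewrite divr_gt0.
  have := bnd s [seq (u.1, a%:C *: u.2) | u <- t].
  have -> : poly [seq (u.1, a%:C *: u.2) | u <- t] = a%:C *: poly t.
    rewrite /poly big_map scaler_sumr; apply: eq_bigr => u _ /=.
    by rewrite (linZ (iota_lin _ tensP _)).
  rewrite innerZr conjc_real hnormZr (ger0_norm (ltW a0)).
  have -> : Re (a%:C * inner (P (poly s)) (poly t)) = a * Re (inner (P (poly s)) (poly t)).
    by case: (inner _ _) => p q /=; rewrite mul0r subr0.
  have -> : a * hnorm (poly t) = hnorm (poly s) by rewrite /a mulfVK.
  rewrite -ler_pdivlMl// => /le_trans; apply.
  rewrite le_eqVlt; apply/orP; left; apply/eqP; rewrite /a; field.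
  by rewrite s0 t0.
have bnd3 s : hnorm (P (poly s)) <= M * hnorm (poly s).
  have [s0|s0] := eqVneq (hnorm (P (poly s))) 0.
    by rewrite s0 mulr_ge0// hnorm_ge0.
  have ps : 0 < hnorm (P (poly s)) by rewrite lt_def s0 hnorm_ge0.
  rewrite -(ler_pM2l ps).
  apply: (@ler_addgt0_mul _ _ _ (hnorm (P (poly s)) + M * hnorm (poly s))).
    by rewrite addr_ge0 ?mulr_ge0 ?hnorm_ge0.
  (* [P (poly s)] need not be a finite sum, so it is approximated by one before being used as the
     second argument of [bnd2]. *)
  move=> eps eps0; have [t ht] := iota_total e_basis tensP (P (poly s)) eps0.
  rewrite -expr2 hnorm_sqr -{2}(subrK (poly t) (P (poly s))) innerDr raddfD /=.
  have h1 := Re_inner_le (P (poly s)) (P (poly s) - poly t).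
  have h2 := bnd2 s t.
  have h3 : hnorm (poly t) <= hnorm (P (poly s)) + eps.
    rewrite -{1}(subrK (P (poly s)) (poly t)) addrC (le_trans (ler_hnormD _ _))//.
    by rewrite lerD2l hdistC ltW.
  have h4 : M * (hnorm (poly s) * hnorm (poly t)) <=
      M * (hnorm (poly s) * (hnorm (P (poly s)) + eps)).
    by rewrite ler_wpM2l// ler_wpM2l ?hnorm_ge0.
  have h5 : hnorm (P (poly s)) * hnorm (P (poly s) - poly t) <= hnorm (P (poly s)) * eps.
    by rewrite ler_wpM2l ?hnorm_ge0// ltW.
  move: h1 h2 h4 h5; rewrite /poly; nra.
move=> z; have [C C0 hC] := bounded_op_ge0 hP.
apply: (@ler_addgt0_mul _ _ _ (C + M)); first by rewrite addr_ge0.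
move=> eps eps0; have [s hs] := iota_total e_basis tensP z eps0.
rewrite -/(poly s) in hs.
have -> : P z = P (z - poly s) + P (poly s) by rewrite -(linD hP.1) subrK.
rewrite (le_trans (ler_hnormD _ _))//.
have h1 := hC (z - poly s); have h2 := bnd3 s.
have h3 : hnorm (poly s) <= hnorm z + eps.
  rewrite -{1}(subrK z (poly s)) addrC (le_trans (ler_hnormD _ _))//.
  by rewrite lerD2l hdistC ltW.
have h4 : C * hnorm (z - poly s) <= C * eps by rewrite ler_wpM2l// ltW.
have h5 : M * hnorm (poly s) <= M * (hnorm z + eps) by rewrite ler_wpM2l.
lra.
Qed.

End Schur.

(** * Multi-Toeplitz operators and their symbols *)

Section SpatialTensor.
Context {R : realType} {E F H : hilbertType R} (tens : E -> F -> H) (AF : set (F -> F)).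

Definition algebraic_tensor : set (H -> H) :=
  [set S | exists (k : nat) (A : 'I_k -> E -> E) (X : 'I_k -> F -> F),
    (forall i, bounded_op (A i) /\ AF (X i)) /\
    S = \sum_(i < k) tensop tens (A i) (X i)].

Lemma algebraic_tensor1 A X : bounded_op A -> AF X -> algebraic_tensor (tensop tens A X).
Proof. by move=> hA hX; exists 1%N, (fun=> A), (fun=> X); rewrite big_ord1. Qed.

Lemma algebraic_tensorD S T :
  algebraic_tensor S -> algebraic_tensor T -> algebraic_tensor (S + T).
Proof.
move=> [k [A [X [h ->]]]] [l [B [Y [h' ->]]]].
exists (k + l)%N, (fun i => match fintype.split i with inl j => A j | inr j => B j end),
  (fun i => match fintype.split i with inl j => X j | inr j => Y j end); split.
  by move=> i; case: (fintype.split i).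
rewrite big_split_ord /=; congr (_ + _); apply: eq_bigr => i _.
- by case: split_ordP => j /eqP; rewrite ?eq_lshift ?eq_lrshift// => /eqP ->.
- by case: split_ordP => j /eqP; rewrite ?eq_rshift ?eq_rlshift// => /eqP ->.
Qed.

Lemma algebraic_tensor_sum (I : eqType) (s : seq I) (f : I -> H -> H) :
  (forall i, i \in s -> algebraic_tensor (f i)) -> algebraic_tensor (\sum_(i <- s) f i).
Proof.
elim: s => [|i s IH] h; first by rewrite big_nil; exists 0%N, (fun=> 0), (fun=> 0);
  split; [case|rewrite big_ord0].
rewrite big_cons; apply: algebraic_tensorD; first by apply: h; rewrite mem_head.
by apply: IH => j js; apply: h; rewrite in_cons js orbT.
Qed.

Lemma opnormC (S T : H -> H) : opnorm (S - T) = opnorm (T - S).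
Proof.
rewrite /opnorm; congr ereal_sup; apply: eq_imagel => x _.
by rewrite !fctE hdistC.
Qed.

Lemma spatial_tensor_lim (U : nat -> H -> H) S C : bounded_op C -> op_cvg U S ->
  (forall N, algebraic_tensor (C + U N)) -> spatial_tensor tens AF (C + S).
Proof.
move=> hC [hS hcv] hU; split; first exact: bounded_opD.
move=> eps eps0.
have [N _ hN] : \forall N \near \oo, (opnorm (U N - S)%R < eps%:E)%E.
  by apply: (hcv [set y | (y < _)%E]); apply: open_ereal_lt'; rewrite lte_fin.
exists (C + U N); first exact: hU.
by rewrite opnormC opprD addrACA subrr add0r; apply: hN => /=.
Qed.

End SpatialTensor.

(** * WOT-summability and square summability *)

Section WotSums.
Context {R : realType} {n : nat} {E F H : hilbertType R}.

(** With nonnegative terms, every finite sum of quadratic forms lies below the form of the limit,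
    which is bounded. *)
Lemma wot_summable_bound (P : pred (word n)) (u : word n -> E -> E) (v : word n -> E -> R) :
  (forall alpha x, P alpha -> inner (u alpha x) x = (v alpha x)%:C) ->
  (forall alpha x, 0 <= v alpha x) -> wot_summable P u ->
  exists2 M : R, 0 <= M & forall s x, uniq s ->
    \sum_(alpha <- s | P alpha) v alpha x <= M * hnorm x ^+ 2.
Proof.
move=> uv v0 [S hS hcv]; have [M M0 hM] := bounded_op_ge0 hS.
exists M => // s x us; apply/ler_addgt0Pr => eps eps0.
have /(@cvgrPdist_lt R[i] R[i]^o)/(_ eps%:C) := hcv x x.
rewrite ltcR => /(_ eps0)[J _ hJ].
(* [L] lies beyond the threshold J and its sum dominates the sum over s. *)
pose L := (J `|` seq_fset tt s)%fset.
have /hJ : (J `<=` L)%fset by exact: fsubsetUl.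
have -> : inner (word_psum P u L x) x = (\sum_(alpha <- L | P alpha) v alpha x)%:C.
  rewrite /word_psum fct_sumE inner_suml rmorph_sum /=.
  by apply: eq_bigr => al Pal; rewrite uv.
move=> h; have h1 : \sum_(alpha <- s | P alpha) v alpha x <= \sum_(alpha <- L | P alpha) v alpha x.
  have sL : (seq_fset tt s `<=` L)%fset by exact: fsubsetUr.
  rewrite (big_fset_sub _ _ sL) (perm_big _ (seq_fset_perm tt s)) undup_id//.
  by rewrite lerDl sumr_ge0.
apply: (le_trans h1); set p := \sum_(_ <- _ | _) _ in h *.
have h2 : `|Re (inner (S x) x) - p| < eps.
  have : normc (inner (S x) x - p%:C) < eps by rewrite -ltcR.
  case: (inner (S x) x) => a c /=; apply: le_lt_trans.
  by rewrite -sqrtr_sqr ler_wsqrtr// lerDl sqr_ge0.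
have h3 : Re (inner (S x) x) <= M * hnorm x ^+ 2.
  rewrite (le_trans (Re_inner_le _ _))// expr2 mulrA ler_wpM2r ?hnorm_ge0//.
move: h2; rewrite ltr_norml => /andP[h4 h5]; lra.
Qed.

Variables (e : word n -> F) (tens : E -> F -> H).
Hypotheses (e_basis : orthonormal_basis e) (tensP : hilbert_tensor tens).
Local Notation iota := (iota_op e tens).
Local Notation coord alpha := (adjoint (iota alpha)).

Lemma coord_iota alpha gamma x : coord alpha (iota gamma x) = if alpha == gamma then x else 0.
Proof.
apply: inner_ext => y; rewrite inner_adjointl; last exact: bounded_iota.
rewrite (iota_inner e_basis tensP) eq_sym; case: eqP => _; first by rewrite mulr1.
by rewrite mulr0 inner0l.
Qed.

Lemma coord_psum_cvg (P : pred (word n)) : exists2 Q : H -> H, bounded_op Q &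
  forall z, (fun J : {fset word n} => \sum_(alpha <- J | P alpha) iota alpha (coord alpha z))
    @ totally --> (Q z : H).
Proof.
pose U (J : {fset word n}) z := \sum_(alpha <- J | P alpha) iota alpha (coord alpha z).
have bio al := bounded_iota e_basis tensP al.
have Ul J : linear (U J).
  move=> c u v; rewrite /U scaler_sumr -big_split /=; apply: eq_bigr => al _.
  by rewrite (bounded_adjoint (bio al)).1 (bio al).1.
have UM J z : hnorm (U J z) <= 1 * hnorm z.
  rewrite mul1r; have [->|U0] := eqVneq (hnorm (U J z)) 0; first exact: hnorm_ge0.
  have pU : 0 < hnorm (U J z) by rewrite lt_def U0 hnorm_ge0.
  rewrite -(ler_pM2l pU) -expr2.
  (* [U J] is the orthogonal projection onto the components indexed by J and satisfying P, hence a
     contraction. *)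
  suff -> : hnorm (U J z) ^+ 2 = Re (inner (U J z) z) by exact: Re_inner_le.
  rewrite hnorm_sqr; congr Re; rewrite /U !inner_suml.
  rewrite -big_filter -[RHS]big_filter; set s := [seq _ <- _ | _].
  rewrite big_seq [RHS]big_seq; apply: eq_bigr => al als.
  rewrite inner_sumr -big_filter -/s (bigD1_seq al)//=; last by rewrite filter_uniq ?fset_uniq.
  rewrite (iota_same e_basis tensP) big1 ?addr0 => [|be ne].
    by rewrite -inner_adjoint// ; exact: bio.
  by rewrite (iota_orth e_basis tensP)// eq_sym.
have [|ga x|Q [Ql QM QE]] := sot_cvg (FG := totally_filter) (M := 1) ler01
    (iota_total e_basis tensP) (U := U) (G := totally).
- by apply: nearW => J; split.
- exists (if P ga then iota ga x else 0); apply: cvg_near_cst.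
  exists [fset ga]%fset => //= J gaJ; rewrite /U.
  have gaJ' : ga \in J by rewrite -fsub1set.
  rewrite -big_filter; case: ifPn => Pga.
    rewrite (bigD1_seq ga) ?filter_uniq ?fset_uniq ?mem_filter ?Pga//= coord_iota eqxx big1 ?addr0//.
    by move=> al ne; rewrite coord_iota (negbTE ne) (lin0 (bio al).1).
  rewrite big_filter big1// => al Pal; rewrite coord_iota.
  have [e1|_] := eqVneq al ga; last by rewrite (lin0 (bio al).1).
  by move: Pal; rewrite e1 (negbTE Pga).
by exists Q => //; split=> //; exists 1.
Qed.

(** The sum is the adjoint of R0, then the coordinate projection, then R0. Below, R0 is the first
    column of T for the A series and that of its adjoint for the B series. *)
Lemma wot_summable_coord (P : pred (word n)) (u : word n -> E -> E) (R0 : E -> H) :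
  bounded_op R0 ->
  (forall alpha x y, P alpha ->
     inner (u alpha x) y = inner (coord alpha (R0 x)) (coord alpha (R0 y))) ->
  wot_summable P u.
Proof.
move=> hR hu; have [Q hQ QE] := coord_psum_cvg P.
exists (adjoint R0 \o Q \o R0).
  by do 2?apply: bounded_op_comp => //; exact: bounded_adjoint.
move=> x y /=; rewrite inner_adjointl//.
have -> : (fun J => inner (word_psum P u J x) y) = (fun J : {fset word n} =>
    inner (\sum_(alpha <- J | P alpha) iota alpha (coord alpha (R0 x))) (R0 y)).
  apply/funext => J; rewrite /word_psum fct_sumE !inner_suml; apply: eq_bigr => al Pal.
  by rewrite hu// [RHS]inner_adjoint//; exact: (bounded_iota e_basis tensP).
exact: inner_cvg.
Qed.

End WotSums.

(** * Multi-Toeplitz operators and the matrix of the Fourier coefficients *)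

Section Toeplitz.
Context {R : realType} {n : nat} {E F H : hilbertType R}.
Variables (e : word n -> F) (tens : E -> F -> H) (b : word n -> R).
Hypotheses (e_basis : orthonormal_basis e) (tensP : hilbert_tensor tens).
Hypotheses (b_gt0 : forall w, 0 < b w) (b_nil : b [::] = 1).
Variables (A B : word n -> E -> E).
Local Notation iota := (iota_op e tens).
Local Notation sh := (shift_coef b).
Local Notation entries := (entries_at e tens b A B (fun=> 1)).

Lemma entryP T omega gamma : bounded_op T -> bounded_op (entry e tens T omega gamma) /\
  forall x y, inner (entry e tens T omega gamma x) y = inner (T (iota gamma x)) (iota omega y).
Proof.
move=> hT; have bio al := bounded_iota e_basis tensP al.
suff : exists C : E -> E, bounded_op C /\
    forall x y, inner (C x) y = inner (T (iota gamma x)) (iota omega y) by move=> /(xgetPex 0).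
exists (adjoint (iota omega) \o T \o iota gamma); split.
  by do 2?apply: bounded_op_comp => //; exact: bounded_adjoint.
by move=> x y /=; rewrite inner_adjointl.
Qed.

Lemma rweight_catl alpha gamma : rweight b (alpha ++ gamma) gamma = (sh alpha gamma)^-1.
Proof. by rewrite /rweight /rge suffix_suffix /shift_coef -sqrtrV ?invf_div// divr_ge0// ltW. Qed.

Lemma rweight_catr alpha gamma : nontrivial alpha ->
  rweight b gamma (alpha ++ gamma) = (sh alpha gamma)^-1.
Proof.
move=> al0; rewrite /rweight /rge.
have -> : suffix (alpha ++ gamma) gamma = false.
  apply/negbTE/negP => /size_suffix; rewrite size_cat -{2}[size gamma]add0n leq_add2r leqn0.
  by rewrite size_eq0 (negbTE al0).
by rewrite /shift_coef -sqrtrV ?invf_div// divr_ge0// ltW.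
Qed.

Lemma shift_coef_gt0 alpha gamma : 0 < sh alpha gamma.
Proof. by rewrite sqrtr_gt0 divr_gt0. Qed.

Lemma shift_coef_cat_nil alpha : sh alpha [::] = (Num.sqrt (b alpha))^-1.
Proof. by rewrite /shift_coef cats0 b_nil div1r sqrtrV// ltW. Qed.

Lemma multi_Toeplitz_entries T : multi_Toeplitz e tens b T ->
  fourier_representation e tens b A B T ->
  forall gamma x, entries gamma x (T (iota gamma x)).
Proof.
move=> [hT hw h0] [fA fB] gamma x.
have en om ga := (entryP om ga hT).2.
(* The Toeplitz relation appends a letter on the right of both words; removing the letters of [de]
   from the end leads back to the first column, where the Fourier coefficient is read off. *)
have hA al de : (sh al de)^-1%:C *: entry e tens T (al ++ de) de =
    (Num.sqrt (b al))%:C *: entry e tens T al [::].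
  elim/last_ind: de => [|de i IH]; first by rewrite cats0 shift_coef_cat_nil invrK.
  by have := hw i _ _ (rcomparable_cat al de); rewrite rcons_cat !rweight_catl => ->.
have hB al de : nontrivial al -> (sh al de)^-1%:C *: entry e tens T de (al ++ de) =
    (Num.sqrt (b al))%:C *: entry e tens T [::] al.
  move=> al0; elim/last_ind: de => [|de i IH]; first by rewrite cats0 shift_coef_cat_nil invrK.
  have := hw i de (al ++ de); rewrite rcomparableC rcomparable_cat => /(_ isT).
  by rewrite rcons_cat !rweight_catr// => ->.
have shK al de (c : R[i]) : c = (sh al de)%:C * ((sh al de)^-1%:C * c).
  by rewrite mulrA -rmorphM /= divff ?mul1r// gt_eqF// shift_coef_gt0.
split.
- move=> al y; rewrite -en [LHS](shK al gamma) mul1r; congr (_ * _).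
  by have /= := congr1 (fun f => inner (f x) y) (hA al gamma); rewrite !fctE !innerZl !en fA.
- move=> al de y al0 ->; rewrite -en [LHS](shK al de) mul1r; congr (_ * _).
  by have /= := congr1 (fun f => inner (f x) y) (hB al de al0); rewrite !fctE !innerZl !en fB.
- by move=> om y nc; rewrite -en h0// inner0l.
Qed.

Lemma entries_multi_Toeplitz T : bounded_op T ->
  (forall gamma x, entries gamma x (T (iota gamma x))) ->
  multi_Toeplitz e tens b T /\ fourier_representation e tens b A B T.
Proof.
move=> hT hE; have en om ga := (entryP om ga hT).2.
have shK al de (c : R[i]) : (sh al de)^-1%:C * ((sh al de)%:C * c) = c.
  by rewrite mulrA -rmorphM /= mulVf ?mul1r// gt_eqF// shift_coef_gt0.
have hA al de : (rweight b (al ++ de) de)%:C *: entry e tens T (al ++ de) de = A al.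
  apply/funext => x; apply: inner_ext => y; rewrite fctE innerZl en rweight_catl.
  by have [-> _ _] := hE de x; rewrite mul1r shK.
have hB al de : nontrivial al -> (rweight b de (al ++ de))%:C *: entry e tens T de (al ++ de) = B al.
  move=> al0; apply/funext => x; apply: inner_ext => y; rewrite fctE innerZl en rweight_catr//.
  by have [_ h _] := hE (al ++ de) x; rewrite (h al de)// mul1r shK.
split; split=> //.
- move=> i om ga /[dup] cmp; case: (rcomparableP om ga) => [[al ->]|[al al0 ->]|/negP//] _.
    by rewrite rcons_cat !hA.
  by rewrite rcons_cat !hB.
- move=> al be nc; apply/funext => x; apply: inner_ext => y; rewrite en inner0l.
  by have [_ _ ->] := hE be x.
- move=> al x y; have [h _ _] := hE [::] x; have := h al y.
  rewrite cats0 mul1r shift_coef_cat_nil /iota_op => ->.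
  by rewrite mulrA -rmorphM /= divff ?mul1r// gt_eqF// sqrtr_gt0.
- move=> al x y al0; have [_ h _] := hE al x; have := h al [::] y al0.
  rewrite cats0 mul1r shift_coef_cat_nil /iota_op => -> //.
  by rewrite mulrA -rmorphM /= divff ?mul1r// gt_eqF// sqrtr_gt0.
Qed.

Lemma fourier_wot_A T : bounded_op T -> fourier_representation e tens b A B T ->
  (forall alpha, bounded_op (A alpha)) ->
  wot_summable nontrivial (fun alpha => ((b alpha)^-1)%:C *: (adjoint (A alpha) \o A alpha)).
Proof.
move=> hT [fA _] hA; have bio al := bounded_iota e_basis tensP al.
apply: (wot_summable_coord e_basis tensP (R0 := T \o iota [::])); first exact: bounded_op_comp.
move=> al x y _; rewrite fctE innerZl /= inner_adjointl//.
have AE z : A al z = (Num.sqrt (b al))%:C *: adjoint (iota al) (T (iota [::] z)).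
  by apply: inner_ext => v; rewrite fA innerZl inner_adjointl.
rewrite !AE innerZl innerZr conjc_real mulrA -!rmorphM mulrA -!rmorphM /=.
by rewrite -mulrA -expr2 sqr_sqrtr ?ltW// mulVf ?mul1r// gt_eqF.
Qed.

Lemma fourier_wot_B T : bounded_op T -> fourier_representation e tens b A B T ->
  (forall alpha, nontrivial alpha -> bounded_op (B alpha)) ->
  wot_summable nontrivial (fun alpha => ((b alpha)^-1)%:C *: (B alpha \o adjoint (B alpha))).
Proof.
move=> hT [_ fB] hB; have bio al := bounded_iota e_basis tensP al.
apply: (wot_summable_coord e_basis tensP (R0 := adjoint T \o iota [::])).
  by apply: bounded_op_comp => //; exact: bounded_adjoint.
move=> al x y al0; rewrite fctE innerZl /= inner_adjoint; last exact: hB.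
have BE z : adjoint (B al) z = (Num.sqrt (b al))%:C *: adjoint (iota al) (adjoint T (iota [::] z)).
  apply: inner_ext => v; rewrite inner_adjointl; last exact: hB.
  rewrite inner_conj fB// rmorphM /= oppr0 -inner_conj innerZl inner_adjointl//.
  by rewrite inner_adjointl.
rewrite !BE innerZl innerZr conjc_real mulrA -!rmorphM mulrA -!rmorphM /=.
by rewrite -mulrA -expr2 sqr_sqrtr ?ltW// mulVf ?mul1r// gt_eqF.
Qed.

End Toeplitz.

(** * Operator norms of strong limits and on dense subspaces *)

Section OpnormLimits.
Context {R : realType} {H K : hilbertType R}.

(** A unit vector almost norming for T is almost norming for [U r] with r near 1, and the upper
    bound is assumed; monotonicity in r does not enter. *)
Lemma sot_opnorm (U : R -> H -> K) (T : H -> K) : bounded_op T ->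
  (forall r, 0 <= r < 1 -> bounded_op (U r)) ->
  (forall r, 0 <= r < 1 -> (opnorm (U r) <= opnorm T)%E) ->
  (forall z, U r z @[r --> 1^'-] --> (T z : K)) ->
  opnorm T = ereal_sup [set opnorm (U r) | r in `[0%R, 1%R[] /\
  opnorm (U r) @[r --> 1^'-] --> opnorm T.
Proof.
move=> hT hU UT hcv; have [t t0 tE] := opnorm_fin hT.
have sup_le : (ereal_sup [set opnorm (U r) | r in `[0%R, 1%R[] <= opnorm T)%E.
  by apply: ub_ereal_sup => _ [r /= r01 <-]; apply: UT; rewrite in_itv /= in r01.
split; last first.
  rewrite tE; apply: ereal_cvg_fin => eps eps0.
  have e2 : 0 < eps / 2 by rewrite divr_gt0.
  have : ereal_sup [set (hnorm (T x))%:E | x in [set x : H | hnorm x <= 1]] \is a fin_num.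
    by rewrite -/(opnorm T) tE.
  move=> /(ub_ereal_sup_adherent e2)[_ [x /= x1 <-]].
  rewrite -/(opnorm T) tE -EFinB lte_fin => hx.
  have /hcvgP/(_ _ e2) := hcv x; apply: filterS2 (near_left1 R) => r r01 hr.
  have [u u0 uE] := opnorm_fin (hU _ r01); exists u => //.
  have ut : u <= t by rewrite -lee_fin -uE -tE; exact: UT.
  have xu : hnorm (U r x) <= u by rewrite -lee_fin -uE; exact: opnorm_ub.
  have h1 : hnorm (T x) <= hnorm (U r x - T x) + hnorm (U r x).
    by rewrite -{1}(subrK (U r x) (T x)) (le_trans (ler_hnormD _ _))// hdistC.
  by rewrite ler0_norm ?subr_le0//; lra.
apply/eqP; rewrite eq_le sup_le andbT.
have s0 : (0 <= ereal_sup [set opnorm (U r) | r in `[0%R, 1%R[])%E.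
  apply: le_trans (opnorm_ge0 (U 0)) _; apply: ereal_sup_ubound; exists 0 => //=.
  by rewrite in_itv /= lexx ltr01.
have [s sE] : exists s : R, ereal_sup [set opnorm (U r) | r in `[0%R, 1%R[] = s%:E.
  move: s0 sup_le; rewrite tE; case: (ereal_sup _) => [s| |]//= _ _; by exists s.
rewrite sE; have s0' : 0 <= s by rewrite -lee_fin -sE.
apply: le_opnorm => // z; apply: (@ler_addgt0_mul _ _ _ 1) => // eps eps0; rewrite mul1r.
have /hcvgP/(_ _ eps0) hz := hcv z.
have [r [r01 hr]] := filter_ex (filterI (near_left1 R) hz).
have h1 : hnorm (T z) <= hnorm (U r z - T z) + hnorm (U r z).
  by rewrite -{1}(subrK (U r z) (T z)) (le_trans (ler_hnormD _ _))// hdistC.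
have h2 : hnorm (U r z) <= s * hnorm z.
  apply: opnorm_le; first exact: (hU _ r01).1.
  by rewrite -sE; apply: ereal_sup_ubound; exists r => //=; rewrite in_itv.
lra.
Qed.

(** Closure of D under real scaling turns the supremum over its unit ball into a bound on all of D,
    which then passes to the closure. *)
Lemma opnorm_dense (D : set H) (T : H -> K) : bounded_op T ->
  (forall (c : R) q, D q -> D (c%:C *: q)) ->
  (forall z (eps : R), 0 < eps -> exists2 q, D q & hnorm (z - q) < eps) ->
  opnorm T = ereal_sup [set (hnorm (T q))%:E | q in D `&` [set q | hnorm q <= 1]].
Proof.
move=> hT Dscale Ddense; set S := [set _ | _ in _].
have sup_le : (ereal_sup S <= opnorm T)%E.
  by apply: ub_ereal_sup => _ [q [_ q1] <-]; exact: opnorm_ub.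
have [q0 Dq0] : D !=set0 by have [q Dq _] := Ddense 0 1 ltr01; exists q.
have D0 : D 0 by have := Dscale 0 _ Dq0; rewrite scale0r.
have s0 : (0 <= ereal_sup S)%E.
  apply: (@le_trans _ _ (hnorm (T 0))%:E); first by rewrite lee_fin hnorm_ge0.
  by apply: ereal_sup_ubound; exists 0 => //; split=> //=; rewrite hnorm0 ler01.
have [t t0 tE] := opnorm_fin hT.
have [s sE] : exists s : R, ereal_sup S = s%:E.
  move: s0 sup_le; rewrite tE; case: (ereal_sup _) => [s| |]//= _ _; by exists s.
have s0' : 0 <= s by rewrite -lee_fin -sE.
apply/eqP; rewrite eq_le sup_le andbT sE.
have Dle q : D q -> hnorm (T q) <= s * hnorm q.
  move=> Dq; have [x0|x0] := eqVneq (hnorm q) 0.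
    by rewrite x0 mulr0 (hnorm0_eq0 x0) (lin0 hT.1) hnorm0.
  have px : 0 < hnorm q by rewrite lt_def x0 hnorm_ge0.
  have : ((hnorm (T (((hnorm q)^-1)%:C *: q)))%:E <= s%:E)%E.
    rewrite -sE; apply: ereal_sup_ubound; exists (((hnorm q)^-1)%:C *: q) => //; split.
      exact: Dscale.
    by rewrite /= hnormZr ger0_norm ?invr_ge0 ?hnorm_ge0// mulVf.
  rewrite lee_fin (linZ hT.1) hnormZr ger0_norm ?invr_ge0 ?hnorm_ge0//.
  by rewrite mulrC ler_pdivrMr.
have TM := opnorm_le (M := t) hT.1; rewrite tE lexx in TM; have {}TM := TM isT.
apply: le_opnorm => // z; apply: (@ler_addgt0_mul _ _ _ (t + s)); first exact: addr_ge0.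
move=> eps eps0; have [q Dq hq] := Ddense z _ eps0.
have -> : T z = T (z - q) + T q by rewrite -(linD hT.1) subrK.
rewrite (le_trans (ler_hnormD _ _))//.
have h1 := TM (z - q); have h2 := Dle _ Dq.
have h3 : hnorm q <= hnorm z + eps.
  rewrite -{1}(subrK z q) addrC (le_trans (ler_hnormD _ _))//.
  by rewrite lerD2l hdistC ltW.
have h4 : t * hnorm (z - q) <= t * eps by rewrite ler_wpM2l// ltW.
have h5 : s * hnorm q <= s * (hnorm z + eps) by rewrite ler_wpM2l.
lra.
Qed.

End OpnormLimits.

Section PolynomialSpace.
Context {R : realType} {n : nat} {E F H : hilbertType R}.
Variables (e : word n -> F) (tens : E -> F -> H).
Hypotheses (e_basis : orthonormal_basis e) (tensP : hilbert_tensor tens).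

Lemma E_poly_dense z (eps : R) : 0 < eps -> exists2 q, E_poly e tens q & hnorm (z - q) < eps.
Proof.
move=> eps0; have [s hs] := iota_total e_basis tensP z eps0.
exists (\sum_(p <- s) iota_op e tens p.1 p.2) => //.
exists (undup (unzip1 s)), (fun i => \sum_(p <- s | p.1 == i) p.2).
exact: (sum_by_fst _ (fun i => linD (iota_lin e tensP i))).
Qed.

Lemma E_polyZ (c : R[i]) q : E_poly e tens q -> E_poly e tens (c *: q).
Proof.
move=> [s [h ->]]; exists s, (fun al => c *: h al); rewrite scaler_sumr.
by apply: eq_bigr => al _; rewrite (linZ (tens_linearl tensP _)).
Qed.

End PolynomialSpace.

(** * The two directions and the properties (a), (b), (c) *)

Section Fourier.
Context {R : realType} {n m : nat} {E F H : hilbertType R}.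
Variables (e : word n -> F) (tens : E -> F -> H) (b : word n -> R).
Hypotheses (m_gt0 : (0 < m)%N).
Hypotheses (e_basis : orthonormal_basis e) (tensP : hilbert_tensor tens).
Hypotheses (b_gt0 : forall w, 0 < b w) (b_nil : b [::] = 1).
Local Notation D k := ('C(k + m - 1, m - 1)%:R : R).
Hypothesis b_cat : forall beta gamma,
  b beta * b gamma <= D (size beta) * b (beta ++ gamma).
Hypothesis b_catr : forall beta gamma,
  b beta * b gamma <= D (size gamma) * b (beta ++ gamma).
Variables (A B : word n -> E -> E).
Hypotheses (A_bd : forall alpha, bounded_op (A alpha)).
Hypotheses (B_bd : forall alpha, nontrivial alpha -> bounded_op (B alpha)).
Local Notation iota := (iota_op e tens).
Local Notation phi := (phi_r e tens b A B).
Local Notation wotA := (wot_summable nontrivial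
  (fun alpha => ((b alpha)^-1)%:C *: (adjoint (A alpha) \o A alpha))).
Local Notation wotB := (wot_summable nontrivial
  (fun alpha => ((b alpha)^-1)%:C *: (B alpha \o adjoint (B alpha)))).

Definition square_summable (M : R) (X : word n -> E -> E) := forall s x, uniq s ->
  \sum_(alpha <- s | nontrivial alpha) (b alpha)^-1 * hnorm (X alpha x) ^+ 2 <=
  M * hnorm x ^+ 2.

Lemma wot_square_summable : wotA -> wotB -> exists M : R,
  [/\ 0 <= M, square_summable M A & square_summable M (fun alpha => adjoint (B alpha))].
Proof.
have v0 (X : word n -> E -> E) al x : 0 <= (b al)^-1 * hnorm (X al x) ^+ 2.
  by rewrite mulr_ge0 ?sqr_ge0// invr_ge0 ltW.
move=> /(@wot_summable_bound R n E _ _ (fun al x => (b al)^-1 * hnorm (A al x) ^+ 2)) hA.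
have [|//|MA MA0 hMA] := hA.
  by move=> al x _; rewrite fctE innerZl inner_adjointl//= inner_hnorm -rmorphM.
move=> /(@wot_summable_bound R n E _ _ (fun al x => (b al)^-1 * hnorm (adjoint (B al) x) ^+ 2)) hB.
have [|al x|MB MB0 hMB] := hB; [|exact: (v0 (fun al => adjoint (B al)))|].
  move=> al x al0; rewrite fctE innerZl inner_adjoint; last exact: B_bd.
  by rewrite inner_hnorm -rmorphM.
exists (MA + MB); split; first exact: addr_ge0.
- by move=> s x us; apply: le_trans (hMA s x us) _; rewrite ler_wpM2r ?sqr_ge0// lerDl.
- by move=> s x us; apply: le_trans (hMB s x us) _; rewrite ler_wpM2r ?sqr_ge0// lerDr.
Qed.

Section Summable.
Variable M : R.
Hypotheses (M_ge0 : 0 <= M) (A_M : square_summable M A).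
Hypothesis B_M : square_summable M (fun alpha => adjoint (B alpha)).

Let phi_bd r := bounded_phi_r m_gt0 e_basis tensP b_gt0 b_cat A_bd B_bd M_ge0 A_M B_M (r := r).

Lemma phi_r_star_plus r : 0 <= r < 1 ->
  star_plus (spatial_tensor tens (domain_algebra e b)) (phi r).
Proof.
move=> r01; have [S1 [S2 [h1 h2 _ ->]]] :=
  phi_rP m_gt0 e_basis tensP b_gt0 b_cat A_bd B_bd M_ge0 A_M B_M r01.
have sh_bd := shift_coef_bounded b_gt0 b_cat.
have dom c al : domain_algebra e b (c *: creation_word e b al).
  apply: (domain_algebra_creation_word e_basis b_gt0) => i.
  have [C hC] := sh_bd [:: i]; exists (C ^+ 2) => ga.
  rewrite -[leLHS](shift_coef_sqr b_gt0 [:: i] ga).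
  have s0 := shift_coef_ge0 b [:: i] ga.
  by rewrite ler_pXn2r ?nnegrE ?(le_trans s0).
have alg (X : word n -> E -> E) N : (forall al, nontrivial al -> bounded_op (X al)) ->
    algebraic_tensor tens (domain_algebra e b) (phi_r_Apsum e tens b X r N).
  move=> hX; apply: algebraic_tensor_sum => k; rewrite mem_index_iota => /andP[k0 _].
  apply: algebraic_tensor_sum => al _; apply: algebraic_tensor1; last exact: dom.
  by apply: hX; exact: tuple_nontrivial.
(* The constant term joins the summand that is not adjoined; [S1] is the creation series whose
   coefficients are the adjoints of B_alpha. *)
exists S1, (tensop tens (A [::]) id + S2); split; last by rewrite addrA.
- rewrite -[S1]add0r; apply: (spatial_tensor_lim (bounded_op0 _ _) h1) => N.
  by rewrite add0r; apply: alg => al /B_bd; exact: bounded_adjoint.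
- apply: (spatial_tensor_lim _ h2).
    exact: (tensop_idP e_basis tensP b_gt0 b_cat (A_bd [::])).1.
  move=> N; apply: algebraic_tensorD; last by apply: alg => al _; exact: A_bd.
  by apply: algebraic_tensor1 => //; have := dom 1 [::]; rewrite scale1r.
Qed.

Variable T : H -> H.
Hypotheses (T_bd : bounded_op T)
  (T_entries : forall gamma x, entries_at e tens b A B (fun=> 1) gamma x (T (iota gamma x))).

Let phi_W_T gamma x : phi_W e tens b A B (iota gamma x) = T (iota gamma x).
Proof.
apply: (entries_at_unique e_basis tensP) (T_entries gamma x).
exact: (phi_W_iota e_basis tensP b_gt0 b_cat b_catr A_bd B_bd A_M).
Qed.

Lemma phi_r_opnorm_le r : 0 <= r < 1 -> (opnorm (phi r) <= opnorm T)%E.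
Proof.
move=> r01; have [t t0 tE] := opnorm_fin T_bd; rewrite tE.
apply: le_opnorm => //; apply: (schur_bound e_basis tensP t0 r01 T_bd) => //.
- by apply: opnorm_le; [exact: T_bd.1|rewrite tE].
- exact: phi_bd.
move=> ga om x y; have r01' : 0 <= r <= 1 by case/andP: r01 => -> /ltW.
have [U [_ _ _ hU]] := damp_ex e_basis tensP (size ga) r01'.
rewrite (phi_r_damp m_gt0 e_basis tensP b_gt0 b_cat b_catr A_bd B_bd M_ge0 A_M B_M x r01 hU).
by rewrite hU phi_W_T /degdist addnC.
Qed.

Lemma phi_r_sot_cvg z : phi r z @[r --> 1^'-] --> (T z : H).
Proof.
have [t t0 tE] := opnorm_fin T_bd.
have [|S [hS SE Scv]] := phi_r_sot m_gt0 e_basis tensP b_gt0 b_cat b_catr A_bd B_bd M_ge0 A_M B_M t0.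
  move=> r z' r01; apply: opnorm_le; first exact: (phi_bd r01).1.
  by rewrite -tE; exact: phi_r_opnorm_le.
have -> : T = S; last exact: Scv.
apply: (iota_op_eq e_basis tensP) => // ga x.
exact: (entries_at_unique e_basis tensP) (T_entries _ _) (SE _ _).
Qed.

Lemma phi_W_opnorm : opnorm T = ereal_sup [set (hnorm (phi_W e tens b A B q))%:E
  | q in E_poly e tens `&` [set q | hnorm q <= 1]].
Proof.
rewrite (@opnorm_dense _ _ _ (E_poly e tens) T)//.
- congr ereal_sup; apply: eq_imagel => q [qp _].
  by rewrite (phi_W_poly e_basis tensP b_gt0 b_cat b_catr A_bd B_bd A_M T_bd T_entries qp).
- by move=> c q; exact: E_polyZ.
- by move=> z eps; exact: E_poly_dense.
Qed.

End Summable.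

Lemma multi_Toeplitz_data T : multi_Toeplitz e tens b T ->
  fourier_representation e tens b A B T ->
  [/\ bounded_op T, wotA, wotB
    & forall gamma x, entries_at e tens b A B (fun=> 1) gamma x (T (iota gamma x))].
Proof.
move=> hT hF; have hT1 : bounded_op T by case: hT.
split=> //.
- exact: (fourier_wot_A e_basis tensP b_gt0 hT1 hF).
- exact: (fourier_wot_B e_basis tensP b_gt0 hT1 hF).
- exact: (multi_Toeplitz_entries e_basis tensP b_gt0 b_nil hT hF).
Qed.

Lemma multi_Toeplitz_exists : wotA -> wotB ->
  (ereal_sup [set opnorm (phi r) | r in `[0%R, 1%R[] < +oo)%E ->
  exists T, multi_Toeplitz e tens b T /\ fourier_representation e tens b A B T.
Proof.
move=> hA hB; have [M [M0 AM BM]] := wot_square_summable hA hB.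
set S := ereal_sup _ => S_oo.
have s0 : (0 <= S)%E.
  apply: le_trans (opnorm_ge0 (phi 0)) _; apply: ereal_sup_ubound; exists 0 => //=.
  by rewrite in_itv /= lexx ltr01.
have [s sE] : exists s : R, S = s%:E.
  by move: s0 S_oo; case: S => [s| |]//= _ _; exists s.
have s0' : 0 <= s by rewrite -lee_fin -sE.
have [|T [hT TE _]] := phi_r_sot m_gt0 e_basis tensP b_gt0 b_cat b_catr A_bd B_bd M0 AM BM s0'.
  move=> r z r01; apply: opnorm_le.
    exact: (bounded_phi_r m_gt0 e_basis tensP b_gt0 b_cat A_bd B_bd M0 AM BM r01).1.
  by rewrite -sE; apply: ereal_sup_ubound; exists r => //=; rewrite in_itv.
exists T; exact: (entries_multi_Toeplitz e_basis tensP b_gt0 b_nil hT TE).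
Qed.

End Fourier.

Theorem theorem2p3 (R : realType) (n m : nat) (n_gt0 : (0 < n)%N)
    (m_gt0 : (0 < m)%N)
    (* coefficient space *)
    (E : hilbertType R) (sepE : separable_space E)
    (* positive regular free holomorphic function *)
    (a : word n -> R) (a_posreg : positive_regular a)
    (* full Fock space *)
    (F : hilbertType R) (e : word n -> F) (e_basis : orthonormal_basis e)
    (* tensor product of E and the Fock space *)
    (H : hilbertType R) (tens : E -> F -> H) (tensP : hilbert_tensor tens)
    (A B : word n -> E -> E)
    (A_bounded : forall alpha, bounded_op (A alpha))
    (B_bounded : forall alpha, nontrivial alpha -> bounded_op (B alpha)) :
  let b := bcoef m a in
  let phi := phi_r e tens b A B in
  ((exists T : H -> H,
      multi_Toeplitz e tens b T /\ fourier_representation e tens b A B T)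
   <->
   ([/\ wot_summable nontrivial
          (fun alpha => ((b alpha)^-1)%:C *: (adjoint (A alpha) \o A alpha)),
        wot_summable nontrivial
          (fun alpha => ((b alpha)^-1)%:C *: (B alpha \o adjoint (B alpha)))
      & (ereal_sup [set opnorm (phi r) | r in `[0%R, 1%R[] < +oo)%E]))
  /\
  (forall T : H -> H,
    multi_Toeplitz e tens b T -> fourier_representation e tens b A B T ->
    [/\ (* (a) *)
        forall r : R, 0 <= r < 1 ->
          [/\ exists S, op_cvg (phi_r_Bpsum e tens b B r) S,
              exists S, op_cvg (phi_r_Apsum e tens b A r) S
            & star_plus (spatial_tensor tens (domain_algebra e b)) (phi r)],
        (* (b) *)
        forall x : H, phi r x @[r --> 1^'-] --> T x
      & (* (c) *)
        [/\ opnorm T = ereal_sup [set opnorm (phi r) | r in `[0%R, 1%R[],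
            opnorm (phi r) @[r --> 1^'-] --> opnorm T
          & opnorm T =
            ereal_sup [set (hnorm (phi_W e tens b A B q))%:E
                      | q in E_poly e tens `&` [set q | hnorm q <= 1]]]]).
Proof.
move=> b phi.
have a0 := posreg_ge0 a_posreg.
have b_gt0 w : 0 < b w by apply: bcoef_gt0 => //; exact: posreg_gen.
have b_nil : b [::] = 1 by exact: bcoef_nil.
have b_cat be ga := bcoef_cat (m := m) (a := a) be ga m_gt0 a0.
have b_catr be ga := bcoef_catr (m := m) (a := a) be ga m_gt0 a0.
have data := multi_Toeplitz_data e_basis tensP b_gt0 b_nil A_bounded B_bounded.
split; first split.
- move=> [T [hT hF]]; have [T_bd hA hB TE] := data _ hT hF.
  have [M [M0 AM BM]] := wot_square_summable b_gt0 A_bounded B_bounded hA hB.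
  split=> //; have [t t0 tE] := opnorm_fin T_bd.
  apply: (@le_lt_trans _ _ (opnorm T)); last by rewrite tE ltry.
  apply: ub_ereal_sup => _ [r /= r01 <-]; rewrite in_itv /= in r01.
  exact: (phi_r_opnorm_le m_gt0 e_basis tensP b_gt0 b_cat b_catr A_bounded B_bounded M0 AM BM).
- move=> [hA hB hS].
  exact: (multi_Toeplitz_exists m_gt0 e_basis tensP b_gt0 b_nil b_cat b_catr A_bounded B_bounded).
move=> T hT hF; have [T_bd hA hB TE] := data _ hT hF.
have [M [M0 AM BM]] := wot_square_summable b_gt0 A_bounded B_bounded hA hB.
have sot := phi_r_sot_cvg m_gt0 e_basis tensP b_gt0 b_cat b_catr A_bounded B_bounded M0 AM BM T_bd TE.
have [sup_eq sup_cvg] : opnorm T = ereal_sup [set opnorm (phi r) | r in `[0%R, 1%R[] /\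
    opnorm (phi r) @[r --> 1^'-] --> opnorm T.
  apply: sot_opnorm => // r r01.
    exact: (bounded_phi_r m_gt0 e_basis tensP b_gt0 b_cat A_bounded B_bounded M0 AM BM r01).
  exact: (phi_r_opnorm_le m_gt0 e_basis tensP b_gt0 b_cat b_catr A_bounded B_bounded M0 AM BM).
split=> // [r r01|].
- have [S1 [S2 [_ h2 h3 _]]] :=
    phi_rP m_gt0 e_basis tensP b_gt0 b_cat A_bounded B_bounded M0 AM BM r01.
  split; [by exists (adjoint S1)|by exists S2|].
  exact: (phi_r_star_plus m_gt0 e_basis tensP b_gt0 b_cat A_bounded B_bounded M0 AM BM r01).
- split=> //.
  exact: (phi_W_opnorm e_basis tensP b_gt0 b_cat b_catr A_bounded B_bounded AM T_bd TE).
Qed.
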